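(* Let $X$ be a finite set of self-adjoint generators for the $\mathrm{II}_1$ factor $(M,\tau)$. Then $$\delta_0(X)\leq 1+\mathcal I(X).$$
   Context: $\tau$ is the faithful normal trace on $M$ with $\tau(1)=1$; ''generators'' means generating $M$ as a von Neumann algebra. Let $\mathcal P(M)$ be the collection of all finite sets of mutually orthogonal projections in $M$ which sum to $1$. For $x\in M$ and $P\in\mathcal P(M)$ put $\mathcal I(x;P)=\sum_{p,q\in P,\ pxq\neq 0}\tau(p)\tau(q)$; for a finite subset $X\subset M$ put $\mathcal I(X;P)=\sum_{x\in X}\mathcal I(x;P)$ and $\mathcal I(X)=\inf_{P\in\mathcal P(M)}\mathcal I(X;P)$. Let $\mathrm{tr}_k$ be the trace on $\mathbb M_k(\mathbb C)$ with $\mathrm{tr}_k(1)=1$. For $X=\{x_1,\dots,x_n\}\subset M$, $\gamma>0$, $m,k\in\mathbb N$, $R>0$, the microstate space $\Gamma_R(X;m,k,\gamma)$ is the set of $n$-tuples $(a_1,\dots,a_n)$ of $k\times k$ matrices with operator norms $\|a_i\|\leq R$ and $$\left|\tau(x_{i_1}^{j_1}\cdots x_{i_p}^{j_p})-\mathrm{tr}_k(a_{i_1}^{j_1}\cdots a_{i_p}^{j_p})\right|<\gamma$$ for all $p\leq m$, $i_1,\dots,i_p\in\{1,\dots,n\}$, $j_1,\dots,j_p\in\{1,*\}$. (When all $x_i$ are self-adjoint, it makes no difference to the value of $\delta_0(X)$ whether the $a_i$ are required to be self-adjoint.) Equip $(\mathbb M_k(\mathbb C))^n$ with the norm $\|(a_1,\dots,a_n)\|_2=\left(\sum_{l=1}^n\mathrm{tr}_k(a_l^*a_l)\right)^{1/2}$.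 For a metric space $Y$, $K_\varepsilon(Y)$ is the minimal cardinality of an $\varepsilon$-net for $Y$. Define $$\mathbb K_{\varepsilon,R}(X;m,\gamma)=\limsup_{k\to\infty}k^{-2}\log K_\varepsilon(\Gamma_R(X;m,k,\gamma)),\quad \mathbb K_{\varepsilon,R}(X)=\inf_{m\in\mathbb N,\gamma>0}\mathbb K_{\varepsilon,R}(X;m,\gamma),$$ $\mathbb K_\varepsilon(X)=\sup_{R>0}\mathbb K_{\varepsilon,R}(X)$ (with $\log 0=-\infty$). The modified free entropy dimension is $$\delta_0(X)=\limsup_{\varepsilon\to0}\frac{\mathbb K_\varepsilon(X)}{|\log\varepsilon|}.$$ *)

(* Defs.v *)
From HB Require Import structures.
From mathcomp Require Import all_boot all_order all_algebra.
From mathcomp Require Import complex.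
From mathcomp Require Import all_classical all_reals all_analysis.

Set Implicit Arguments.
Unset Strict Implicit.
Unset Printing Implicit Defensive.

Import Order.TTheory GRing.Theory Num.Theory.
Import numFieldNormedType.Exports.

Local Open Scope complex_scope.
Local Open Scope classical_set_scope.
Local Open Scope ring_scope.

Section VonNeumannAlgebras.
Context {R : realType} {H : completeNormedModType R[i]}.
Variable ip : {dot H for Num.conj}.

(* H is a Hilbert space: its (complete) norm is the one given by the inner
   product ip, which is linear in its first argument. *)
Definition hilbert_space := forall v : H, `|v| ^+ 2 = ip v v.

Definition bounded_operator (T : H -> H) := linear T /\ continuous T.

(* Meaningful when T is a bounded operator on a Hilbert space (and then
   existence and uniqueness follow from the Riesz theorem). *)
Definition adjoint (T : H -> H) : H -> H :=
  xget (fun=> 0)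
    [set S | bounded_operator S /\ forall v w, ip (T v) w = ip v (S w)].

Definition commutant (A : set (H -> H)) : set (H -> H) :=
  [set T | bounded_operator T /\ forall S, A S -> T \o S = S \o T].

Definition von_neumann_algebra (M : set (H -> H)) :=
  (forall T, M T -> M (adjoint T)) /\ M = commutant (commutant M).

(* M is the von Neumann algebra generated by the range of x. *)
Definition generates (M : set (H -> H)) (I : Type) (x : I -> H -> H) :=
  [/\ von_neumann_algebra M, forall i, M (x i) &
      forall N, von_neumann_algebra N -> (forall i, N (x i)) -> M `<=` N].

Definition self_adjoint (T : H -> H) := adjoint T = T.

Definition projection (M : set (H -> H)) (p : H -> H) :=
  [/\ M p, self_adjoint p & p \o p = p].

Definition minimal_projection (M : set (H -> H)) (p : H -> H) :=
  [/\ projection M p, p <> cst 0 &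
      forall q, projection M q -> p \o q = q -> q = cst 0 \/ q = p].

Definition factor (M : set (H -> H)) :=
  von_neumann_algebra M /\
  M `&` commutant M = [set T | exists c : R[i], T = (fun v => c *: v)].

(* No minimal projection, and 1 is a finite projection. *)
Definition II1_factor (M : set (H -> H)) :=
  [/\ factor M,
      ~ (exists p, minimal_projection M p) &
      forall v, M v -> adjoint v \o v = id -> v \o adjoint v = id].

Definition operator_le (S T : H -> H) := forall v, ip (S v) v <= ip (T v) v.

Definition directed (D : set (H -> H)) :=
  D !=set0 /\
  forall S T, D S -> D T ->
    exists2 U, D U & operator_le S U /\ operator_le T U.

(* T is the least upper bound of D among the self-adjoint elements of M. *)
Definition operator_sup (M D : set (H -> H)) (T : H -> H) :=
  [/\ M T, self_adjoint T, forall S, D S -> operator_le S T &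
      forall U, M U -> self_adjoint U ->
        (forall S, D S -> operator_le S U) -> operator_le T U].

(* A trace is a functional on M; tau is unconstrained outside M. *)
Definition normal_on (M : set (H -> H)) (tau : (H -> H) -> R[i]) :=
  forall (D : set (H -> H)) (T : H -> H),
    (forall S, D S -> M S /\ self_adjoint S) -> directed D ->
    operator_sup M D T ->
    complex.Re (tau T) = sup [set complex.Re (tau S) | S in D].

Record faithful_normal_trace (M : set (H -> H)) (tau : (H -> H) -> R[i]) :
    Prop := FaithfulNormalTrace {
  trace_linear : forall (c : R[i]) S T, M S -> M T ->
    tau (fun v => c *: S v + T v) = c * tau S + tau T ;
  trace_tracial : forall S T, M S -> M T -> tau (S \o T) = tau (T \o S) ;
  trace_positive : forall T, M T -> 0 <= tau (adjoint T \o T) ;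
  trace_faithful : forall T, M T -> tau (adjoint T \o T) = 0 -> T = cst 0 ;
  trace_normal : normal_on M tau ;
  trace_unital : tau id = 1
}.

Definition proj_partition (M : set (H -> H)) (P : set (H -> H)) :=
  [/\ finite_set P,
      forall p, P p -> projection M p,
      forall p q, P p -> P q -> p <> q -> p \o q = cst 0 &
      forall v, \sum_(p \in P) p v = v].

(* tau p is a nonnegative real number for every projection p, hence Re. *)
Definition I_op (tau : (H -> H) -> R[i]) (x : H -> H) (P : set (H -> H)) : R :=
  \sum_(pq \in [set pq : (H -> H) * (H -> H) |
                 [/\ P pq.1, P pq.2 & pq.1 \o x \o pq.2 <> cst 0]])
    complex.Re (tau pq.1) * complex.Re (tau pq.2).

Definition I_part (tau : (H -> H) -> R[i]) n (x : 'I_n -> H -> H)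
    (P : set (H -> H)) : R :=
  \sum_(i < n) I_op tau (x i) P.

Definition I_set (M : set (H -> H)) (tau : (H -> H) -> R[i]) n
    (x : 'I_n -> H -> H) : R :=
  inf [set I_part tau x P | P in proj_partition M].

End VonNeumannAlgebras.

Section Matrices.
Context {R : realType}.

Definition mxadjoint m n (a : 'M[R[i]]_(m, n)) : 'M[R[i]]_(n, m) :=
  map_mx Num.conj a^T.

Definition euclid_norm k (v : 'cV[R[i]]_k) : R :=
  Num.sqrt (complex.Re (\tr (mxadjoint v *m v))).

Definition mx_opnorm k (a : 'M[R[i]]_k) : R :=
  sup [set euclid_norm (a *m v) |
        v in [set v : 'cV[R[i]]_k | euclid_norm v <= 1]].

Definition ntrace k (a : 'M[R[i]]_k) : R[i] := \tr a / k%:R.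

Definition tuple_dist n k (a b : 'I_n -> 'M[R[i]]_k) : R :=
  Num.sqrt (\sum_(l < n)
    complex.Re (ntrace (mxadjoint (a l - b l) *m (a l - b l)))).

(* Words in the letters j and j^*; the letter (j, true) stands for j^*. *)
Definition mxword n k (a : 'I_n -> 'M[R[i]]_k) (w : seq ('I_n * bool)) :
    'M[R[i]]_k :=
  foldr (fun l b => (if l.2 then mxadjoint (a l.1) else a l.1) *m b) 1%:M w.

End Matrices.

Section Covering.
Context {R : realType} {Y : Type}.

(* Nets consist of points of A; the value is +oo if A has no finite net. *)
Definition covering_number (d : Y -> Y -> R) (A : set Y) (eps : R) : \bar R :=
  ereal_inf [set (N%:R%:E)%E | N in [set N : nat |
    exists s : 'I_N -> Y, (forall i, A (s i)) /\
      forall y, A y -> exists i, d y (s i) < eps]].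

End Covering.

Section FreeEntropyDimension.
Context {R : realType} {H : completeNormedModType R[i]}.
Variables (ip : {dot H for Num.conj}) (tau : (H -> H) -> R[i]).
Variables (n : nat) (x : 'I_n -> H -> H).

Definition opword (w : seq ('I_n * bool)) : H -> H :=
  foldr (fun l T => (if l.2 then adjoint ip (x l.1) else x l.1) \o T) id w.

Definition microstates (rho : R) (m k : nat) (gamma : R) :
    set ('I_n -> 'M[R[i]]_k) :=
  [set a | (forall i, mx_opnorm (a i) <= rho) /\
    forall w : seq ('I_n * bool), (size w <= m)%N ->
      complex.Re `|tau (opword w) - ntrace (mxword a w)| < gamma].

Definition K_micro (eps rho : R) (m : nat) (gamma : R) : \bar R :=
  limn_esup (fun k => ((k%:R ^- 2)%:E *
    lne (covering_number (@tuple_dist R n k) (@microstates rho m k gamma) eps))%E).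

Definition K_radius (eps rho : R) : \bar R :=
  ereal_inf [set K_micro eps rho mg.1 mg.2 |
              mg in [set mg : nat * R | 0 < mg.2]].

Definition K_eps (eps : R) : \bar R :=
  ereal_sup [set K_radius eps rho | rho in [set rho : R | 0 < rho]].

Definition delta0 : \bar R :=
  limf_esup (fun eps : R => (K_eps eps * (`|ln eps|^-1)%:E)%E) 0^'+.

End FreeEntropyDimension.

(* Main.v *)
(* Fix a partition [P = {p_0, ..., p_(r-1)}] and [delta > 0].  Since
   [*]-polynomials in [x] are 2-norm dense in the projections of [M], there are
   polynomials [g = g^*] and [h_i] with [g(x)] close to [\sum_i i p_i] on the
   range of [h_i(x)], and [h_i(x)] close to [p_i].  For a microstate [a] the
   matrix [g(a)] is Hermitian; its spectral projections [E_i] around the integers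
   [i] are 2-norm close to [h_i(a)], hence have normalised traces close to
   [tau p_i], and [E_i a_l E_j] is small whenever [p_i x_l p_j = 0].  So, up to a
   small error, [a] is determined by the Hermitian matrix [\sum_i i E_i] ([k^2]
   real parameters) and by the remaining blocks of the [a_l] (about
   [k^2 I(X; P)] real parameters, the [a_l] being almost Hermitian).  Moments of
   high order show that [a_l] is 2-norm close to a matrix of operator norm at most
   [2 c], where [c] bounds the [x_l]; so every parameter costs
   [|ln eps| + O(1)] with a constant independent of the cut-off [rho], which gives
   [K_eps <= (1 + I(X; P) + delta) (|ln eps| + O(1))]. *)
From HB Require Import structures.
Require Import Defs.
From mathcomp Require Import all_boot all_order all_algebra.
From mathcomp Require Import complex.
From mathcomp Require Import all_classical all_reals all_analysis.
From mathcomp Require Import ring lra.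

Set Implicit Arguments.
Unset Strict Implicit.
Unset Printing Implicit Defensive.

Import Order.TTheory GRing.Theory Num.Theory.
Import numFieldNormedType.Exports.

Local Open Scope complex_scope.
Local Open Scope classical_set_scope.
Local Open Scope ring_scope.

(** * Projections in real Hilbert spaces *)

Section RealAux.
Context {R : realType}.
Implicit Types a b c d e : R.

Lemma invSn_lt e : 0 < e -> exists k, forall j, (k <= j)%N -> j.+1%:R^-1 < e.
Proof.
move=> e0; exists (Num.truncn e^-1) => j kj.
rewrite invf_plt ?posrE ?ltr0Sn// (lt_le_trans (truncnS_gt _))//.
by rewrite ler_nat.
Qed.

Lemma le_eps a b : (forall e, 0 < e -> a <= b + e) -> a <= b.
Proof. by move=> h; apply/ler_addgt0Pr. Qed.

Lemma le_invSn a b : (forall k : nat, a <= b + k.+1%:R^-1) -> a <= b.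
Proof.
move=> h; apply: le_eps => e e0; have [k /(_ k (leqnn k)) ke] := invSn_lt e0.
by rewrite (le_trans (h k))// lerD2l ltW.
Qed.

Lemma quad_discr a b d : 0 <= d -> (forall c, 0 <= a + 2 * c * b + c ^+ 2 * d) ->
  b ^+ 2 <= a * d.
Proof.
move=> d0 h; have a0 : 0 <= a by have := h 0; rewrite expr0n/= mulr0 !mul0r !addr0.
have [dn|dn] := eqVneq d 0; last first.
  have := h (- (b / d)).
  have -> : a + 2 * - (b / d) * b + (- (b / d)) ^+ 2 * d = (a * d - b ^+ 2) / d
    by field.
  by rewrite pmulr_lge0 ?invr_gt0 ?lt_def ?dn// subr_ge0.
have [->|b0] := eqVneq b 0; first by rewrite expr0n/= mulr_ge0.
have := h (- (a + 1) / b); rewrite dn.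
have -> : a + 2 * (- (a + 1) / b) * b + (- (a + 1) / b) ^+ 2 * 0 = - a - 2
  by field.
by lra.
Qed.

End RealAux.

Section RealForm.
Context {R : realType} {V : lmodType R[i]}.

Record real_form (b : V -> V -> R) : Prop := RealForm {
  rfC : forall v w, b v w = b w v ;
  rfD : forall u v w, b (u + v) w = b u w + b v w ;
  rfZ : forall (c : R) v w, b (c%:C *: v) w = c * b v w ;
  rf_ge0 : forall v, 0 <= b v v }.

Variables (b : V -> V -> R) (rf : real_form b).

Definition fnorm v := Num.sqrt (b v v).

Lemma rfDr u v w : b u (v + w) = b u v + b u w.
Proof. by rewrite rfC// rfD// !(rfC rf _ u). Qed.

Lemma rfZr (c : R) v w : b v (c%:C *: w) = c * b v w.
Proof. by rewrite rfC// rfZ// (rfC rf w). Qed.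

Lemma rfN v w : b (- v) w = - b v w.
Proof.
have <- : ((-1 : R)%:C) *: v = - v by rewrite rmorphN1 scaleN1r.
by rewrite rfZ// mulN1r.
Qed.

Lemma rfNr v w : b v (- w) = - b v w.
Proof. by rewrite rfC// rfN (rfC rf w). Qed.

Lemma rf0 w : b 0 w = 0.
Proof. by have := rfN 0 w; rewrite oppr0; lra. Qed.

Lemma rf0r w : b w 0 = 0.
Proof. by rewrite rfC// rf0. Qed.

Definition rfE := (rfD rf, rfDr, rfN, rfNr, rfZ rf, rfZr, rf0, rf0r).

Lemma rf_cs v w : (b v w) ^+ 2 <= b v v * b w w.
Proof.
apply: quad_discr; first exact: rf_ge0.
move=> c; have := rf_ge0 rf (v + c%:C *: w).
by rewrite !rfE (rfC rf w v); lra.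
Qed.

Lemma fnorm_ge0 v : 0 <= fnorm v. Proof. exact: sqrtr_ge0. Qed.

Lemma fnorm_sqr v : fnorm v ^+ 2 = b v v.
Proof. by rewrite sqr_sqrtr// rf_ge0. Qed.

Lemma rf_le v w : `|b v w| <= fnorm v * fnorm w.
Proof.
rewrite -sqrtrM ?rf_ge0// -sqrtr_sqr ler_sqrt; first exact: rf_cs.
by rewrite mulr_ge0 ?rf_ge0.
Qed.

Lemma rf_ler v w : b v w <= fnorm v * fnorm w.
Proof. exact: le_trans (ler_norm _) (rf_le _ _). Qed.

Lemma fnormN v : fnorm (- v) = fnorm v.
Proof. by rewrite /fnorm !rfE opprK. Qed.

Lemma fnormB v w : fnorm (v - w) = fnorm (w - v).
Proof. by rewrite -fnormN opprB. Qed.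

Lemma fnorm0 : fnorm 0 = 0.
Proof. by rewrite /fnorm rf0 sqrtr0. Qed.

Lemma fnormZ (c : R) v : fnorm (c%:C *: v) = `|c| * fnorm v.
Proof.
rewrite /fnorm !rfE mulrA -expr2 sqrtrM ?sqr_ge0//.
by rewrite sqrtr_sqr.
Qed.

Lemma fnormD v w : fnorm (v + w) <= fnorm v + fnorm w.
Proof.
rewrite -(ler_pXn2r (n:=2))// ?nnegrE ?addr_ge0 ?fnorm_ge0//.
rewrite fnorm_sqr !rfE (rfC rf w v) sqrrD !fnorm_sqr.
by have := rf_ler v w; lra.
Qed.

Lemma fnorm_dist u v w : fnorm (u - w) <= fnorm (u - v) + fnorm (v - w).
Proof. by have := fnormD (u - v) (v - w); rewrite addrA subrK. Qed.

Definition fcauchy (u : nat -> V) := forall e : R, 0 < e -> exists k,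
  forall i j, (k <= i)%N -> (k <= j)%N -> fnorm (u i - u j) < e.

Definition fcvg (u : nat -> V) (l : V) := forall e : R, 0 < e -> exists k,
  forall i, (k <= i)%N -> fnorm (u i - l) < e.

Definition fcomplete := forall u, fcauchy u -> exists l, fcvg u l.

Definition fclosure (S : set V) : set V :=
  [set v | forall e : R, 0 < e -> exists2 s, S s & fnorm (v - s) < e].

Definition real_subspace (S : set V) := [/\ S 0,
  forall v w, S v -> S w -> S (v + w) & forall (c : R) v, S v -> S (c%:C *: v)].

Lemma sub_fclosure S : S `<=` fclosure S.
Proof. by move=> v Sv e e0; exists v => //; rewrite subrr fnorm0. Qed.

Lemma fclosureK S : fclosure (fclosure S) `<=` fclosure S.
Proof.
move=> v Sv e e0; have e2 : 0 < e / 2 by rewrite divr_gt0.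
have [s Ss vs] := Sv _ e2; have [s' Ss' ss'] := Ss _ e2; exists s' => //.
by have := fnorm_dist v s s'; lra.
Qed.

Lemma fclosure_subspace S : real_subspace S -> real_subspace (fclosure S).
Proof.
move=> [S0 SD SZ]; split; first exact: sub_fclosure.
  move=> v w Sv Sw e e0; have e2 : 0 < e / 2 by rewrite divr_gt0.
  have [s Ss vs] := Sv _ e2; have [t St wt] := Sw _ e2.
  exists (s + t); first exact: SD.
  by have := fnormD (v - s) (w - t); rewrite addrACA -opprD; lra.
move=> c v Sv e e0.
have c1 : 0 < `|c| + 1 by rewrite ltr_wpDl.
have [s Ss vs] := Sv _ (divr_gt0 e0 c1).
exists (c%:C *: s); first exact: SZ.
rewrite -scalerBr fnormZ.
rewrite (@le_lt_trans _ _ ((`|c| + 1) * fnorm (v - s)))//.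
  by rewrite ler_wpM2r ?fnorm_ge0// lerDl.
by rewrite -ltr_pdivlMl// mulrC.
Qed.

Lemma fcvg_closure S u l : (forall i, S (u i)) -> fcvg u l -> fclosure S l.
Proof.
move=> Su ul e e0; have [k /(_ k (leqnn k)) h] := ul _ e0.
by exists (u k) => //; rewrite fnormB.
Qed.

Lemma parallelogram v w :
  b (v + w) (v + w) + b (v - w) (v - w) = 2 * b v v + 2 * b w w.
Proof. by rewrite !rfE (rfC rf w v); lra. Qed.

Lemma orthogonal_projection S : fcomplete -> real_subspace S ->
  fclosure S `<=` S -> forall x, exists2 s, S s & forall d, S d -> b (x - s) d = 0.
Proof.
move=> cpl [S0 SD SZ] Scl x.
have SB v w : S v -> S w -> S (v - w).
  move=> Sv Sw; apply: SD => //; have := SZ (-1) _ Sw.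
  by rewrite rmorphN1 scaleN1r.
pose E := [set b (x - s) (x - s) | s in S].
have Elb : has_inf E.
  split; first by exists (b (x - 0) (x - 0)); exists 0.
  by exists 0 => _ [s _ <-]; apply: rf_ge0.
pose m := inf E.
have mS s : S s -> m <= b (x - s) (x - s).
  by move=> Ss; apply: ge_inf; [exact: Elb.2 | exists s].
have /choice[u hu] : forall k : nat, exists s, S s /\
    b (x - s) (x - s) < m + k.+1%:R^-1.
  move=> k; have k0 : (0 : R) < k.+1%:R^-1 by rewrite invr_gt0.
  by have [_ [s Ss <-] h] := inf_adherent k0 Elb; exists s.
have mid v w : S v -> S w -> forall e, b (x - v) (x - v) < m + e ->
    b (x - w) (x - w) < m + e -> b (v - w) (v - w) < 4 * e.
  move=> Sv Sw e ve we.
  have := parallelogram (x - v) (x - w).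
  have -> : x - v - (x - w) = w - v by rewrite opprB addrC addrA subrK.
  have -> : b (w - v) (w - v) = b (v - w) (v - w) by rewrite !rfE; lra.
  have Sm : S ((2^-1)%:C *: (v + w)) by apply: SZ; apply: SD.
  have := mS _ Sm.
  have -> : x - v + (x - w) = (2 : R)%:C *: (x - (2^-1)%:C *: (v + w)).
    rewrite scalerBr scalerA -rmorphM divff ?pnatr_eq0// rmorph1 scale1r.
    by rewrite rmorph_nat scaler_nat mulr2n opprD addrACA.
  by rewrite [b (_ *: _) (_ *: _)]rfZ// rfZr; lra.
have [l ul] : exists l, fcvg u l.
  apply: cpl => e e0.
  have e40 : 0 < e ^+ 2 / 4 by rewrite divr_gt0// exprn_gt0.
  have [k hk] := invSn_lt e40; exists k => i j ki kj.
  rewrite -(ltr_pXn2r (n:=2))// ?nnegrE ?fnorm_ge0 ?(ltW e0)//.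
  rewrite fnorm_sqr.
  have -> : e ^+ 2 = 4 * (e ^+ 2 / 4) by field.
  apply: mid; [exact: (hu i).1|exact: (hu j).1| |].
    by apply: lt_trans (hu i).2 _; rewrite ltrD2l hk.
  by apply: lt_trans (hu j).2 _; rewrite ltrD2l hk.
have Sl : S l by apply: Scl; apply: fcvg_closure ul => i; exact: (hu i).1.
exists l => // d Sd.
have lm : b (x - l) (x - l) <= m.
  have -> : b (x - l) (x - l) = fnorm (x - l) ^+ 2 by rewrite fnorm_sqr.
  have m0 : 0 <= m by apply: lb_le_inf; [exact: Elb.1|move=> _ [s _ <-]; apply: rf_ge0].
  rewrite -(sqr_sqrtr m0) ler_pXn2r// ?nnegrE ?fnorm_ge0 ?sqrtr_ge0//.
  apply: le_eps => e e0.
  have e20 : 0 < e / 2 by rewrite divr_gt0.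
  have e40 : 0 < (e / 2) ^+ 2 by rewrite exprn_gt0.
  have [k hk] := invSn_lt e40; have [k' hk'] := ul _ e20.
  set i := maxn k k'.
  have := hk' i (leq_maxr _ _); have := hk i (leq_maxl _ _) => h1 h2.
  have h3 : fnorm (x - u i) <= Num.sqrt m + e / 2.
    rewrite -(ler_pXn2r (n:=2))// ?nnegrE ?fnorm_ge0 ?addr_ge0 ?sqrtr_ge0 ?(ltW e20)//.
    rewrite fnorm_sqr sqrrD sqr_sqrtr//.
    have := (hu i).2; have : 0 <= Num.sqrt m * (e / 2) by rewrite mulr_ge0 ?sqrtr_ge0// ltW.
    clear -h1; move: h1; set A := _.+1%:R^-1; set B := b _ _; set C := Num.sqrt m * _.
    by rewrite mulr2n; move: (_ ^+ 2) => D; lra.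
  by have := fnorm_dist x (u i) l; lra.
suff : (b (x - l) d) ^+ 2 <= 0 * b d d.
  by rewrite mul0r => h; apply/eqP; rewrite -sqrf_eq0 eq_le h sqr_ge0.
apply: quad_discr => [|c]; first exact: rf_ge0.
have := mS _ (SD _ _ Sl (SZ (- c) _ Sd)).
rewrite rmorphN scaleNr opprD opprK addrA.
move: (x - l) lm => y lm.
rewrite !(rfD rf, rfDr, rfZ rf, rfZr) (rfC rf d y); move: lm.
by set A := b _ _; set B := b _ _; set D := b _ _ => *; lra.
Qed.

End RealForm.

Section Hilbert.
Context {R : realType} {H : completeNormedModType R[i]}.
Variable ip : {dot H for Num.conj}.
Hypothesis ipH : hilbert_space ip.
Implicit Types (u v w : H).

Definition rip v w : R := complex.Re (ip v w).

Lemma ReC_mul (c : R) (z : R[i]) : complex.Re (c%:C * z) = c * complex.Re z.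
Proof. by case: z => x y /=; rewrite mul0r subr0. Qed.

Lemma ReN (z : R[i]) : complex.Re (- z) = - complex.Re z.
Proof. by case: z. Qed.

Lemma ReD (z z' : R[i]) : complex.Re (z + z') = complex.Re z + complex.Re z'.
Proof. by case: z; case: z'. Qed.

Lemma ReJ (z : R[i]) : complex.Re (Num.conj z) = complex.Re z.
Proof. by case: z. Qed.

Lemma ipC v w : ip v w = Num.conj (ip w v).
Proof. by rewrite hermC expr0 mul1r. Qed.

Lemma rip_form : real_form rip.
Proof.
split=> [v w|u v w|c v w|v]; rewrite /rip.
- by rewrite ipC ReJ.
- by rewrite linearDl ReD.
- by rewrite linearZl_LR/= ReC_mul.
- by have := dnorm_ge0 ip v; rewrite lecE => /andP[].
Qed.

Definition hn v := fnorm rip v.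

Lemma norm_hn v : `|v| = (hn v)%:C.
Proof.
have h : 0 <= (hn v)%:C by rewrite ler0c fnorm_ge0.
apply: (pexpIrn (n:=2)); rewrite ?nnegrE//.
rewrite ipH -rmorphXn/= (fnorm_sqr rip_form) RRe_real//.
exact: ger0_real (dnorm_ge0 _ _).
Qed.

Lemma hn_sqr v : hn v ^+ 2 = rip v v.
Proof. exact: fnorm_sqr rip_form v. Qed.

Lemma hn0_eq0 v : hn v = 0 -> v = 0.
Proof. by move=> h; apply/eqP; rewrite -normr_eq0 norm_hn h. Qed.

Lemma hnZ (c : R[i]) v : hn (c *: v) = complex.Re `|c| * hn v.
Proof.
have : `|c *: v| = `|c| * `|v| by rewrite normrZ.
by rewrite !norm_hn mulrC => /(congr1 (@complex.Re R)); rewrite ReC_mul/= mulrC.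
Qed.

Lemma hn_complete : fcomplete rip.
Proof.
move=> u cu.
have : cvg (u @ \oo).
  apply/cauchy_cvgP/cauchy_exP => e; rewrite ltcE/= => /andP[/eqP ei e0].
  have [k hk] := cu _ e0; exists (u k); exists k => // j /= kj.
  by rewrite -ball_normE/= norm_hn ltcE/= ei eqxx/=; exact: hk.
move=> /cvg_ex[l ul]; exists l => e e0.
have e0c : 0 < e%:C by rewrite ltcE/= eqxx.
have /cvgrPdist_lt/(_ _ e0c)[k _ hk] := ul.
exists k => i ki; have := hk i ki.
by rewrite /= norm_hn ltcR -/(fnorm _ _) /hn fnormB//; exact: rip_form.
Unshelve. all: by end_near. Qed.

Lemma cont_bounded (T : H -> H) : bounded_operator T ->
  exists K : R, 0 <= K /\ forall v, hn (T v) <= K * hn v.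
Proof.
move=> [Tl Tc].
pose mT := GRing.isLinear.Build R[i] H H *:%R T Tl.
pose LT : {linear H -> H} := HB.pack T mT.
have : bounded_near LT (nbhs (0 : H)) by apply: continuous_linear_bounded; exact: Tc.
move=> /linear_boundedP/pinfty_ex_gt0[M M0 hM].
have {}hM v : hn (T v) <= complex.Re M * hn v.
  have := hM v; rewrite !norm_hn /= lecE => /andP[_].
  by move: M0; rewrite ltcE/= => /andP[/eqP M0 _]; case: M {hM} M0 => a b/= ->; rewrite mul0r subr0.
by exists (complex.Re M); split => //; move: M0; rewrite ltcE => /andP[_ /ltW].
Qed.

Lemma bounded_cont (T : H -> H) (K : R) : linear T ->
  (forall v, hn (T v) <= K * hn v) -> bounded_operator T.
Proof.
move=> Tl hK; split => //.
pose mT := GRing.isLinear.Build R[i] H H *:%R T Tl.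
pose LT : {linear H -> H} := HB.pack T mT.
have h : bounded_near LT (nbhs (0 : H)).
  apply/linear_boundedP; near=> M => v.
  rewrite /= !norm_hn; apply: (@le_trans _ _ (K%:C * (hn v)%:C)).
    by rewrite -rmorphM lecR.
  apply: ler_wpM2r; first by rewrite ler0c fnorm_ge0.
  near: M; apply: nbhs_pinfty_ge; by rewrite complex_real.
exact: (bounded_linear_continuous h).
Unshelve. all: by end_near. Qed.

Lemma rip_eq v v' : (forall w, rip v w = rip v' w) -> v = v'.
Proof.
move=> h; apply/eqP; rewrite -subr_eq0; apply/eqP/hn0_eq0/eqP.
rewrite -sqrf_eq0 hn_sqr -/(rip _ _).
by rewrite (rfD rip_form) (rfN rip_form) h subrr.
Qed.

Lemma ip_rip v w : ip v w = rip v w +i* rip v ('i *: w).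
Proof.
apply/eqP; rewrite eq_complex/= /rip eqxx/=; apply/eqP.
by rewrite linearZr_LR/=; case: (ip v w) => a b /=; rewrite !(mul0r, mulN1r, opprK, sub0r, mul1r, add0r).
Qed.

Lemma riesz (f : H -> R[i]) (K : R) : scalar f ->
  (forall v, complex.Re `|f v| <= K * hn v) -> exists z, forall v, f v = ip v z.
Proof.
move=> fl fK.
have f0 : f 0 = 0 by have := fl (-1) 0 0; rewrite scaler0 addr0 mulN1r addNr.
have fD u v : f (u + v) = f u + f v by have := fl 1 u v; rewrite scale1r mul1r.
have fZ c v : f (c *: v) = c * f v by have := fl c v 0; rewrite !addr0 f0 addr0.
have fN v : f (- v) = - f v by rewrite -scaleN1r fZ mulN1r.
have [f0'|] := pselect (forall v, f v = 0).
  by exists 0 => v; rewrite f0' linear0r.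
move=> /existsNP[x /eqP fx].
pose S : set H := [set v | f v = 0].
have Ssub : real_subspace S.
  split=> [|v w|c v]; rewrite /S/= ?fD ?fZ//; first by move=> -> ->; rewrite addr0.
  by move=> ->; rewrite mulr0.
have Scl : fclosure rip S `<=` S.
  move=> v Sv; apply/eqP; rewrite -normr_eq0.
  have : complex.Re `|f v| <= 0.
    apply: le_eps => e e0; rewrite add0r.
    have K1 : 0 < `|K| + 1 by rewrite ltr_wpDl.
    have [s Ss vs] := Sv _ (divr_gt0 e0 K1).
    have -> : f v = f (v - s) by rewrite fD fN Ss subr0.
    rewrite (le_trans (fK _))//; apply: (@le_trans _ _ ((`|K| + 1) * hn (v - s))).
      by rewrite ler_wpM2r ?fnorm_ge0// (le_trans (ler_norm _))// lerDl.
    by rewrite -ler_pdivlMl// mulrC ltW.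
  have := normr_ge0 (f v); case: (`|f v|) => a b; rewrite lecE/= => /andP[/eqP -> a0] a0'.
  by rewrite eq_complex/= eqxx andbT eq_le a0 a0'.
have [s Ss os] := orthogonal_projection rip_form hn_complete Ssub Scl x.
pose e := x - s.
have fe : f e = f x by rewrite fD fN Ss subr0.
have oe d : S d -> ip e d = 0.
  move=> Sd; rewrite ip_rip !os//; rewrite /S/= fZ Sd ?mulr0//.
have ee : ip e e != 0.
  rewrite dnorm_eq0; apply: contra fx => /eqP e0.
  by rewrite -fe e0 f0.
exists ((Num.conj (f x / ip e e)) *: e) => v.
have Sd : S (v - (f v / f x) *: e).
  by rewrite /S/= fD fN fZ fe divfK// subrr.
rewrite linearZr_LR/= conjCK.
have := oe _ Sd; rewrite ipC => /eqP; rewrite conjC_eq0 linearBl linearZl_LR/= subr_eq0 => /eqP->.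
by field; rewrite ee fx.
Qed.

Lemma ip_rip_le v w : complex.Re `|ip v w| <= 2 * (hn v * hn w).
Proof.
rewrite ip_rip normc_def/=.
have h1 := rf_le rip_form v w; have h2 := rf_le rip_form v ('i *: w).
have hi : hn ('i *: w) = hn w.
  by rewrite hnZ normc_def/= expr0n/= expr1n add0r sqrtr1 mul1r.
move: h2; rewrite -/(hn _) -/(hn _) hi; move: h1; rewrite -/(hn _) -/(hn _).
have : 0 <= hn v * hn w by rewrite mulr_ge0 ?fnorm_ge0.
move: (rip v w) (rip v ('i *: w)) (hn v * hn w : R) => A B P P0 h1 h2.
rewrite -(ler_pXn2r (n:=2))// ?nnegrE ?sqrtr_ge0 ?mulr_ge0//.
rewrite sqr_sqrtr ?addr_ge0 ?sqr_ge0//.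
have : A ^+ 2 <= P ^+ 2 by rewrite -(real_normK (num_real A)) ler_pXn2r ?nnegrE.
have : B ^+ 2 <= P ^+ 2 by rewrite -(real_normK (num_real B)) ler_pXn2r ?nnegrE.
have : 0 <= P ^+ 2 by rewrite sqr_ge0.
by rewrite exprMn; lra.
Qed.

Lemma adjoint_exists (T : H -> H) : bounded_operator T ->
  exists S, bounded_operator S /\ forall v w, ip (T v) w = ip v (S w).
Proof.
move=> bT; have [K [K0 hK]] := cont_bounded bT.
have Tl := bT.1.
have /choice[S hS] : forall w, exists z, forall v, ip (T v) w = ip v z.
  move=> w; apply: (@riesz _ (2 * K * hn w)).
    by move=> c u v; rewrite /= Tl linearPl.
  move=> v; rewrite (le_trans (ip_rip_le _ _))//.
  rewrite -!mulrA ler_pM2l// (mulrC (hn w)) mulrA.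
  by rewrite ler_wpM2r ?fnorm_ge0.
exists S; split; last by move=> v w; exact: hS.
have Sl : linear S.
  move=> c u v; apply: rip_eq => w.
  rewrite !(rfC rip_form _ w) /rip; congr complex.Re.
  by rewrite -hS !(linearDr, linearZr_LR)/= !hS.
apply: (@bounded_cont _ K Sl) => w.
have [->|/eqP Sw] := eqVneq (S w) 0.
  by rewrite /hn fnorm0; [rewrite mulr_ge0 ?fnorm_ge0|exact: rip_form].
have Sw0 : 0 < hn (S w).
  rewrite lt_def fnorm_ge0 andbT; apply/eqP => h; apply: Sw; exact: hn0_eq0.
rewrite -(ler_pM2l Sw0) -expr2 hn_sqr /rip -hS.
rewrite (le_trans (rf_ler rip_form _ _))// -!/(hn _).
by rewrite mulrA (mulrC (hn _) K) ler_wpM2r ?fnorm_ge0.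
Qed.

End Hilbert.

(** * Tracial star-algebras *)

Section StarAlgebra.
Context {R : realType}.
Local Notation C := R[i].

Record star_alg (A : pzRingType) (sc : C -> A) (st : A -> A) : Prop := StarAlg {
  sa_sc1 : sc 1 = 1 ;
  sa_scD : forall c d, sc (c + d) = sc c + sc d ;
  sa_scM : forall c d, sc (c * d) = sc c * sc d ;
  sa_scC : forall c x, sc c * x = x * sc c ;
  sa_stsc : forall c, st (sc c) = sc (Num.conj c) ;
  sa_stD : forall x y, st (x + y) = st x + st y ;
  sa_stM : forall x y, st (x * y) = st y * st x ;
  sa_stK : forall x, st (st x) = x }.

Record tracial (A : pzRingType) (sc : C -> A) (st : A -> A)
    (D : set A) (tau : A -> C) : Prop := Tracial {
  ta_alg : star_alg sc st ;
  ta_sc : forall c, D (sc c) ;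
  ta_D : forall x y, D x -> D y -> D (x + y) ;
  ta_M : forall x y, D x -> D y -> D (x * y) ;
  ta_st : forall x, D x -> D (st x) ;
  ta_lin : forall c x y, D x -> D y -> tau (sc c * x + y) = c * tau x + tau y ;
  ta_comm : forall x y, D x -> D y -> tau (x * y) = tau (y * x) ;
  ta_ge0 : forall x, D x -> 0 <= tau (st x * x) ;
  ta_1 : tau 1 = 1 }.

Arguments ta_sc {A sc st D tau} _ c.
Arguments ta_D {A sc st D tau} _ {x y}.
Arguments ta_M {A sc st D tau} _ {x y}.
Arguments ta_st {A sc st D tau} _ {x}.
Arguments ta_lin {A sc st D tau} _ c {x y}.
Arguments ta_comm {A sc st D tau} _ {x y}.
Arguments ta_ge0 {A sc st D tau} _ {x}.

Section Polynomials.
Variables (A : pzRingType) (sc : C -> A) (st : A -> A) (sa : star_alg sc st).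
Implicit Types (x y : A) (c d : C).

Lemma sc0 : sc 0 = 0.
Proof. by apply: (addrI (sc 0)); rewrite -(sa_scD sa) !addr0. Qed.

Lemma scN c : sc (- c) = - sc c.
Proof. by apply: (addrI (sc c)); rewrite -(sa_scD sa) !subrr sc0. Qed.

Lemma st0 : st 0 = 0.
Proof. by apply: (addrI (st 0)); rewrite -(sa_stD sa) !addr0. Qed.

Lemma stN x : st (- x) = - st x.
Proof. by apply: (addrI (st x)); rewrite -(sa_stD sa) !subrr st0. Qed.

Lemma stB x y : st (x - y) = st x - st y.
Proof. by rewrite (sa_stD sa) stN. Qed.

Lemma st1 : st 1 = 1.
Proof. by rewrite -(sa_sc1 sa) (sa_stsc sa) rmorph1. Qed.

Lemma stX x k : st (x ^+ k) = st x ^+ k.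
Proof.
by elim: k => [|k IH]; rewrite ?expr0 ?st1// exprS (sa_stM sa) IH exprSr.
Qed.

Lemma st_sum I (r : seq I) (F : I -> A) :
  st (\sum_(i <- r) F i) = \sum_(i <- r) st (F i).
Proof. exact: (big_morph _ (sa_stD sa) st0). Qed.

Context {n : nat}.
Definition npoly := seq (C * seq ('I_n * bool)).
Variable X : 'I_n -> A.

Definition evw (w : seq ('I_n * bool)) : A :=
  foldr (fun l b => (if l.2 then st (X l.1) else X l.1) * b) 1 w.

Definition npeval (f : npoly) : A := \sum_(m <- f) sc m.1 * evw m.2.

Definition np_const (c : C) : npoly := [:: (c, [::])].
Definition np_var (l : 'I_n) : npoly := [:: (1, [:: (l, false)])].
Definition np_mul (f g : npoly) : npoly :=
  [seq (a.1 * b.1, a.2 ++ b.2) | a <- f, b <- g].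
Definition np_star (f : npoly) : npoly :=
  [seq (Num.conj a.1, rev [seq (l.1, ~~ l.2) | l <- a.2]) | a <- f].
Definition np_exp (f : npoly) k : npoly := iter k (np_mul f) (np_const 1).
Definition np_opp (f : npoly) : npoly := np_mul (np_const (-1)) f.

Lemma evw_cat w w' : evw (w ++ w') = evw w * evw w'.
Proof. by elim: w => [|l w IH] /=; rewrite ?mul1r// IH mulrA. Qed.

Lemma ev_const c : npeval (np_const c) = sc c.
Proof. by rewrite /npeval big_seq1/= mulr1. Qed.

Lemma ev_var l : npeval (np_var l) = X l.
Proof. by rewrite /npeval big_seq1/= mulr1 (sa_sc1 sa) mul1r. Qed.

Lemma ev_cat f g : npeval (f ++ g) = npeval f + npeval g.
Proof. exact: big_cat. Qed.

Lemma ev_flatten I (r : seq I) (F : I -> npoly) :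
  npeval (flatten [seq F i | i <- r]) = \sum_(i <- r) npeval (F i).
Proof.
elim: r => [|i r IH] /=; first by rewrite /npeval !big_nil.
by rewrite ev_cat IH big_cons.
Qed.

Lemma ev_mul f g : npeval (np_mul f g) = npeval f * npeval g.
Proof.
rewrite {1}/npeval /np_mul big_allpairs_dep/= /npeval mulr_suml.
apply: eq_bigr => a _; rewrite mulr_sumr; apply: eq_bigr => b _.
by rewrite (sa_scM sa) evw_cat -!mulrA; congr (_ * _); rewrite !mulrA (sa_scC sa).
Qed.

Lemma ev_exp f k : npeval (np_exp f k) = npeval f ^+ k.
Proof.
elim: k => [|k IH]; first by rewrite ev_const (sa_sc1 sa).
by rewrite exprS -IH -ev_mul.
Qed.

Lemma ev_opp f : npeval (np_opp f) = - npeval f.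
Proof. by rewrite ev_mul ev_const scN (sa_sc1 sa) mulN1r. Qed.

Lemma ev_star f : npeval (np_star f) = st (npeval f).
Proof.
rewrite {1}/npeval /np_star big_map /npeval st_sum.
apply: eq_bigr => a _ /=; rewrite (sa_stM sa) (sa_stsc sa) (sa_scC sa).
congr (_ * _); elim: a.2 => [|l w IH] /=; first by rewrite st1.
rewrite rev_cons -cats1 evw_cat IH /= mulr1 (sa_stM sa); congr (_ * _).
by case: l.2 => //=; rewrite (sa_stK sa).
Qed.

End Polynomials.

Section Tracial.
Variables (A : pzRingType) (sc : C -> A) (st : A -> A) (D : set A) (tau : A -> C).
Hypothesis tr : tracial sc st D tau.
Let sa := ta_alg tr.
Implicit Types (x y z : A).

Definition retrace x : R := complex.Re (tau x).
Definition norm2 x : R := Num.sqrt (retrace (st x * x)).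

Lemma D_1 : D 1. Proof. by rewrite -(sa_sc1 sa); exact: (ta_sc tr). Qed.
Lemma D_0 : D 0. Proof. by rewrite -(sc0 sa); exact: (ta_sc tr). Qed.
Lemma D_N x : D x -> D (- x).
Proof.
move=> Dx; have -> : - x = sc (-1) * x by rewrite (scN sa) (sa_sc1 sa) mulN1r.
exact: (ta_M tr (ta_sc tr _) Dx).
Qed.
Lemma D_B x y : D x -> D y -> D (x - y).
Proof. by move=> Dx Dy; apply: (ta_D tr Dx _); apply: D_N. Qed.
Lemma D_exp x k : D x -> D (x ^+ k).
Proof.
move=> Dx; elim: k => [|k IH]; first by rewrite expr0; exact: D_1.
by rewrite exprS; exact: (ta_M tr).
Qed.
Lemma D_sum I (r : seq I) (F : I -> A) : (forall i, D (F i)) ->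
  D (\sum_(i <- r) F i).
Proof.
move=> DF; elim: r => [|i r IH]; first by rewrite big_nil; exact: D_0.
by rewrite big_cons; exact: (ta_D tr).
Qed.

Lemma tauD x y : D x -> D y -> tau (x + y) = tau x + tau y.
Proof.
by move=> Dx Dy; have := ta_lin tr 1 Dx Dy; rewrite (sa_sc1 sa) !mul1r.
Qed.

Lemma tau0 : tau 0 = 0.
Proof. by apply: (addrI (tau 0)); rewrite -tauD ?addr0//; exact: D_0. Qed.

Lemma tauZ c x : D x -> tau (sc c * x) = c * tau x.
Proof. by move=> Dx; have := ta_lin tr c Dx D_0; rewrite tau0 !addr0. Qed.

Lemma rtrD x y : D x -> D y -> retrace (x + y) = retrace x + retrace y.
Proof. by move=> Dx Dy; rewrite /retrace tauD// ReD. Qed.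

Lemma rtrZ (c : R) x : D x -> retrace (sc c%:C * x) = c * retrace x.
Proof. by move=> Dx; rewrite /retrace tauZ// ReC_mul. Qed.

Lemma rtrN x : D x -> retrace (- x) = - retrace x.
Proof.
move=> Dx; have := rtrZ (-1) Dx; rewrite rmorphN1 (scN sa) (sa_sc1 sa) !mulN1r.
by [].
Qed.

Lemma rtrB x y : D x -> D y -> retrace (x - y) = retrace x - retrace y.
Proof. by move=> Dx Dy; rewrite rtrD ?rtrN//; exact: D_N. Qed.

Lemma rtr0 : retrace 0 = 0. Proof. by rewrite /retrace tau0. Qed.

Lemma rtr1 : retrace 1 = 1. Proof. by rewrite /retrace (ta_1 tr). Qed.

Lemma rtr_comm x y : D x -> D y -> retrace (x * y) = retrace (y * x).
Proof. by move=> Dx Dy; rewrite /retrace (ta_comm tr). Qed.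

Lemma rtr_ge0 x : D x -> 0 <= retrace (st x * x).
Proof. by move=> /(ta_ge0 tr); rewrite lecE => /andP[]. Qed.

Lemma rtr_st x : D x -> retrace (st x) = retrace x.
Proof.
move=> Dx; have Dsx := ta_st tr Dx.
have Di c : D (sc c * x) by exact: (ta_M tr (ta_sc tr _) Dx).
have Dy : D (1 + sc 'i * x) by exact: (ta_D tr D_1 (Di _)).
have := ta_ge0 tr Dy.
have -> : st (1 + sc 'i * x) * (1 + sc 'i * x) =
   sc 'i * x + (sc (- 'i) * st x + (1 + st x * x)).
  rewrite (sa_stD sa) (st1 sa) (sa_stM sa) (sa_stsc sa) -(sa_scC sa).
  have -> : Num.conj 'i = - 'i :> C by rewrite [LHS]/=; apply/eqP; rewrite eq_complex/= oppr0 !eqxx.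
  rewrite mulrDl mul1r mulrDr mulr1.
  have -> : sc (- 'i) * st x * (sc 'i * x) = st x * x.
    rewrite -mulrA (mulrA (st x)) -(sa_scC sa 'i) -!mulrA mulrA -(sa_scM sa).
    have -> : - 'i * 'i = 1 :> C.
      by apply/eqP; rewrite eq_complex/= !(mul0r, mulr0, mulr1, oppr0, mulrN1, mulN1r, opprK, sub0r, add0r, addr0, eqxx).
    by rewrite (sa_sc1 sa) mul1r.
  by rewrite [1 + sc _ * _]addrC -addrA; congr (_ + _); rewrite addrCA.
rewrite tauD//; last first.
  apply: (ta_D tr); first exact: (ta_M tr (ta_sc tr _) Dsx).
  by apply: (ta_D tr D_1 _); exact: (ta_M tr).
rewrite tauD//; last by apply: (ta_D tr D_1 _); exact: (ta_M tr).
  rewrite tauD ?(ta_1 tr)//; last by exact: (ta_M tr).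
    rewrite !tauZ// lecE => /andP[/eqP + _]; rewrite /retrace.
    have := ta_ge0 tr Dx; rewrite lecE => /andP[/eqP + _].
    case: (tau x) => a b; case: (tau (st x)) => a' b'; case: (tau _) => a'' b'' /=.
    by move=> ->; lra.
  exact: D_1.
exact: (ta_M tr (ta_sc tr _) Dsx).
Qed.

Lemma rtr_stC x y : D x -> D y -> retrace (st x * y) = retrace (st y * x).
Proof.
move=> Dx Dy; rewrite -(rtr_st (x := st y * x)) ?(sa_stM sa) ?(sa_stK sa)//.
by apply: (ta_M tr) => //; exact: (ta_st tr).
Qed.

Lemma n2_ge0 x : 0 <= norm2 x. Proof. exact: sqrtr_ge0. Qed.

Lemma n2_sqr x : D x -> norm2 x ^+ 2 = retrace (st x * x).
Proof. by move=> Dx; rewrite sqr_sqrtr// rtr_ge0. Qed.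

Lemma n2_st x : D x -> norm2 (st x) = norm2 x.
Proof.
by move=> Dx; rewrite /norm2 (sa_stK sa) rtr_comm//; exact: (ta_st tr).
Qed.

Lemma n2N x : D x -> norm2 (- x) = norm2 x.
Proof. by move=> Dx; rewrite /norm2 (stN sa) mulrNN. Qed.

Lemma n2_distC x y : D x -> D y -> norm2 (x - y) = norm2 (y - x).
Proof. by move=> Dx Dy; rewrite -n2N ?opprB//; exact: D_B. Qed.

Lemma n20 : norm2 0 = 0.
Proof. by rewrite /norm2 mulr0 /retrace tau0 sqrtr0. Qed.

Lemma n21 : norm2 1 = 1.
Proof. by rewrite /norm2 mulr1 (st1 sa) rtr1 sqrtr1. Qed.

Lemma n2D_sqr x y : D x -> D y ->
  norm2 (x + y) ^+ 2 = norm2 x ^+ 2 + 2 * retrace (st x * y) + norm2 y ^+ 2.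
Proof.
move=> Dx Dy; have Dsx := ta_st tr Dx; have Dsy := ta_st tr Dy.
rewrite (n2_sqr Dx) (n2_sqr Dy) (n2_sqr (ta_D tr Dx Dy)).
have Dm u v : D u -> D v -> D (st u * v) by move=> *; apply: (ta_M tr) => //; exact: (ta_st tr).
rewrite (sa_stD sa) mulrDl !mulrDr.
rewrite (rtrD (ta_D tr (Dm _ _ Dx Dx) (Dm _ _ Dx Dy)) (ta_D tr (Dm _ _ Dy Dx) (Dm _ _ Dy Dy))).
rewrite (rtrD (Dm _ _ Dx Dx) (Dm _ _ Dx Dy)) (rtrD (Dm _ _ Dy Dx) (Dm _ _ Dy Dy)).
by rewrite (rtr_stC Dy Dx); lra.
Qed.

Lemma n2Z (c : R) x : D x -> norm2 (sc c%:C * x) = `|c| * norm2 x.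
Proof.
move=> Dx; have Dsx := ta_st tr Dx.
rewrite /norm2 (sa_stM sa) (sa_stsc sa) -mulrA (mulrA (sc _) (sc _)) -(sa_scM sa).
rewrite [st x * _]mulrA -(sa_scC sa) -[_ * st x * x]mulrA.
have -> : Num.conj c%:C * c%:C = (c ^+ 2)%:C :> C.
  by apply/eqP; rewrite eq_complex/= !(mul0r, mulr0, oppr0, subr0, addr0) expr2 !eqxx.
rewrite (rtrZ _ (ta_M tr Dsx Dx)).
by rewrite sqrtrM ?sqr_ge0 // sqrtr_sqr.
Qed.

Lemma rtr_cs x y : D x -> D y -> `|retrace (st x * y)| <= norm2 x * norm2 y.
Proof.
move=> Dx Dy.
rewrite -(ler_pXn2r (n:=2))// ?nnegrE ?mulr_ge0 ?n2_ge0//.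
rewrite real_normK ?num_real// exprMn; apply: quad_discr; first exact: sqr_ge0.
move=> c; have Dc : D (sc c%:C * y) by exact: (ta_M tr (ta_sc tr _) Dy).
have := n2D_sqr Dx Dc; rewrite n2Z// exprMn real_normK ?num_real//.
have -> : retrace (st x * (sc c%:C * y)) = c * retrace (st x * y).
  rewrite mulrA -(sa_scC sa) -mulrA rtrZ//.
  by apply: (ta_M tr _ Dy); exact: (ta_st tr).
rewrite mulrA => <-; exact: sqr_ge0.
Qed.

Lemma rtr_le x : D x -> `|retrace x| <= norm2 x.
Proof.
by move=> Dx; have := rtr_cs D_1 Dx; rewrite (st1 sa) mul1r n21 mul1r.
Qed.

Lemma rtrM_le x y : D x -> D y -> `|retrace (x * y)| <= norm2 x * norm2 y.
Proof.
move=> Dx Dy; have := rtr_cs (ta_st tr Dx) Dy.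
by rewrite (sa_stK sa) n2_st.
Qed.

Lemma n2D x y : D x -> D y -> norm2 (x + y) <= norm2 x + norm2 y.
Proof.
move=> Dx Dy.
rewrite -(ler_pXn2r (n:=2))// ?nnegrE ?addr_ge0 ?n2_ge0//.
rewrite n2D_sqr// sqrrD mulr2n.
by have := ler_norm (retrace (st x * y)); have := rtr_cs Dx Dy; lra.
Qed.

Lemma n2B x y : D x -> D y -> norm2 (x - y) <= norm2 x + norm2 y.
Proof. by move=> Dx Dy; rewrite -(n2N Dy); apply: n2D => //; exact: D_N. Qed.

Lemma n2_dist x y z : D x -> D y -> D z -> norm2 (x - z) <= norm2 (x - y) + norm2 (y - z).
Proof.
move=> Dx Dy Dz; have := n2D (D_B Dx Dy) (D_B Dy Dz).
by rewrite addrA subrK.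
Qed.

Lemma n2_sum I (r : seq I) (F : I -> A) : (forall i, D (F i)) ->
  norm2 (\sum_(i <- r) F i) <= \sum_(i <- r) norm2 (F i).
Proof.
move=> DF; elim: r => [|i r IH]; first by rewrite !big_nil n20.
rewrite !big_cons (le_trans (n2D _ _))//; first exact: D_sum.
by rewrite lerD2l.
Qed.

Definition opbd K x := 0 <= K /\ forall y, D y -> norm2 (x * y) <= K * norm2 y.

Lemma opbd_st K x : D x -> opbd K x -> opbd K (st x).
Proof.
move=> Dx [K0 h]; split => // y Dy.
have Dsx := ta_st tr Dx; have Dsxy := ta_M tr Dsx Dy.
have [h0|h0] := eqVneq (norm2 (st x * y)) 0; first by rewrite h0 mulr_ge0 ?n2_ge0.
have {}h0 : 0 < norm2 (st x * y) by rewrite lt_def h0 n2_ge0.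
rewrite -(ler_pM2r h0) -expr2 n2_sqr// (sa_stM sa) (sa_stK sa).
rewrite -mulrA (le_trans (ler_norm _))// (le_trans (rtr_cs _ _))//.
  exact: (ta_M tr).
by rewrite mulrAC mulrC ler_wpM2r ?n2_ge0// h.
Qed.

Lemma opbdr K x y : D x -> D y -> opbd K x -> norm2 (y * x) <= K * norm2 y.
Proof.
move=> Dx Dy hx; rewrite -(n2_st (ta_M tr Dy Dx)) (sa_stM sa) -(n2_st Dy).
by apply: (opbd_st Dx hx).2; exact: (ta_st tr Dy).
Qed.

Lemma opbdM K L x y : D x -> D y -> opbd K x -> opbd L y -> opbd (K * L) (x * y).
Proof.
move=> Dx Dy [K0 hK] [L0 hL]; split; first by rewrite mulr_ge0.
move=> z Dz; rewrite -!mulrA (le_trans (hK _ (ta_M tr Dy Dz)))//.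
by rewrite ler_wpM2l// hL.
Qed.

Lemma opbdX K x k : D x -> opbd K x -> opbd (K ^+ k) (x ^+ k).
Proof.
move=> Dx hx; elim: k => [|k IH].
  by split=> [|y Dy]; rewrite expr0 ?ler01// !mul1r.
by rewrite !exprS; apply: opbdM => //; exact: D_exp.
Qed.

Context {n : nat} (X : 'I_n -> A) (DX : forall i, D (X i)).

Lemma D_evw w : D (evw st X w).
Proof.
elim: w => [|l w IH] /=; first exact: D_1.
by apply: (ta_M tr _ IH); case: l.2 => //; exact: (ta_st tr).
Qed.

Lemma D_ev f : D (npeval sc st X f).
Proof.
by apply: D_sum => m; apply: (ta_M tr (ta_sc tr _) _); exact: D_evw.
Qed.

Lemma tau_ev f : tau (npeval sc st X f) = \sum_(m <- f) m.1 * tau (evw st X m.2).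
Proof.
rewrite /npeval; elim: f => [|m f IH]; first by rewrite !big_nil tau0.
rewrite !big_cons tauD ?IH ?tauZ//; first exact: D_evw.
  by apply: (ta_M tr (ta_sc tr _) _); exact: D_evw.
exact: D_ev.
Qed.

End Tracial.
End StarAlgebra.

(** * Bounded operators *)

Section BoundedOperators.
Context {R : realType} {H : completeNormedModType R[i]}.

Record bop := Bop { bop_fun :> H -> H ; bopP : bounded_operator bop_fun }.

HB.instance Definition _ := gen_eqMixin bop.
HB.instance Definition _ := gen_choiceMixin bop.

Lemma bop_ext (S T : bop) : (forall v, S v = T v) -> S = T.
Proof.
case: S T => [S bS] [T bT] /= h; have /funext eST : forall v, S v = T v := h.
by rewrite eST in bS *; congr Bop; exact: Prop_irrelevance.
Qed.

Lemma bop_inj (S T : bop) : bop_fun S = bop_fun T -> S = T.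
Proof. by move=> h; apply: bop_ext => v; rewrite h. Qed.

Lemma bounded_scale_id (c : R[i]) : bounded_operator (fun v : H => c *: v).
Proof.
split; first by move=> a u v; rewrite scalerDr !scalerA mulrC.
by move=> v; apply: cvgZr; exact: cvg_id.
Qed.

Lemma bounded_add (S T : bop) : bounded_operator (fun v => S v + T v).
Proof.
have [Sl Sc] := bopP S; have [Tl Tc] := bopP T; split.
  by move=> a u v; rewrite Sl Tl scalerDr addrACA.
by move=> v; apply: cvgD; [exact: Sc|exact: Tc].
Qed.

Lemma bounded_opp (S : bop) : bounded_operator (fun v => - S v).
Proof.
have [Sl Sc] := bopP S; split; first by move=> a u v; rewrite Sl opprD scalerN.
by move=> v; apply: cvgN; exact: Sc.
Qed.

Lemma bounded_comp (S T : bop) : bounded_operator (fun v => S (T v)).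
Proof.
have [Sl Sc] := bopP S; have [Tl Tc] := bopP T; split.
  by move=> a u v; rewrite Tl Sl.
by move=> v; apply: (@continuous_comp _ _ _ T S v); [exact: Tc|exact: Sc].
Qed.

Definition bscal (c : R[i]) := Bop (bounded_scale_id c).
Definition badd (S T : bop) := Bop (bounded_add S T).
Definition bopp (S : bop) := Bop (bounded_opp S).
Definition bmul (S T : bop) := Bop (bounded_comp S T).

Lemma bopD_lin (S : bop) : {morph S : u v / u + v}.
Proof. by move=> u v; have := (bopP S).1 1 u v; rewrite !scale1r. Qed.

Lemma bop0_lin (S : bop) : S 0 = 0.
Proof. by apply: (addrI (S 0)); rewrite -bopD_lin !addr0. Qed.

Lemma bopZ_lin (S : bop) c v : S (c *: v) = c *: S v.
Proof. by have := (bopP S).1 c v 0; rewrite !addr0 bop0_lin addr0. Qed.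

Lemma bopN_lin (S : bop) v : S (- v) = - S v.
Proof. by rewrite -scaleN1r bopZ_lin scaleN1r. Qed.

Lemma bopB_lin (S : bop) u v : S (u - v) = S u - S v.
Proof. by rewrite bopD_lin bopN_lin. Qed.

Lemma baddA : associative badd.
Proof. by move=> S T U; apply: bop_ext => v; exact: addrA. Qed.
Lemma baddC : commutative badd.
Proof. by move=> S T; apply: bop_ext => v; exact: addrC. Qed.
Lemma badd0 : left_id (bscal 0) badd.
Proof. by move=> S; apply: bop_ext => v; rewrite /= scale0r add0r. Qed.
Lemma baddN : left_inverse (bscal 0) bopp badd.
Proof. by move=> S; apply: bop_ext => v; rewrite /= scale0r addNr. Qed.

HB.instance Definition _ := GRing.isZmodule.Build bop baddA baddC badd0 baddN.

Lemma bmulA : associative bmul.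
Proof. by move=> S T U; apply: bop_ext. Qed.
Lemma bmul1 : left_id (bscal 1) bmul.
Proof. by move=> S; apply: bop_ext => v; rewrite /= scale1r. Qed.
Lemma bmul1r : right_id (bscal 1) bmul.
Proof. by move=> S; apply: bop_ext => v; rewrite /= scale1r. Qed.
Lemma bmulDl : left_distributive bmul badd.
Proof. by move=> S T U; apply: bop_ext. Qed.
Lemma bmulDr : right_distributive bmul badd.
Proof. by move=> S T U; apply: bop_ext => v /=; rewrite bopD_lin. Qed.

HB.instance Definition _ :=
  GRing.Zmodule_isPzRing.Build bop bmulA bmul1 bmul1r bmulDl bmulDr.

Lemma bopDE (S T : bop) v : (S + T) v = S v + T v. Proof. by []. Qed.
Lemma bopNE (S : bop) v : (- S) v = - S v. Proof. by []. Qed.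
Lemma bopME (S T : bop) v : (S * T) v = S (T v). Proof. by []. Qed.
Lemma bop1E v : (1 : bop) v = v. Proof. exact: scale1r. Qed.
Lemma bop0E v : (0 : bop) v = 0. Proof. exact: scale0r. Qed.
Lemma bscalE c v : bscal c v = c *: v. Proof. by []. Qed.
Definition bopE := (bopDE, bopNE, bopME, bop1E, bop0E, bscalE).

Lemma bop_sumE I (r : seq I) (F : I -> bop) v :
  (\sum_(i <- r) F i) v = \sum_(i <- r) F i v.
Proof.
elim: r => [|i r IH]; first by rewrite !big_nil bop0E.
by rewrite !big_cons bopDE IH.
Qed.

Lemma bmul_fun (S T : bop) : bop_fun (S * T) = S \o T. Proof. by []. Qed.
Lemma bop1_fun : bop_fun 1 = id. Proof. by apply/funext => v; rewrite bop1E. Qed.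

Variable ip : {dot H for Num.conj}.
Hypothesis ipH : hilbert_space ip.
Local Notation rip := (rip ip).
Local Notation hn := (hn ip).
Let rf := rip_form ip.
Implicit Types (S T : bop).

Lemma bst_exists (T : bop) : exists S : bop, forall v w, ip (T v) w = ip v (S w).
Proof.
by have [S [bS hS]] := adjoint_exists ipH (bopP T); exists (Bop bS).
Qed.

Definition bst (T : bop) : bop := sval (cid (bst_exists T)).

Lemma bstP T v w : ip (T v) w = ip v (bst T w).
Proof. exact: (svalP (cid (bst_exists T))). Qed.

Lemma rip_st T v w : rip (T v) w = rip v (bst T w).
Proof. by rewrite /rip bstP. Qed.

Lemma rip_str T v w : rip v (T w) = rip (bst T v) w.
Proof. by rewrite (rfC rf) rip_st (rfC rf). Qed.

Lemma bst_unique (T S : bop) : (forall v w, rip (T v) w = rip v (S w)) -> S = bst T.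
Proof.
move=> h; apply: bop_ext => w; apply: (rip_eq ipH) => v.
by rewrite !(rfC rf _ v) -h rip_st.
Qed.

Lemma adjointE (T : bop) : adjoint ip T = bst T.
Proof.
have : [set S | bounded_operator S /\ forall v w, ip (T v) w = ip v (S w)]
   (adjoint ip T).
  by apply: (@xgetI _ _ _ (bop_fun (bst T))); split; [exact: bopP|exact: bstP].
move=> [bS hS]; have -> : adjoint ip T = Bop bS by [].
apply: (congr1 bop_fun); apply: bst_unique => v w.
by rewrite /rip hS.
Qed.

Lemma bop_star_alg : star_alg bscal bst.
Proof.
split.
- by [].
- by move=> c d; apply: bop_ext => v; exact: scalerDl.
- by move=> c d; apply: bop_ext => v; rewrite /= scalerA.
- by move=> c S; apply: bop_ext => v; rewrite !bopE bopZ_lin.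
- move=> c; apply/esym/bst_unique => v w; rewrite !bopE /rip.
  by rewrite linearZl_LR linearZr_LR/= conjCK.
- move=> S T; apply/esym/bst_unique => v w.
  by rewrite !bopE (rfD rf) (rfDr rf) !rip_st.
- by move=> S T; apply/esym/bst_unique => v w; rewrite !bopE !rip_st.
- by move=> S; apply/esym/bst_unique => v w; rewrite rip_str.
Qed.
Let sa := bop_star_alg.

Lemma bop_bounded (T : bop) : exists K : R, 0 <= K /\ forall v, hn (T v) <= K * hn v.
Proof. exact: (cont_bounded ipH (bopP T)). Qed.

Definition sadj (T : bop) := bst T = T.
Definition pos (T : bop) := sadj T /\ forall v, 0 <= rip (T v) v.

Lemma sadj_rip T : sadj T -> forall v w, rip (T v) w = rip v (T w).
Proof. by move=> sT v w; rewrite rip_st sT. Qed.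

Lemma sadjI T : (forall v w, rip (T v) w = rip v (T w)) -> sadj T.
Proof. by move=> h; apply/esym/bst_unique. Qed.

Lemma sadj_Im T v : sadj T -> ip (T v) v = (rip (T v) v)%:C.
Proof.
move=> sT; have : Num.conj (ip (T v) v) = ip (T v) v.
  by rewrite -ipC bstP sT.
rewrite /rip; case: (ip (T v) v) => a b [] /= h.
by apply/eqP; rewrite eq_complex/= eqxx/=; apply/eqP; lra.
Qed.

Lemma sadjD S T : sadj S -> sadj T -> sadj (S + T).
Proof. by move=> sS sT; rewrite /sadj (sa_stD sa) sS sT. Qed.
Lemma sadjN S : sadj S -> sadj (- S).
Proof. by move=> sS; rewrite /sadj (stN sa) sS. Qed.
Lemma sadjB S T : sadj S -> sadj T -> sadj (S - T).
Proof. by move=> sS sT; apply: sadjD => //; exact: sadjN. Qed.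
Lemma sadj1 : sadj 1. Proof. exact: (st1 sa). Qed.
Lemma sadjZ (c : R) T : sadj T -> sadj (bscal c%:C * T).
Proof.
move=> sT; rewrite /sadj (sa_stM sa) sT (sa_stsc sa) (sa_scC sa).
by congr (_ * bscal _); apply/eqP; rewrite eq_complex/= oppr0 !eqxx.
Qed.
Lemma sadjX T k : sadj T -> sadj (T ^+ k).
Proof. by move=> sT; rewrite /sadj (stX sa) sT. Qed.
Lemma sadj_congr S T : sadj T -> sadj (bst S * T * S).
Proof. by move=> sT; rewrite /sadj !(sa_stM sa) (sa_stK sa) sT mulrA. Qed.

Lemma ripZl (c : R) T v w : rip ((bscal c%:C * T) v) w = c * rip (T v) w.
Proof. by rewrite !bopE (rfZ rf). Qed.

Lemma posD S T : pos S -> pos T -> pos (S + T).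
Proof.
move=> [sS pS] [sT pT]; split; first exact: sadjD.
by move=> v; rewrite bopE (rfD rf) addr_ge0.
Qed.
Lemma posZ (c : R) T : 0 <= c -> pos T -> pos (bscal c%:C * T).
Proof.
move=> c0 [sT pT]; split; first exact: sadjZ.
by move=> v; rewrite ripZl mulr_ge0.
Qed.
Lemma pos1 : pos 1.
Proof. by split=> [|v]; [exact: sadj1 | rewrite bopE (rf_ge0 rf)]. Qed.
Lemma pos_congr S T : pos T -> pos (bst S * T * S).
Proof.
move=> [sT pT]; split; first exact: sadj_congr.
by move=> v; rewrite !bopE -rip_str.
Qed.
Lemma pos_sq S : pos (bst S * S).
Proof.
have := pos_congr S pos1; by rewrite mulr1.
Qed.

Lemma pos_form T : pos T -> real_form (fun v w => rip (T v) w).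
Proof.
move=> [sT pT]; split=> [v w|u v w|c v w|v] //.
- by rewrite sadj_rip// (rfC rf).
- by rewrite bopD_lin (rfD rf).
- by rewrite bopZ_lin (rfZ rf).
Qed.

(* Cauchy--Schwarz for the form [<T v, w>] *)
Lemma pos_le_sqr T (K : R) : pos T -> 0 <= K -> (forall v, rip (T v) v <= K * hn v ^+ 2) ->
  forall v, hn (T v) ^+ 2 <= K * rip (T v) v.
Proof.
move=> pT K0 hK v; have := rf_cs (pos_form pT) v (T v).
rewrite -hn_sqr; set a := hn (T v) ^+ 2 => h.
have a0 : 0 <= a by exact: sqr_ge0.
have [->|an0] := eqVneq a 0; first by rewrite mulr_ge0// pT.2.
have ap : 0 < a by rewrite lt_def an0.
rewrite -(ler_pM2r ap) -expr2 (le_trans h)//.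
by rewrite [K * _]mulrC -mulrA ler_wpM2l ?pT.2.
Qed.

Lemma pos_norm_le T (K : R) : pos T -> 0 <= K -> (forall v, rip (T v) v <= K * hn v ^+ 2) ->
  forall v, hn (T v) <= K * hn v.
Proof.
move=> pT K0 hK v.
rewrite -(ler_pXn2r (n:=2))// ?nnegrE ?mulr_ge0 ?fnorm_ge0//.
rewrite (le_trans (pos_le_sqr pT K0 hK v))// exprMn expr2 -mulrA ler_wpM2l//.
Qed.

Lemma rip_bound T (K : R) : (forall v, hn (T v) <= K * hn v) ->
  forall v, rip (T v) v <= K * hn v ^+ 2.
Proof.
move=> hK v; rewrite (le_trans (rf_ler rf _ _))// -!/(hn _) expr2 mulrA.
by rewrite ler_wpM2r ?fnorm_ge0.
Qed.

Definition ople (S T : bop) := forall v, rip (S v) v <= rip (T v) v.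

Lemma operator_leE (S T : bop) : sadj S -> sadj T -> operator_le ip S T <-> ople S T.
Proof.
move=> sS sT; split => h v; have := h v.
  by rewrite !sadj_Im// lecR.
by move=> hv; rewrite !sadj_Im// lecR.
Qed.

Lemma ople_pos S T : sadj S -> sadj T -> ople S T <-> pos (T - S).
Proof.
move=> sS sT; split => [h|[_ h] v].
  split; first exact: sadjB.
  by move=> v; rewrite !bopE (rfD rf) (rfN rf) subr_ge0.
by have := h v; rewrite !bopE (rfD rf) (rfN rf) subr_ge0.
Qed.

End BoundedOperators.
Arguments bop {R} H.

Section PairSpace.
Context {R : realType} {H : completeNormedModType R[i]}.
Variable ip : {dot H for Num.conj}.
Hypothesis ipH : hilbert_space ip.
Local Notation rip := (rip ip).
Local Notation hn := (hn ip).
Let rf := rip_form ip.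
Implicit Types (p q : (H * H)%type) (T : bop H).

Definition rip2 p q := rip p.1 q.1 + rip p.2 q.2.

Lemma rip2_form : real_form rip2.
Proof.
split=> [v w|u v w|c v w|v]; rewrite /rip2/=.
- by rewrite (rfC rf) (rfC rf v.2).
- by rewrite !(rfD rf) addrACA.
- by rewrite !(rfZ rf) mulrDr.
- by rewrite addr_ge0 ?(rf_ge0 rf).
Qed.
Let rf2 := rip2_form.
Local Notation hn2 := (fnorm rip2).

Lemma hn2_sqr p : hn2 p ^+ 2 = hn p.1 ^+ 2 + hn p.2 ^+ 2.
Proof. by rewrite (fnorm_sqr rf2) !hn_sqr. Qed.

Definition pr (b : bool) p := if b then p.1 else p.2.
Definition inj (b : bool) (v : H) : H * H := if b then (v, 0) else (0, v).

Lemma hn_pr b p : hn (pr b p) <= hn2 p.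
Proof.
rewrite -(ler_pXn2r (n:=2))// ?nnegrE ?fnorm_ge0// hn2_sqr.
by case: b => /=; rewrite ?lerDl ?lerDr sqr_ge0.
Qed.

Lemma hn2_inj b v : hn2 (inj b v) = hn v.
Proof.
apply/eqP; rewrite -(eqrXn2 (n:=2)) ?fnorm_ge0// hn2_sqr.
by case: b => /=; rewrite /hn (fnorm0 rf) expr0n/= ?addr0 ?add0r.
Qed.

Lemma hn2_le p : hn2 p <= hn p.1 + hn p.2.
Proof.
rewrite -(ler_pXn2r (n:=2))// ?nnegrE ?addr_ge0 ?fnorm_ge0// hn2_sqr sqrrD.
by have := mulr_ge0 (fnorm_ge0 rip p.1) (fnorm_ge0 rip p.2); rewrite /hn mulr2n; lra.
Qed.

Lemma hn2_complete : fcomplete rip2.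
Proof.
move=> u cu.
have h b : exists l, fcvg rip (fun i => pr b (u i)) l.
  apply: (hn_complete ipH) => e e0; have [k hk] := cu _ e0.
  exists k => i j ki kj; apply: le_lt_trans (hk _ _ ki kj).
  by have := hn_pr b (u i - u j); case: b.
have [l1 h1] := h true; have [l2 h2] := h false; exists (l1, l2) => e e0.
have e2 : 0 < e / 2 by rewrite divr_gt0.
have [k1 hk1] := h1 _ e2; have [k2 hk2] := h2 _ e2.
exists (maxn k1 k2) => i; rewrite geq_max => /andP[ki1 ki2].
apply: le_lt_trans (hn2_le _) _ => /=.
by have := hk1 _ ki1; have := hk2 _ ki2; rewrite /= -!/(hn _); lra.
Qed.

Definition dg T p : H * H := (T p.1, T p.2).

Lemma dgD T p q : dg T (p + q) = dg T p + dg T q.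
Proof. by rewrite /dg /= !bopD_lin. Qed.
Lemma dgN T p : dg T (- p) = - dg T p.
Proof. by rewrite /dg /= !bopN_lin. Qed.
Lemma dg_inj T b v : dg T (inj b v) = inj b (T v).
Proof. by case: b; rewrite /dg/= bop0_lin. Qed.
Lemma dg_pr T b p : pr b (dg T p) = T (pr b p).
Proof. by case: b. Qed.

Lemma rip2_dg T p q : rip2 (dg T p) q = rip2 p (dg (bst ipH T) q).
Proof. by rewrite /rip2/= !(rip_st ipH). Qed.

Lemma dg_bounded T : exists K : R, 0 <= K /\ forall p, hn2 (dg T p) <= K * hn2 p.
Proof.
have [K [K0 hK]] := bop_bounded ipH T; exists (K + K); split; first exact: addr_ge0.
move=> p; rewrite (le_trans (hn2_le _))//= mulrDl lerD//.
  by rewrite (le_trans (hK _))// ler_wpM2l// (hn_pr true).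
by rewrite (le_trans (hK _))// ler_wpM2l// (hn_pr false).
Qed.

Lemma dg_closure T (S : set (H * H)) : (forall p, S p -> S (dg T p)) ->
  forall p, fclosure rip2 S p -> fclosure rip2 S (dg T p).
Proof.
move=> hS p Sp e e0; have [K [K0 hK]] := dg_bounded T.
have K1 : 0 < K + 1 by rewrite ltr_wpDl.
have [s Ss ps] := Sp _ (divr_gt0 e0 K1).
exists (dg T s); first exact: hS.
rewrite -dgN -dgD (le_lt_trans (hK _))//.
apply: (@le_lt_trans _ _ ((K + 1) * hn2 (p - s))).
  by rewrite ler_wpM2r ?fnorm_ge0// lerDl.
by rewrite -ltr_pdivlMl// mulrC.
Qed.

Lemma closed_projection_commutes (S : set (H * H)) (G : set (bop H)) :
  real_subspace S -> fclosure rip2 S `<=` S ->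
  (forall c p, S p -> S (dg (bscal c) p)) ->
  (forall T, G T -> sadj ipH T) ->
  (forall T p, G T -> S p -> S (dg T p)) ->
  forall U : bop H, (forall Q : bop H, (forall T, G T -> Q * T = T * Q) -> U * Q = Q * U) ->
  forall p, S p -> S (dg U p).
Proof.
move=> Ssub Scl Sc Gs SG U hU.
have [S0 SD SZ] := Ssub.
have SN p : S p -> S (- p).
  by move=> Sp; have := SZ (-1) _ Sp; rewrite rmorphN1 scaleN1r.
have /choice[Q hQ] : forall p, exists q, S q /\ forall d, S d -> rip2 (p - q) d = 0.
  move=> p; have [q Sq oq] := orthogonal_projection rf2 hn2_complete Ssub Scl p.
  by exists q.
have Quniq p q : S q -> (forall d, S d -> rip2 (p - q) d = 0) -> Q p = q.
  move=> Sq oq; have [SQ oQ] := hQ p.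
  have Sd : S (Q p - q) by apply: SD => //; exact: SN.
  have h : rip2 (Q p - q) (Q p - q) = 0.
    have {1}-> : Q p - q = (p - q) - (p - Q p).
      by rewrite opprB [RHS]addrC addrA subrK.
    by rewrite (rfD rf2) (rfN rf2) oq// oQ// subrr.
  have h0 : hn2 (Q p - q) = 0 by rewrite /fnorm h sqrtr0.
  have e b : pr b (Q p - q) = 0.
    apply: (hn0_eq0 ipH); apply/eqP; rewrite eq_le fnorm_ge0 andbT -h0.
    exact: hn_pr.
  have := e true; have := e false => /= /eqP + /eqP; rewrite !subr_eq0.
  by move=> /eqP e2 /eqP e1; rewrite (surjective_pairing (Q p)) (surjective_pairing q) e1 e2.
have QD p q : Q (p + q) = Q p + Q q.
  apply: Quniq => [|d Sd]; first by apply: SD; exact: (hQ _).1.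
  by rewrite opprD addrACA (rfD rf2) !(hQ _).2// addr0.
have Qdg T : (forall p, S p -> S (dg T p)) -> (forall p, S p -> S (dg (bst ipH T) p)) ->
    forall p, Q (dg T p) = dg T (Q p).
  move=> ST SsT p; apply: Quniq => [|d Sd]; first by apply: ST; exact: (hQ _).1.
  by rewrite -dgN -dgD rip2_dg (hQ _).2//; exact: SsT.
have Qsc c p : Q (dg (bscal c) p) = dg (bscal c) (Q p).
  by apply: Qdg => q; [|rewrite (sa_stsc (bop_star_alg ipH))]; exact: Sc.
have QG T p : G T -> Q (dg T p) = dg T (Q p).
  by move=> GT; apply: Qdg => q; [|rewrite (Gs _ GT)]; exact: SG.
have Qle p : hn2 (Q p) <= hn2 p.
  have h : rip2 (Q p) (Q p) = rip2 p (Q p).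
    have := (hQ p).2 _ (hQ p).1; rewrite (rfD rf2) (rfN rf2).
    by move/eqP; rewrite subr_eq0 => /eqP.
  have [->|h0] := eqVneq (hn2 (Q p)) 0; first exact: fnorm_ge0.
  have h0' : 0 < hn2 (Q p) by rewrite lt_def h0 fnorm_ge0.
  by rewrite -(ler_pM2r h0') -expr2 (fnorm_sqr rf2) h (rf_ler rf2).
have bQ b b' : bounded_operator (fun v => pr b' (Q (inj b v))).
  apply: (@bounded_cont _ _ _ ipH _ 1).
    move=> c u v; have -> : inj b (c *: u + v) = dg (bscal c) (inj b u) + inj b v.
      by case: b; rewrite /dg/= [RHS]surjective_pairing/= ?scaler0 ?addr0.
    by rewrite QD Qsc; case: b'.
  move=> v; rewrite mul1r (le_trans (hn_pr _ _))// (le_trans (Qle _))//.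
  by rewrite hn2_inj.
pose QB b b' := Bop (bQ b b').
have UQ b b' v : U (pr b' (Q (inj b v))) = pr b' (Q (inj b (U v))).
  have : U * QB b b' = QB b b' * U.
    apply: hU => T GT; apply: bop_ext => w; rewrite !bopE /=.
    by rewrite -dg_inj QG// dg_pr.
  by move=> /(congr1 (fun T : bop H => T v)).
have QU p : Q (dg U p) = dg U (Q p).
  have ep q : q = inj true q.1 + inj false q.2.
    by case: q => a b; rewrite [RHS]surjective_pairing/= addr0 add0r.
  rewrite (ep p) dgD !QD dgD !dg_inj.
  have e b v : Q (inj b (U v)) = dg U (Q (inj b v)).
    rewrite [LHS]surjective_pairing /dg.
    by rewrite (UQ b true v) (UQ b false v).
  by rewrite !e.
move=> p Sp; have Qp : Q p = p.
  by apply: Quniq => // d _; rewrite subrr (rf0 rf2).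
by rewrite -Qp -QU; exact: (hQ _).1.
Qed.

End PairSpace.

Section HilbertLimits.
Context {R : realType} {H : completeNormedModType R[i]}.
Variable ip : {dot H for Num.conj}.
Hypothesis ipH : hilbert_space ip.
Local Notation rip := (rip ip).
Local Notation hn := (hn ip).
Let rf := rip_form ip.

Lemma fcvgP (u : nat -> H) l : fcvg rip u l <-> u @ \oo --> l.
Proof.
split=> [ul|ul e e0].
  apply/cvgrPdist_lt => e; rewrite ltcE/= => /andP[/eqP ei e0].
  have [k hk] := ul _ e0; exists k => // j /= kj.
  by rewrite (norm_hn ipH) ltcE/= ei eqxx/= /hn (fnormB rf) hk.
have e0c : 0 < e%:C by rewrite ltcE/= eqxx.
have /cvgrPdist_lt/(_ _ e0c)[k _ hk] := ul.
exists k => i ki; have := hk i ki.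
by rewrite /= (norm_hn ipH) ltcR /hn (fnormB rf).
Qed.

Lemma bop_cvg (T : bop H) (u : nat -> H) l : u @ \oo --> l -> T (u k) @[k --> \oo] --> T l.
Proof. by move=> ul; apply: continuous_cvg ul; exact: (bopP T).2. Qed.

Lemma rip_cvg (u : nat -> H) l w : u @ \oo --> l -> rip (u k) w @[k --> \oo] --> rip l w.
Proof.
move=> /fcvgP ul; apply/cvgrPdist_lt => e e0.
have w1 : 0 < hn w + 1 by rewrite ltr_wpDl// fnorm_ge0.
have [k hk] := ul _ (divr_gt0 e0 w1); exists k => // j /= kj.
have -> : rip l w - rip (u j) w = rip (l - u j) w by rewrite (rfD rf) (rfN rf).
rewrite (le_lt_trans (rf_le rf _ _))// (fnormB rf).
apply: (@le_lt_trans _ _ (fnorm rip (u j - l) * (hn w + 1))).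
  by rewrite ler_wpM2l ?fnorm_ge0// lerDl.
by rewrite -ltr_pdivlMr// hk.
Qed.

Lemma hn_cvg0 (u : nat -> H) l : u @ \oo --> l ->
  forall e, 0 < e -> exists k, hn (u k - l) < e.
Proof. by move=> /fcvgP ul e /ul[k hk]; exists k; exact: hk. Qed.

Lemma decreasing_pos_cvg (T : nat -> bop H) : (forall k, pos ipH (T k)) ->
  (forall k, ople ip (T k.+1) (T k)) ->
  exists L : bop H, [/\ pos ipH L, forall k, ople ip L (T k) &
    forall v, T k v @[k --> \oo] --> L v].
Proof.
move=> pT dT.
have [K [K0 hK0]] := bop_bounded ipH (T 0%N).
have {}hK0 := rip_bound hK0.
have dec i j : (i <= j)%N -> ople ip (T j) (T i).
  elim: j => [|j IH]; first by rewrite leqn0 => /eqP->; exact: (fun v => lexx _).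
  rewrite leq_eqVlt => /predU1P[->|]; first exact: (fun v => lexx _).
  by rewrite ltnS => /IH h v; apply: le_trans (h v); exact: dT.
have hK k v : rip (T k v) v <= K * hn v ^+ 2.
  by apply: le_trans (hK0 v); apply: dec.
have pd i j : (i <= j)%N -> pos ipH (T i - T j).
  by move=> ij; apply/ople_pos; [exact: (pT _).1|exact: (pT _).1|exact: dec].
have sq i j v : (i <= j)%N ->
    hn (T i v - T j v) ^+ 2 <= K * (rip (T i v) v - rip (T j v) v).
  move=> ij; have := @pos_le_sqr _ _ _ _ _ K (pd _ _ ij) K0 _ v.
  rewrite !bopE (rfD rf) (rfN rf); apply => w.
  rewrite !bopE (rfD rf) (rfN rf); have := hK i w; have := (pT j).2 w; lra.
have cau v : fcauchy rip (fun k => T k v).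
  pose a k := rip (T k v) v; pose m := inf (range a).
  have hm : has_inf (range a).
    by split; [exists (a 0%N); exists 0%N|exists 0 => _ [k _ <-]; exact: (pT k).2].
  move=> e e0; have K1 : 0 < K + 1 by rewrite ltr_wpDl.
  have e1 : 0 < e ^+ 2 / (K + 1) by rewrite divr_gt0// exprn_gt0.
  have [_ [k _ <-] hk] := inf_adherent e1 hm.
  have main i j : (k <= i)%N -> (i <= j)%N -> hn (T i v - T j v) < e.
    move=> ki ij.
    rewrite -(ltr_pXn2r (n:=2))// ?nnegrE ?fnorm_ge0 ?(ltW e0)//.
    apply: le_lt_trans (sq _ _ _ ij) _.
    have h1 : a i <= a k by exact: dec.
    have h2 : m <= a j by apply: ge_inf; [exact: hm.2|exists j].
    have h3 : 0 <= a i - a j by rewrite subr_ge0; exact: dec.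
    apply: (@le_lt_trans _ _ ((K + 1) * (a i - a j))).
      by rewrite ler_wpM2r// lerDl.
    rewrite mulrC -ltr_pdivlMr//; apply: le_lt_trans (_ : a k - m < _); first lra.
    by rewrite ltrBlDl.
  exists k => i j ki kj; have [ij|/ltnW ij] := leqP i j; first exact: main.
  by rewrite (fnormB rf); exact: main.
have hex v : exists l : H, T k v @[k --> \oo] --> l.
  by have [l /fcvgP hl] := hn_complete ipH (cau v); exists l.
have [L0 hL0] := choice hex.
have Llin : linear L0.
  move=> c u v; apply: norm_cvg_unique (hL0 _) _.
  have -> : (fun k => T k (c *: u + v)) = (fun k => c *: T k u + T k v).
    by apply/funext => k; rewrite bopD_lin bopZ_lin.
  by apply: cvgD; [apply: cvgZr|]; exact: hL0.
have Lle v : hn (L0 v) <= K * hn v.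
  apply: le_eps => e e0; have [k hk] := hn_cvg0 (hL0 v) e0.
  have := @pos_norm_le _ _ _ _ _ K (pT k) K0 (hK k) v.
  have := fnorm_dist rf (L0 v) (T k v) 0; rewrite !subr0 (fnormB rf) -!/(hn _).
  by move: hk; rewrite -!/(hn _); lra.
pose L := Bop (bounded_cont ipH Llin Lle).
have ripL v w : rip (T k v) w @[k --> \oo] --> rip (L v) w.
  exact: rip_cvg (hL0 v).
exists L; split => //.
- split.
    apply: sadjI => v w; apply: norm_cvg_unique (ripL v w) _.
    have := ripL w v; rewrite (rfC rf (L w)).
    have -> : (fun k => rip (T k w) v) = (fun k => rip (T k v) w).
      by apply/funext => k; rewrite (sadj_rip (pT k).1) (rfC rf).
    exact.
  move=> v; apply: (ler_cvg_to (cvg_cst 0) (ripL v v)).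
  by near=> k; exact: (pT k).2.
- move=> k v; apply: (ler_cvg_to (ripL v v) (cvg_cst _)).
  by exists k => // j /= kj; exact: dec.
Unshelve. all: by end_near. Qed.

End HilbertLimits.

(** * The von Neumann algebra and its 2-norm *)

Section Generated.
Context {R : realType} {H : completeNormedModType R[i]}.
Variable ip : {dot H for Num.conj}.
Hypothesis ipH : hilbert_space ip.
Let rf := rip_form ip.
Variables (M : set (H -> H)) (tau : (H -> H) -> R[i]).
Hypothesis tauM : faithful_normal_trace ip M tau.
Variables (n : nat) (x : 'I_n -> H -> H).
Hypothesis x_sa : forall i, self_adjoint ip (x i).
Hypothesis x_gen : generates ip M x.
Implicit Types (S T U : bop H).
Local Notation bst := (bst ipH).
Local Notation pos := (pos ipH).
Local Notation sadj := (sadj ipH).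

Definition MB : set (bop H) := [set T | M T].
Definition tauB (T : bop H) := tau T.

Lemma M_bounded f : M f -> bounded_operator f.
Proof. by have [[_ ->] _ _] := x_gen; case. Qed.

Definition gens (i : 'I_n) : bop H :=
  Bop (M_bounded (let: And3 _ h _ := x_gen in h i)).

Lemma MB_gens i : MB (gens i).
Proof. by have [_ h _] := x_gen; exact: h. Qed.

Lemma gens_sadj i : sadj (gens i).
Proof. by apply: bop_inj; rewrite -adjointE; exact: x_sa. Qed.

Lemma MBP T : MB T <-> forall S, commutant M S -> T * S = S * T.
Proof.
split=> [MT S [_ MS]|hT]; first by apply: bop_inj; rewrite !bmul_fun MS.
have [[_ MM] _ _] := x_gen; rewrite /MB/= MM; split; first exact: bopP.
move=> S cS; have bS := cS.1; have := hT (Bop bS) cS.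
by move/(congr1 (@bop_fun _ _)).
Qed.

Lemma MB_bst T : MB T -> MB (bst T).
Proof.
move=> MT; have [[h _] _ _] := x_gen.
by rewrite /MB/= -adjointE; exact: h.
Qed.

Lemma MB_bicommutant T : MB T -> forall S, (forall i, S * gens i = gens i * S) ->
  T * S = S * T.
Proof.
have [_ _ Mmin] := x_gen => MT S hS.
pose A : set (H -> H) := commutant (range x).
have AS (f : H -> H) : A f <-> exists2 S', f = bop_fun S' & forall i, S' * gens i = gens i * S'.
  split=> [[bT' h]|[S' -> h]].
    exists (Bop bT') => // i; apply: bop_inj; rewrite !bmul_fun.
    by apply: h; exists i.
  by split=> [|_ [i _ <-]]; [exact: bopP|exact: (congr1 (@bop_fun _ _) (h i))].
have AA : A = commutant (commutant A).
  apply/seteqP; split=> T' [bT' h]; split => //.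
    by move=> S' [bS' h']; rewrite h'//; split.
  move=> S' [i _ <-]; apply: h; split; first exact: bopP (gens i).
  by move=> T'' [_ ->]//; exists i.
have vn : von_neumann_algebra ip (commutant A).
  split; last by rewrite -AA.
  move=> _T [bT hT]; pose T' := Bop bT.
  have -> : _T = T' by [].
  rewrite adjointE; split; first exact: bopP.
  move=> S' /AS[S'' -> h]; apply: (congr1 (@bop_fun _ _) (_ : bst T' * S'' = S'' * bst T')).
  have sa := bop_star_alg ipH.
  have AS' : A (bst S'').
    apply/AS; exists (bst S'') => // i.
    by rewrite -(gens_sadj i) -!(sa_stM sa) h.
  have /(congr1 bst) : T' * bst S'' = bst S'' * T' by apply: bop_inj; rewrite !bmul_fun hT.
  by rewrite !(sa_stM sa) (sa_stK sa).
have [_ cT] : commutant A T.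
  apply: Mmin => // i; split; first exact: bopP (gens i).
  by move=> S' [_ ->]//; exists i.
by apply: bop_inj; rewrite !bmul_fun cT//; apply/AS; exists S.
Qed.

Lemma MB_tracial : tracial bscal bst MB tauB.
Proof.
split.
- exact: bop_star_alg.
- move=> c; apply/MBP => S _; exact: (sa_scC (bop_star_alg ipH)).
- by move=> S T /MBP hS /MBP hT; apply/MBP => U cU; rewrite mulrDl mulrDr hS ?hT.
- move=> S T /MBP hS /MBP hT; apply/MBP => U cU.
  by rewrite -mulrA hT// mulrA hS// mulrA.
- exact: MB_bst.
- by move=> c S T MS MT; exact: (trace_linear tauM).
- by move=> S T MS MT; exact: (trace_tracial tauM).
- by move=> T MT; rewrite /tauB bmul_fun -adjointE; exact: (trace_positive tauM).
- by rewrite /tauB bop1_fun (trace_unital tauM).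
Qed.
Let tr := MB_tracial.
Local Notation rtr := (retrace tauB).

Lemma MB_limit (T : nat -> bop H) (L : bop H) : (forall k, MB (T k)) ->
  (forall v, T k v @[k --> \oo] --> L v) -> MB L.
Proof.
move=> MT TL; apply/MBP => S cS; apply: bop_ext => v; rewrite !bopE.
apply: norm_cvg_unique (TL _) _; have := bop_cvg (T := S) (TL v).
have -> : (fun k => S (T k v)) = (fun k => T k (S v)); last exact.
apply/funext => k.
by have := (MBP (T k)).1 (MT k) S cS; move/(congr1 (fun A : bop H => A v)).
Qed.

Lemma rtr_pos T : MB T -> pos T -> 0 <= rtr T.
Proof.
move=> MT [sT pT]; pose D : set (H -> H) := [set f : H -> H | f = bop_fun (0 : bop H) \/ f = bop_fun T].
have M0 : MB 0 := D_0 tr.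
have s0 : sadj 0 := st0 (bop_star_alg ipH).
have le0 : operator_le ip (0 : bop H) T.
  by apply/(operator_leE (ipH := ipH) s0 sT) => v; rewrite bopE (rf0 rf).
have le1 U : operator_le ip U U by [].
have sup : operator_sup ip M D T.
  split=> //; first by rewrite /self_adjoint adjointE sT.
    by move=> S [->|->].
  by move=> U MU sU; apply; right.
have dir : directed ip D.
  split; first by exists (bop_fun T); right.
  move=> S U [->|->] [->|->]; try by exists (bop_fun T); [right|].
have := trace_normal tauM _ dir sup; rewrite -/(tauB T) -/(rtr T) => -> //.
  rewrite -(rtr0 tr).
  apply: ub_le_sup; last by exists (bop_fun (0 : bop H)) => //; left.
  exists (Num.max (rtr 0) (rtr T)) => _ [S [->|->] <-]; rewrite le_max; first by rewrite lexx.
  by rewrite [X in _ || X]lexx orbT.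
by move=> S [->|->]; split => //; rewrite /self_adjoint adjointE ?s0 ?sT.
Qed.
End Generated.

Section TwoNormClosure.
Context {R : realType} {H : completeNormedModType R[i]}.
Variable ip : {dot H for Num.conj}.
Hypothesis ipH : hilbert_space ip.
Local Notation rip := (rip ip).
Local Notation hn := (hn ip).
Let rf := rip_form ip.
Variables (M : set (H -> H)) (tau : (H -> H) -> R[i]).
Hypothesis tauM : faithful_normal_trace ip M tau.
Variables (n : nat) (x : 'I_n -> H -> H).
Hypothesis x_sa : forall i, self_adjoint ip (x i).
Hypothesis x_gen : generates ip M x.
Implicit Types (S T U : bop H).
Local Notation bst := (bst ipH).
Local Notation pos := (pos ipH).
Local Notation sadj := (sadj ipH).
Local Notation MB := (MB M).
Local Notation gens := (gens x_gen).
Let tr : tracial bscal bst MB (tauB tau) := MB_tracial ipH tauM x_gen.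
Let sa := ta_alg tr.
Local Notation n2 := (norm2 bst (tauB tau)).
Local Notation rtr := (retrace (tauB tau)).
Local Notation ev := (npeval bscal bst gens).

Lemma MB_ev f : MB (ev f).
Proof. exact: (D_ev tr (MB_gens x_gen)). Qed.

Lemma ev_real_subspace (F G : bop H -> H) :
  (forall S T, F (S + T) = F S + F T) -> (forall S T, G (S + T) = G S + G T) ->
  (forall (c : R) S, F (bscal c%:C * S) = c%:C *: F S) ->
  (forall (c : R) S, G (bscal c%:C * S) = c%:C *: G S) ->
  real_subspace [set p : H * H | exists f, p = (F (ev f), G (ev f))].
Proof.
move=> FD GD FZ GZ; split.
- exists [::]; rewrite /npeval big_nil.
  have e0 (E : bop H -> H) : (forall S T, E (S + T) = E S + E T) -> E 0 = 0.
    by move=> ED; apply: (addrI (E 0)); rewrite -ED !addr0.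
  by rewrite !e0.
- move=> _ _ [f ->] [g ->]; exists (f ++ g); rewrite ev_cat FD GD.
  by rewrite [LHS]surjective_pairing.
- move=> c _ [f ->]; exists (np_mul (np_const c%:C) f).
  by rewrite (ev_mul sa) ev_const FZ GZ [LHS]surjective_pairing.
Qed.

Lemma pair_density T u v : MB T -> forall e, 0 < e ->
  exists f, hn (ev f u - T u) < e /\ hn (ev f v - T v) < e.
Proof.
move=> MT e e0.
pose S0 : set (H * H) := [set p | exists f, p = (ev f u, ev f v)].
have S0sub : real_subspace S0.
  exact: (@ev_real_subspace (fun S => S u) (fun S => S v)).
have S0S : forall f p, S0 p -> S0 (dg (ev f) p).
  by move=> f _ [g ->]; exists (np_mul f g); rewrite (ev_mul sa).
have : fclosure (rip2 ip) S0 (dg T (u, v)).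
  apply: (@closed_projection_commutes _ _ _ ipH (fclosure (rip2 ip) S0) (range gens)).
  - exact: (fclosure_subspace (rip2_form ip) S0sub).
  - exact: (@fclosureK _ _ _ (rip2_form ip)).
  - move=> c p; apply: (dg_closure ipH) => q S0q.
    by have := S0S (np_const c) _ S0q; rewrite ev_const.
  - by move=> _ [i _ <-]; exact: gens_sadj.
  - move=> _ p [i _ <-]; apply: (dg_closure ipH) => q S0q.
    by have := S0S (np_var i) _ S0q; rewrite (ev_var sa).
  - move=> Q hQ; apply: (MB_bicommutant ipH x_sa MT) => i.
    by apply: hQ; exists i.
  - apply: (sub_fclosure (rip2_form ip)); exists (np_const 1).
    by rewrite ev_const (sa_sc1 sa) !bop1E.
move=> /(_ _ e0)[_ [f ->] h]; exists f.
have h1 := hn_pr ip true (dg T (u, v) - (ev f u, ev f v)).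
have h2 := hn_pr ip false (dg T (u, v) - (ev f u, ev f v)).
rewrite /hn !(fnormB rf (ev f _)).
by split; [apply: le_lt_trans h1 h|apply: le_lt_trans h2 h].
Qed.

(* The pairs [(a^* u, a v)] form only a real subspace; the closest point to
   [(u, 0)] in its closure is found by projecting in the real Hilbert space. *)
Lemma star_density T u v : MB T -> sadj T -> T u = u -> T v = 0 ->
  forall e, 0 < e -> exists f, hn (bst (ev f) u - u) < e /\ hn (ev f v) < e.
Proof.
move=> MT sT Tu Tv e e0.
pose S0 : set (H * H) := [set p | exists f, p = (bst (ev f) u, ev f v)].
have S0sub : real_subspace S0.
  apply: (@ev_real_subspace (fun S => bst S u) (fun S => S v)) => //.
    by move=> S U; rewrite (sa_stD sa).
  move=> c S; rewrite (sa_stM sa) (sa_stsc sa) -(sa_scC sa) !bopE.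
  by congr (_ *: _); apply/eqP; rewrite eq_complex/= oppr0 !eqxx.
pose rf2 := rip2_form ip.
have [s Ss os] := orthogonal_projection rf2 (hn2_complete ipH)
  (fclosure_subspace rf2 S0sub) (@fclosureK _ _ _ rf2 _) (u, 0).
suff h0 : fnorm (rip2 ip) ((u, 0) - s) = 0.
  have [q [f qe] sq] := Ss _ e0; exists f.
  have h : fnorm (rip2 ip) ((u, 0) - q) < e.
    by apply: le_lt_trans (fnorm_dist rf2 _ s _) _; rewrite h0 add0r.
  rewrite qe in h.
  have h1 := hn_pr ip true ((u, 0) - (bst (ev f) u, ev f v)).
  have h2 := hn_pr ip false ((u, 0) - (bst (ev f) u, ev f v)).
  split; first by rewrite /hn (fnormB rf); exact: le_lt_trans h1 h.
  rewrite /hn -(subr0 (ev f v)) (fnormB rf); exact: le_lt_trans h2 h.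
have [d dE] : exists d, d = (u, 0) - s by exists ((u, 0) - s).
have od f : rip2 ip d (bst (ev f) u, ev f v) = 0.
  by rewrite dE; apply: os; apply: (sub_fclosure rf2); exists f.
have ru : rip d.1 u = 0.
  apply/eqP; rewrite -normr_le0; apply: le_eps => t t0; rewrite add0r.
  have B0 : 0 < hn u + hn d.2 + 1 by rewrite ltr_wpDl// addr_ge0 ?fnorm_ge0.
  have [f [f1 f2]] := pair_density d.1 v MT (divr_gt0 t0 B0).
  have := od f; rewrite /rip2/= -(rip_st ipH) => hf.
  have -> : rip d.1 u = rip (T d.1 - ev f d.1) u - rip d.2 (ev f v - T v).
    rewrite Tv subr0 (rfD rf) (rfN rf) (sadj_rip sT) Tu.
    by move: hf; lra.
  rewrite (le_trans (ler_normB _ _))//.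
  have := rf_le rf (T d.1 - ev f d.1) u; rewrite (fnormB rf) => h1.
  have h2 := rf_le rf d.2 (ev f v - T v).
  rewrite (le_trans (lerD h1 h2))//.
  rewrite -!/(hn _); move: f1 f2; set a := hn (_ - _); set b := hn (_ - _) => f1 f2.
  rewrite (@le_trans _ _ ((hn u + hn d.2 + 1) * (t / (hn u + hn d.2 + 1))))//.
    rewrite !mulrDl mul1r.
    have hu : a * hn u <= hn u * (t / (hn u + hn d.2 + 1)).
      by rewrite mulrC ler_wpM2l ?fnorm_ge0// ltW.
    have hd : hn d.2 * b <= hn d.2 * (t / (hn u + hn d.2 + 1)).
      by rewrite ler_wpM2l ?fnorm_ge0// ltW.
    have : 0 <= t / (hn u + hn d.2 + 1) by rewrite ltW// divr_gt0.
    by move: hu hd; lra.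
  by rewrite mulrC divfK ?gt_eqF.
rewrite /fnorm (rfDr rf2) (rfNr rf2) (os _ Ss) subr0 -dE /rip2/= ru.
by rewrite (rf0r rf) addr0 sqrtr0.
Qed.

Lemma MB_opbd (K : R) T : MB T -> 0 <= K -> (forall v, hn (T v) <= K * hn v) ->
  opbd bst MB (tauB tau) K T.
Proof.
move=> MT K0 hK; split => // S MS.
have MTS := ta_M tr MT MS.
rewrite -(ler_pXn2r (n:=2))// ?nnegrE ?mulr_ge0 ?n2_ge0//.
rewrite exprMn (n2_sqr tr MTS) (n2_sqr tr MS).
have MSS : MB (bst S * S) by apply: (ta_M tr) => //; exact: (ta_st tr).
have MTT : MB (bst (T * S) * (T * S)) by apply: (ta_M tr) => //; exact: (ta_st tr).
have MZ := ta_M tr (ta_sc tr (K ^+ 2)%:C) MSS.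
rewrite -(rtrZ tr _ MSS) -subr_ge0 -(rtrB tr MZ MTT).
apply: (rtr_pos tauM x_gen); first exact: (D_B tr MZ MTT).
have sS (V : bop H) : sadj (bst V * V) by exact: (pos_sq ipH _).1.
apply/ople_pos => //; first by apply: sadjZ.
move=> v; rewrite ripZl !bopE -!(rip_str ipH) !bopE -!hn_sqr -exprMn.
by rewrite ler_pXn2r ?nnegrE ?mulr_ge0 ?fnorm_ge0.
Qed.

Lemma MB_opbd_ex T : MB T -> exists K, opbd bst MB (tauB tau) K T.
Proof.
by move=> MT; have [K [K0 hK]] := bop_bounded ipH T; exists K; exact: MB_opbd.
Qed.

Definition nclos : set (bop H) :=
  [set T | MB T /\ forall e : R, 0 < e -> exists f, n2 (T - ev f) < e].
Local Notation N := nclos.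

Lemma N_ev f : N (ev f).
Proof.
by split=> [|e e0]; [exact: MB_ev|exists f; rewrite subrr (n20 tr)].
Qed.

Lemma N_sc c : N (bscal c).
Proof. by have := N_ev (np_const c); rewrite ev_const. Qed.

Lemma N_1 : N 1.
Proof. by have := N_sc 1; rewrite (sa_sc1 sa). Qed.

Lemma N_approx T S : MB T ->
  (forall e : R, 0 < e -> exists2 S, N S & n2 (T - S) < e) -> N T.
Proof.
move=> MT h; split => // e e0; have e2 : 0 < e / 2 by rewrite divr_gt0.
have [S' [MS hS] TS] := h _ e2; have [f Sf] := hS _ e2; exists f.
have := n2_dist tr MT MS (MB_ev f); lra.
Qed.

Lemma N_D S T : N S -> N T -> N (S + T).
Proof.
move=> [MS hS] [MT hT]; split; first exact: (ta_D tr).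
move=> e e0; have e2 : 0 < e / 2 by rewrite divr_gt0.
have [f Sf] := hS _ e2; have [g Tg] := hT _ e2; exists (f ++ g).
rewrite ev_cat opprD addrACA.
have := n2D tr (D_B tr MS (MB_ev f)) (D_B tr MT (MB_ev g)); lra.
Qed.

Lemma N_M S T : N S -> N T -> N (S * T).
Proof.
move=> [MS hS] [MT hT]; split; first exact: (ta_M tr).
move=> e e0; have e2 : 0 < e / 2 by rewrite divr_gt0.
have [K TK] := MB_opbd_ex MT.
have K1 : 0 < K + 1 by rewrite ltr_wpDl// TK.1.
have [f Sf] := hS _ (divr_gt0 e2 K1).
have [L fL] := MB_opbd_ex (MB_ev f).
have L1 : 0 < L + 1 by rewrite ltr_wpDl// fL.1.
have [g Tg] := hT _ (divr_gt0 e2 L1).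
exists (np_mul f g); rewrite (ev_mul sa).
have -> : S * T - ev f * ev g = (S - ev f) * T + ev f * (T - ev g).
  by rewrite mulrBl mulrBr addrA subrK.
have MSf := D_B tr MS (MB_ev f); have MTg := D_B tr MT (MB_ev g).
rewrite (le_lt_trans (n2D tr (ta_M tr MSf MT) (ta_M tr (MB_ev f) MTg)))//.
have h1 : n2 ((S - ev f) * T) <= e / 2.
  rewrite (le_trans (opbdr tr MT MSf TK))//.
  rewrite (@le_trans _ _ ((K + 1) * n2 (S - ev f)))//.
    by rewrite ler_wpM2r ?n2_ge0// lerDl.
  by rewrite -ler_pdivlMl// mulrC ltW.
have h2 : n2 (ev f * (T - ev g)) < e / 2.
  rewrite (le_lt_trans (fL.2 _ MTg))//.
  rewrite (@le_lt_trans _ _ ((L + 1) * n2 (T - ev g)))//.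
    by rewrite ler_wpM2r ?n2_ge0// lerDl.
  by rewrite -ltr_pdivlMl// mulrC.
lra.
Qed.

Lemma N_st T : N T -> N (bst T).
Proof.
move=> [MT hT]; split; first exact: (ta_st tr).
move=> e e0; have [f Tf] := hT _ e0; exists (np_star f).
by rewrite (ev_star sa) -(stB sa) (n2_st tr)//; exact: (D_B tr MT (MB_ev f)).
Qed.

Lemma N_N T : N T -> N (- T).
Proof.
by move=> NT; have := N_M (N_sc (-1)) NT; rewrite (scN sa) (sa_sc1 sa) mulN1r.
Qed.
Lemma N_B S T : N S -> N T -> N (S - T).
Proof. by move=> NS NT; apply: N_D => //; exact: N_N. Qed.
Lemma N_exp T k : N T -> N (T ^+ k).
Proof.
move=> NT; elim: k => [|k IH]; first by rewrite expr0; exact: N_1.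
by rewrite exprS; exact: N_M.
Qed.

#[local] Hint Resolve N_1 N_sc : core.

Lemma rtr_ople S T : MB S -> MB T -> sadj S -> sadj T -> ople ip S T ->
  rtr S <= rtr T.
Proof.
move=> MS MT sS sT ST; rewrite -subr_ge0 -(rtrB tr MT MS).
by apply: (rtr_pos tauM x_gen); [exact: (D_B tr MT MS)|apply/ople_pos].
Qed.

Lemma N_decreasing (T : nat -> bop H) : (forall k, N (T k)) ->
  (forall k, pos (T k)) -> (forall k, ople ip (T k.+1) (T k)) ->
  exists L, [/\ N L, pos L, forall k, ople ip L (T k),
    forall v, T k v @[k --> \oo] --> L v &
    forall e : R, 0 < e -> exists k, rtr (T k) < rtr L + e].
Proof.
move=> NT pT dT; have [L [pL LT TL]] := decreasing_pos_cvg pT dT.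
have ML : MB L by apply: (MB_limit x_gen _ TL) => k; exact: (NT k).1.
have MT k : MB (T k) := (NT k).1.
have dec i j : (i <= j)%N -> ople ip (T j) (T i).
  elim: j => [|j IH]; first by rewrite leqn0 => /eqP->; exact: (fun v => lexx _).
  rewrite leq_eqVlt => /predU1P[->|]; first exact: (fun v => lexx _).
  by rewrite ltnS => /IH h v; apply: le_trans (h v); exact: dT.
have rt : forall e : R, 0 < e -> exists k, rtr (T k) < rtr L + e.
  move=> e e0; pose D : set (H -> H) := range (fun k => bop_fun (- T k)).
  have sN k : sadj (- T k) by apply: sadjN; exact: (pT k).1.
  have sNL : sadj (- L) by apply: sadjN; exact: pL.1.
  have leN k : ople ip (- T k) (- L).
    by move=> v; rewrite !bopE !(rfN rf) lerN2; exact: LT.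
  have sup : operator_sup ip M D (- L : bop H).
    split.
    - exact: (D_N tr ML).
    - by rewrite /self_adjoint adjointE sNL.
    - by move=> _ [k _ <-]; apply/(operator_leE (sN k) sNL).
    - move=> f Mf sf hU; pose U := Bop (M_bounded x_gen Mf).
      have sU : sadj U by apply: bop_inj; rewrite -adjointE; exact: sf.
      apply/(operator_leE (T := U) sNL sU) => v.
      have hv k : rip ((- T k) v) v <= rip (U v) v.
        by apply: (operator_leE (sN k) sU).1; apply: hU; exists k.
      have cv : rip ((- T k) v) v @[k --> \oo] --> rip ((- L) v) v.
        apply: (rip_cvg ipH); rewrite bopE.
        have -> : (fun k => (- T k) v) = (fun k => - T k v) by [].
        by apply: cvgN; exact: TL.
      by apply: (ler_cvg_to cv (cvg_cst _)); near=> k; exact: hv.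
  have dir : directed ip D.
    split; first by exists (bop_fun (- T 0%N)), 0%N.
    move=> _ _ [i _ <-] [j _ <-]; exists (bop_fun (- T (maxn i j))); first by exists (maxn i j).
    split; apply/(operator_leE (sN _) (sN _)) => v; rewrite !bopE !(rfN rf) lerN2.
      by apply: dec; rewrite leq_maxl.
    by apply: dec; rewrite leq_maxr.
  have hD f : D f -> M f /\ self_adjoint ip f.
    move=> [k _ <-]; split; first exact: (D_N tr (MT k)).
    by rewrite /self_adjoint adjointE sN.
  have := trace_normal tauM hD dir sup.
  set E := [set _ | _ in _] => hE.
  have Esup : has_sup E.
    split; first by exists (rtr (- T 0%N)), (bop_fun (- T 0%N)) => //; exists 0%N.
    exists (rtr (- L)) => _ [_ [k _ <-] <-].
    exact: (rtr_ople (D_N tr (MT k)) (D_N tr ML) (sN k) sNL (leN k)).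
  have [_ [_ [k _ <-] <-]] := sup_adherent e0 Esup.
  rewrite -hE -/(tauB tau (- L)) -/(tauB tau (- T k)) -/(rtr _) -/(rtr _).
  by rewrite !(rtrN tr)//; exists k; lra.
exists L; split => //.
apply: (N_approx L ML) => e e0.
have [K [K0 hK0]] := bop_bounded ipH (T 0%N).
have {}hK0 := rip_bound hK0.
have K1 : 0 < K + 1 by rewrite ltr_wpDl.
have e1 : 0 < e ^+ 2 / (K + 1) by rewrite divr_gt0// exprn_gt0.
have [k hk] := rt _ e1; exists (T k) => //.
have MS := D_B tr (MT k) ML.
rewrite (n2_distC tr ML (MT k)) -(ltr_pXn2r (n:=2))// ?nnegrE ?n2_ge0 ?(ltW e0)//.
have pS : pos (T k - L) by apply/ople_pos; [exact: pL.1|exact: (pT k).1|exact: LT].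
rewrite (n2_sqr tr MS) pS.1.
apply: (@le_lt_trans _ _ (rtr (bscal K%:C * (T k - L)))).
  apply: rtr_ople.
  - exact: (ta_M tr).
  - by apply: (ta_M tr) => //; exact: (ta_sc tr).
  - by rewrite -{1}pS.1; exact: (pos_sq ipH _).1.
  - by apply: sadjZ; exact: pS.1.
  move=> v; rewrite ripZl bopME (sadj_rip pS.1) -hn_sqr.
  apply: pos_le_sqr => // w; have := dec 0%N k isT w; have := pL.2 w; have := hK0 w.
  by rewrite !bopE (rfD rf) (rfN rf); lra.
rewrite (rtrZ tr) // (rtrB tr) //.
have h0 : 0 <= rtr (T k) - rtr L.
  by rewrite subr_ge0; apply: rtr_ople => //; [exact: pL.1|exact: (pT k).1].
apply: (@le_lt_trans _ _ ((K + 1) * (rtr (T k) - rtr L))).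
  by rewrite ler_wpM2r// lerDl.
by rewrite mulrC -ltr_pdivlMr//; move: hk; rewrite -ltrBlDl.
Unshelve. all: by end_near. Qed.

Lemma hn_contract T v : pos T -> ople ip T 1 -> hn (T v) ^+ 2 <= rip (T v) v.
Proof.
move=> pT T1; rewrite -[leRHS]mul1r; apply: pos_le_sqr => // w.
by have := T1 w; rewrite bop1E mul1r hn_sqr.
Qed.

Lemma hn_contract_le T v : pos T -> ople ip T 1 -> hn (T v) <= hn v.
Proof.
move=> pT T1; rewrite -[leRHS]mul1r; apply: (pos_norm_le pT) => // w.
by have := T1 w; rewrite bop1E mul1r hn_sqr.
Qed.

Lemma pos_exp T k : pos T -> pos (T ^+ k).
Proof.
move=> pT; elim/ltn_ind: k => -[|[|k]] IH; first by rewrite expr0; exact: pos1.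
  by rewrite expr1.
by rewrite exprS exprSr mulrA -{1}pT.1; apply: pos_congr; exact: IH.
Qed.

(* Neumann series of [1 + S = c (1 - Y)]; its partial sums are increasing. *)
Lemma resolvent S : N S -> pos S -> exists G : bop H, [/\ N G, pos G, (1 + S) * G = 1,
  G * (1 + S) = 1 & ople ip G 1].
Proof.
move=> NS pS; have [K [K0 hK]] := bop_bounded ipH S.
have {}hK := rip_bound hK.
pose c := 1 + K; have c0 : 0 < c by rewrite /c ltr_wpDr.
have cn : c != 0 by rewrite gt_eqF.
have c1 : 1 - c^-1 = K / c by rewrite /c in cn *; field.
pose r := K / c; have r0 : 0 <= r by rewrite divr_ge0// ltW.
pose Y : bop H := 1 - bscal (c^-1)%:C * (1 + S).
have NY : N Y by apply: N_B => //; apply: N_M => //; exact: N_D.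
have s1S : sadj (1 + S) by apply: sadjD; [exact: sadj1|exact: pS.1].
have sY : sadj Y by apply: sadjB; [exact: sadj1|exact: sadjZ].
have ripY v : rip (Y v) v = r * hn v ^+ 2 - c^-1 * rip (S v) v.
  rewrite bopDE bop1E bopNE (rfD rf) (rfN rf) ripZl bopDE bop1E (rfD rf) -hn_sqr.
  by rewrite /r -c1; ring.
have pY : pos Y.
  split=> // v; rewrite ripY subr_ge0 /r mulrAC [leRHS]mulrC.
  by rewrite ler_wpM2l ?invr_ge0 ?(ltW c0).
have hY v : hn (Y v) <= r * hn v.
  apply: (pos_norm_le pY) => // w; rewrite ripY gerBl mulr_ge0 ?pS.2//.
  by rewrite invr_ge0 ltW.
have hYk k v : hn ((Y ^+ k) v) <= r ^+ k * hn v.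
  elim: k => [|k IH]; first by rewrite !expr0 bop1E mul1r.
  by rewrite !exprS bopME -mulrA (le_trans (hY _))// ler_wpM2l.
pose P m : bop H := \sum_(j < m) Y ^+ j.
have PS m : P m.+1 = 1 + Y * P m.
  rewrite /P big_ord_recl expr0 mulr_sumr; congr (_ + _).
  by apply: eq_bigr => i _; rewrite -exprS.
have PS' m : P m.+1 = P m + Y ^+ m by rewrite /P big_ord_recr.
have geo m : \sum_(j < m) r ^+ j <= c.
  have : (1 - r) * \sum_(j < m) r ^+ j <= 1.
    have -> : (1 - r) * (\sum_(j < m) r ^+ j) = 1 - r ^+ m.
      by rewrite -[in RHS](expr1n _ m) subrXX; congr (_ * _); apply: eq_bigr => i _; rewrite expr1n mul1r.
    by rewrite lerBlDr lerDl exprn_ge0.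
  have -> : 1 - r = c^-1 by rewrite /r -c1 opprB addrC subrK.
  by rewrite -ler_pdivlMl ?invr_gt0// invrK mulr1.
pose T m : bop H := bscal c%:C - P m.
have NP m : N (P m).
  elim: m => [|m IH]; first by rewrite /P big_ord0 -(sc0 sa); exact: N_sc.
  by rewrite PS; apply: N_D => //; exact: N_M.
have sP m : sadj (P m).
  change (bst (P m) = P m).
  by rewrite /P (st_sum sa); apply: eq_bigr => i _; apply: sadjX.
have scl (a : R) : sadj (bscal a%:C).
  by have := sadjZ a (@sadj1 _ _ _ ipH); rewrite mulr1.
have pT m : pos (T m).
  split; first exact: sadjB.
  move=> v; rewrite bopDE bopNE (rfD rf) (rfN rf) bscalE (rfZ rf) subr_ge0 -hn_sqr.
  apply: (@le_trans _ _ ((\sum_(j < m) r ^+ j) * hn v ^+ 2)).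
    rewrite bop_sumE mulr_suml.
    have -> : rip (\sum_(j < m) (Y ^+ j) v) v = \sum_(j < m) rip ((Y ^+ j) v) v.
      by apply: (big_morph (rip^~ v)) => [a b|]; rewrite ?(rfD rf) ?(rf0 rf).
    apply: ler_sum => j _; apply: rip_bound => w; exact: hYk.
  by rewrite ler_wpM2r ?sqr_ge0.
have dT m : ople ip (T m.+1) (T m).
  move=> v; rewrite /T PS' !bopDE !bopNE !(rfD rf) !(rfN rf) bopDE (rfD rf).
  by have := (pos_exp m pY).2 v; lra.
have [L [NL pL LT TL _]] := N_decreasing (fun m => N_B (N_sc c%:C) (NP m)) pT dT.
pose Q : bop H := bscal c%:C - L.
have PQ v : P m v @[m --> \oo] --> Q v.
  have -> : (fun m => P m v) = (fun m => c%:C *: v - T m v).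
    by apply/funext => m; rewrite /T bopDE bopNE bscalE opprB addrC subrK.
  by apply: cvgB; [exact: cvg_cst|exact: TL].
have YQ : (1 - Y) * Q = 1.
  apply/eqP; rewrite mulrBl mul1r subr_eq addrC eq_sym; apply/eqP; apply: bop_ext => v.
  have h1 : P m.+1 v @[m --> \oo] --> Q v by have := PQ v; rewrite -cvg_shiftS.
  apply/esym; apply: norm_cvg_unique h1 _; rewrite addrC bopDE bop1E bopME.
  have -> : (fun m => P m.+1 v) = (fun m => v + Y (P m v)).
    by apply/funext => m; rewrite PS bopDE bop1E bopME.
  have h2 : (v + Y (P m v)) @[m --> \oo] --> v + Y (Q v).
    by apply: cvgD; [exact: cvg_cst|exact: (bop_cvg (T := Y) (PQ v))].
  exact: h2.
pose G : bop H := bscal (c^-1)%:C * Q.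
have SG : (1 + S) * G = 1.
  rewrite -[RHS]YQ /Y opprB addrCA subrr addr0 /G mulrA.
  by rewrite -(sa_scC sa).
have sQ : sadj Q by apply: sadjB => //; exact: pL.1.
have sG : sadj G by exact: sadjZ.
have GS : G * (1 + S) = 1.
  by have := congr1 bst SG; rewrite (sa_stM sa) sG s1S (st1 sa).
have eG v : rip (G v) v = hn (G v) ^+ 2 + rip (S (G v)) (G v).
  have {2}-> : v = ((1 + S) * G) v by rewrite SG bop1E.
  by rewrite bopME bopDE bop1E (rfDr rf) -hn_sqr -(sadj_rip pS.1).
have pG : pos G by split=> // v; rewrite eG addr_ge0 ?sqr_ge0 ?pS.2.
exists G; split => //; first by apply: N_M => //; exact: N_B.
move=> v; rewrite bop1E -hn_sqr.
have h1 : hn (G v) ^+ 2 <= hn (G v) * hn v.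
  by rewrite (le_trans _ (rf_ler rf _ _))// eG lerDl pS.2.
have h2 : hn (G v) <= hn v.
  have [->|h] := eqVneq (hn (G v)) 0; first exact: fnorm_ge0.
  by move: h1; rewrite expr2 ler_pM2l// lt_def h fnorm_ge0.
rewrite (le_trans (rf_ler rf _ _))// -!/(hn _) expr2.
by rewrite ler_wpM2r ?fnorm_ge0.
Qed.

Lemma resolvent_antitone S T (G G' : bop H) : pos S -> ople ip S T ->
  (1 + S) * G = 1 -> (1 + T) * G' = 1 -> ople ip G' G.
Proof.
move=> pS ST SG TG v.
have Su : v = G v + S (G v) by rewrite -{1}(bop1E v) -SG bopME bopDE bop1E.
have Tw : v = G' v + T (G' v) by rewrite -{1}(bop1E v) -TG bopME bopDE bop1E.
set u := G v in Su *; set w := G' v in Tw *.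
have h1 := pS.2 (u - w); have h2 := rf_ge0 rf (u - w); have h3 := ST w.
have e1 : rip w v = rip w u + rip (S w) u by rewrite {1}Su (rfDr rf) -(sadj_rip pS.1).
have e2 : rip u v = rip u u + rip (S u) u by rewrite {1}Su (rfDr rf) -(sadj_rip pS.1).
have e3 : rip w v = rip w w + rip (T w) w by rewrite {1}Tw (rfDr rf) (rfC rf w (T w)).
have e4 : rip (S u) w = rip (S w) u by rewrite (sadj_rip pS.1) (rfC rf).
move: h1 h2; rewrite bopB_lin !(rfD rf, rfDr rf, rfN rf, rfNr rf) (rfC rf u w) e4.
move: e1 e2 e3 h3.
move: (rip w v) (rip u v) (rip w u) (rip (S w) u) (rip u u) (rip (S u) u)
  (rip w w) (rip (T w) w) (rip (S w) w) => a1 a2 a3 a4 a5 a6 a7 a8 a9; lra.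
Qed.

Lemma one_sub_resolvent S (G : bop H) v : pos S -> (1 + S) * G = 1 ->
  rip v v - rip (G v) v <= rip (S v) v.
Proof.
move=> pS SG.
have Sw : v = G v + S (G v) by rewrite -{1}(bop1E v) -SG bopME bopDE bop1E.
move: (G v) Sw => w ->.
have h1 := pS.2 (S w); have h2 := rf_ge0 rf (S w).
have e1 : rip (S (S w)) w = rip (S w) (S w) by rewrite (sadj_rip pS.1).
rewrite !bopD_lin !(rfD rf, rfDr rf) e1.
by rewrite (rfC rf w (S w)); move: h1 h2; lra.
Qed.

Lemma resolvent_star_le T (t : R) (G : bop H) u : 0 < t ->
  (1 + bscal (t ^+ 2)%:C * (bst T * T)) * G = 1 ->
  hn (G (bst T u)) <= hn u / (2 * t).
Proof.
move=> t0 TG; set w := G (bst T u).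
have e : bst T u = w + (t ^+ 2)%:C *: (bst T (T w)).
  by rewrite -[LHS]bop1E -TG bopME bopDE bop1E bopME bscalE bopME.
have : rip (bst T u) w = hn w ^+ 2 + t ^+ 2 * hn (T w) ^+ 2.
  by rewrite e (rfD rf) (rfZ rf) !hn_sqr -(rip_str ipH).
rewrite -(rip_str ipH) => h.
have h1 := rf_ler rf u (T w); rewrite -!/(hn _) in h1.
rewrite -(ler_pXn2r (n:=2))// ?nnegrE ?divr_ge0 ?fnorm_ge0 ?mulr_ge0 ?(ltW t0)//.
have tn : t != 0 by rewrite gt_eqF.
have : 0 <= (hn u / (2 * t) - t * hn (T w)) ^+ 2 by rewrite sqr_ge0.
have -> : (hn u / (2 * t) - t * hn (T w)) ^+ 2 =
   (hn u / (2 * t)) ^+ 2 - hn u * hn (T w) + t ^+ 2 * hn (T w) ^+ 2 by field.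
move: h h1; set X := (_ / _) ^+ 2; lra.
Qed.

(* [b = 1 - L], where [L] is the decreasing limit of the resolvents of
   [\sum_(k < m.+1) k.+1 ^ 2 a_k^* a_k]: these vanish on [u] in the limit since
   [a_k^* u] is close to [u], and stay close to 1 on [v] since [a_k v] is tiny. *)
Lemma egorov T u v (e : R) : MB T -> sadj T -> T u = u -> T v = 0 -> 0 < e ->
  exists b : bop H, [/\ N b, pos b, ople ip b 1, b u = u & rip (b v) v <= e].
Proof.
move=> MT sT Tu Tv e0.
pose dk (k : nat) := Num.sqrt (e / 2 ^+ k.+1) / k.+1%:R.
have dk0 k : 0 < dk k.
  by rewrite divr_gt0// sqrtr_gt0 divr_gt0// exprn_gt0.
have hf k : exists f, hn (bst (ev f) u - u) < k.+1%:R^-1 /\ hn (ev f v) < dk k.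
  have m0 : 0 < Num.min k.+1%:R^-1 (dk k) by rewrite lt_min dk0 invr_gt0 ltr0Sn.
  have [f [f1 f2]] := star_density MT sT Tu Tv m0.
  by exists f; move: f1 f2; rewrite !lt_min => /andP[-> _] /andP[_ ->].
have [f hf'] := choice hf.
pose a k := ev (f k).
pose S' k : bop H := bscal (k.+1%:R ^+ 2)%:C * (bst (a k) * a k).
have pS' k : pos (S' k) by apply: posZ; [exact: sqr_ge0|exact: pos_sq].
have NS' k : N (S' k).
  have Na : N (a k) by exact: N_ev.
  by apply: N_M => //; apply: N_M => //; exact: (N_st Na).
pose S m : bop H := \sum_(k < m.+1) S' k.
have SS m : S m.+1 = S m + S' m.+1 by rewrite /S big_ord_recr.
have S0 : S 0%N = S' 0%N by rewrite /S big_ord1.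
have NS m : N (S m).
  by elim: m => [|m IH]; rewrite ?S0// SS; exact: N_D.
have pS m : pos (S m).
  by elim: m => [|m IH]; rewrite ?S0// SS; exact: posD.
have S'S m : ople ip (S' m) (S m).
  move=> w; case: m => [|m]; first by rewrite S0.
  by rewrite SS bopDE (rfD rf) lerDr; exact: (pS m).2.
have [G hG] := choice (fun m => resolvent (NS m) (pS m)).
have NG m : N (G m) by have [] := hG m.
have pG m : pos (G m) by have [] := hG m.
have SG m : (1 + S m) * G m = 1 by have [] := hG m.
have G1 m : ople ip (G m) 1 by have [] := hG m.
have dG m : ople ip (G m.+1) (G m).
  apply: (@resolvent_antitone _ _ _ _ (pS m) _ (SG m) (SG m.+1)) => w.
  by rewrite SS bopDE (rfD rf) lerDl; exact: (pS' _).2.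
have [L [NL pL LG GL _]] := N_decreasing NG pG dG.
have L1 : ople ip L 1 by move=> w; apply: le_trans (LG 0%N w) (G1 _ w).
have Lu : L u = 0.
  apply: (hn0_eq0 ipH); apply/eqP; rewrite -sqrf_eq0 eq_le sqr_ge0 andbT.
  rewrite (le_trans (hn_contract u pL L1))//.
  apply: le_eps => t t0; rewrite add0r.
  pose B := hn u * (1 + hn u / 2).
  have B1 : 0 < B + 1 by rewrite ltr_wpDl// mulr_ge0 ?addr_ge0 ?divr_ge0 ?fnorm_ge0.
  have [m /(_ m (leqnn m)) hm] := invSn_lt (divr_gt0 t0 B1).
  rewrite (le_trans (LG m u))//.
  have [G' [NG' pG' SG' _ G'1]] := resolvent (NS' m) (pS' m).
  rewrite (le_trans (resolvent_antitone (pS' m) (S'S m) SG' (SG m) u))//.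
  rewrite (le_trans (rf_ler rf _ _))// -!/(hn _).
  have h1 : hn (G' u) <= m.+1%:R^-1 * (1 + hn u / 2).
    have -> : G' u = G' (bst (a m) u) - G' (bst (a m) u - u).
      by rewrite bopB_lin opprB addrC subrK.
    rewrite (le_trans (fnormD rf _ _))// (fnormN rf) -!/(hn _).
    have h2 : hn (G' (bst (a m) u)) <= hn u / (2 * m.+1%:R).
      by apply: (resolvent_star_le (T := a m)); rewrite ?ltr0Sn.
    have h3 : hn (G' (bst (a m) u - u)) <= m.+1%:R^-1.
      by rewrite (le_trans (hn_contract_le _ pG' G'1))// ltW//; exact: (hf' m).1.
    have -> : m.+1%:R^-1 * (1 + hn u / 2) = m.+1%:R^-1 + hn u / (2 * m.+1%:R).
      have : (m.+1%:R : R) != 0 by rewrite pnatr_eq0.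
      by move: (m.+1%:R : R) => z z0; field.
    by rewrite addrC lerD.
  rewrite (@le_trans _ _ (m.+1%:R^-1 * (B + 1)))//.
    rewrite (@le_trans _ _ (m.+1%:R^-1 * (1 + hn u / 2) * hn u))//.
      by rewrite ler_wpM2r ?fnorm_ge0.
    by rewrite -mulrA (mulrC _ (hn u)) ler_wpM2l ?invr_ge0// lerDl.
  by rewrite -ler_pdivlMr// ltW.
exists (1 - L); split.
- exact: N_B.
- by apply/ople_pos; [exact: pL.1|exact: sadj1|].
- by move=> w; rewrite bopDE bopNE (rfD rf) (rfN rf) gerBl; exact: pL.2.
- by rewrite bopDE bopNE Lu subr0 bop1E.
rewrite bopDE bopNE bop1E (rfD rf) (rfN rf).
suff h m : rip v v - e <= rip (G m v) v.
  have h' : rip v v - e <= rip (L v) v.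
    have cv := rip_cvg (w := v) ipH (GL v).
    by apply: (ler_cvg_to (cvg_cst _) cv); near=> m; exact: h.
  by move: h'; lra.
have := one_sub_resolvent v (pS m) (SG m).
suff : rip (S m v) v <= e by lra.
have hS' k : rip (S' k v) v <= e / 2 ^+ k.+1.
  rewrite ripZl bopME -(rip_str ipH) -hn_sqr -exprMn.
  have h : k.+1%:R * hn (a k v) <= Num.sqrt (e / 2 ^+ k.+1).
    by rewrite mulrC -ler_pdivlMr// ltW//; exact: (hf' k).2.
  rewrite -[leRHS]sqr_sqrtr; last by rewrite divr_ge0 ?(ltW e0)// exprn_ge0.
  by rewrite ler_pXn2r ?nnegrE ?mulr_ge0 ?fnorm_ge0 ?sqrtr_ge0.
have : rip (S m v) v <= e - e / 2 ^+ m.+1.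
  elim: m => [|m IH].
    by rewrite S0 (le_trans (hS' 0%N))// expr1; lra.
  rewrite SS bopDE (rfD rf) (le_trans (lerD IH (hS' m.+1)))//.
  have h2 : (2 : R) ^+ m.+1 != 0 by rewrite expf_neq0.
  suff : e / 2 ^+ m.+1 = 2 * (e / 2 ^+ m.+2) by lra.
  by rewrite (exprS _ m.+1); field.
have : 0 <= e / 2 ^+ m.+1 by rewrite divr_ge0 ?(ltW e0)// exprn_ge0.
lra.
Unshelve. all: by end_near. Qed.

Definition isproj T := sadj T /\ T * T = T.

Lemma isproj_rip T v : isproj T -> rip (T v) v = hn (T v) ^+ 2.
Proof. by move=> [sT TT]; rewrite hn_sqr -(sadj_rip sT) -bopME TT. Qed.

Lemma isproj_le T v : isproj T -> hn (T v) <= hn v.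
Proof.
move=> pT; have := rf_ler rf (T v) v; rewrite (isproj_rip v pT) -!/(hn _) => h.
have [->|h0] := eqVneq (hn (T v)) 0; first exact: fnorm_ge0.
by move: h; rewrite expr2 ler_pM2l// lt_def h0 fnorm_ge0.
Qed.

Lemma isproj_pos T : isproj T -> pos T.
Proof. by move=> pT; split=> [|v]; [exact: pT.1|rewrite isproj_rip// sqr_ge0]. Qed.

Lemma isproj_idem T v : isproj T -> T (T v) = T v.
Proof. by move=> [_ TT]; rewrite -bopME TT. Qed.

Lemma isproj1 : isproj 1.
Proof. by split; [exact: sadj1|rewrite mulr1]. Qed.

Lemma isproj_compl T : isproj T -> isproj (1 - T).
Proof.
move=> [sT TT]; split; first by apply: sadjB => //; exact: sadj1.
by rewrite mulrBl mul1r mulrBr mulr1 TT subrr subr0.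
Qed.

Lemma isproj_fix T v : isproj T -> hn (T v) = hn v -> T v = v.
Proof.
move=> pT h; apply/eqP; rewrite -subr_eq0; apply/eqP/(hn0_eq0 ipH)/eqP.
rewrite -sqrf_eq0 hn_sqr (rfD rf) !(rfDr rf) !(rfNr rf) !(rfN rf).
by rewrite (rfC rf v) (isproj_rip v pT) -!hn_sqr h; apply/eqP; ring.
Qed.

Lemma fixed_projection b : N b -> pos b -> ople ip b 1 -> exists f : bop H,
  [/\ N f, isproj f, forall v, f v = v <-> b v = v & ople ip f b].
Proof.
move=> Nb pb b1.
pose T k : bop H := b ^+ k * b ^+ k.
have NT k : N (T k) by apply: N_M; exact: N_exp.
have sbk k : sadj (b ^+ k) by apply: sadjX; exact: pb.1.
have pT k : pos (T k) by rewrite /T -{1}(sbk k); exact: pos_sq.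
have ripT k v : rip (T k v) v = hn ((b ^+ k) v) ^+ 2.
  by rewrite bopME (sadj_rip (sbk k)) hn_sqr.
have dT k : ople ip (T k.+1) (T k).
  move=> v; rewrite !ripT ler_pXn2r ?nnegrE ?fnorm_ge0//.
  by rewrite exprS bopME; exact: hn_contract_le.
have [f [Nf pf _ Tf _]] := N_decreasing NT pT dT.
have bfix v : b (b v) = v -> b v = v.
  move=> bbv; pose w := v - b v.
  have bw : b w = - w by rewrite /w bopB_lin bbv opprB.
  have := pb.2 w; rewrite bw (rfN rf) -hn_sqr oppr_ge0 => h.
  have /(hn0_eq0 ipH)/eqP : hn w = 0.
    by apply/eqP; rewrite -sqrf_eq0 eq_le h sqr_ge0.
  by rewrite subr_eq0 => /eqP.
have bf v : b (f v) = f v.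
  apply: bfix.
  have h1 : T k.+1 v @[k --> \oo] --> f v by have := Tf v; rewrite -cvg_shiftS.
  have h2 : T k.+1 v @[k --> \oo] --> b (b (f v)).
    have -> : (fun k => T k.+1 v) = (fun k => b (b (T k v))).
      by apply/funext => k; rewrite /T exprS -mulrA [b ^+ k * (b * _)]mulrA -exprSr exprS -mulrA !bopME.
    exact: (bop_cvg (T := b) (bop_cvg (T := b) (Tf v))).
  exact: norm_cvg_unique h2 h1.
have fb v : b v = v -> f v = v.
  move=> bv; have bk k : (b ^+ k) v = v.
    by elim: k => [|k IH]; rewrite ?expr0 ?bop1E// exprS bopME IH.
  have h := Tf v; have eT : (fun k => T k v) = cst v.
    by apply/funext => k; rewrite /T bopME !bk.
  rewrite eT in h; exact: norm_cvg_unique h (cvg_cst _).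
have ff : isproj f.
  by split; [exact: pf.1|apply: bop_ext => v; rewrite bopME; apply: fb; exact: bf].
exists f; split => // [v|v].
  by split => [fv|]; [rewrite -fv; exact: bf|exact: fb].
rewrite (isproj_rip v ff) hn_sqr.
have [w hw] : exists w, w = v - f v by exists (v - f v).
have ev' : v = f v + w by rewrite hw addrC subrK.
have o : rip (f v) w = 0.
  by rewrite hw (rfDr rf) (rfNr rf) (isproj_rip v ff) -hn_sqr subrr.
rewrite [X in _ <= rip (b X) X]ev' bopD_lin bf !(rfD rf) !(rfDr rf) o.
rewrite (sadj_rip pb.1 w (f v)) bf (rfC rf w) o.
by have := pb.2 w; lra.
Qed.

Lemma projection_meet f g : N f -> isproj f -> N g -> isproj g ->
  exists h : bop H, [/\ N h, isproj h, forall v, h v = v <-> f v = v /\ g v = v & ople ip h f].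
Proof.
move=> Nf pf Ng pg; pose b := f * g * f.
have pb : pos b by rewrite /b -{1}pf.1; apply: pos_congr; exact: isproj_pos.
have ripb v : rip (b v) v = hn (g (f v)) ^+ 2.
  by rewrite /b !bopME (sadj_rip pf.1) (isproj_rip (f v) pg).
have b1 : ople ip b 1.
  move=> v; rewrite ripb bop1E -hn_sqr ler_pXn2r ?nnegrE ?fnorm_ge0//.
  by rewrite (le_trans (isproj_le _ pg))// isproj_le.
have [h [Nh ph hb _]] := fixed_projection (N_M (N_M Nf Ng) Nf) pb b1.
have hfg v : h v = v <-> f v = v /\ g v = v.
  split; last by move=> [fv gv]; apply/hb; rewrite /b !bopME fv gv fv.
  move=> /hb bv; rewrite /b !bopME in bv.
  have fv : f v = v by rewrite -bv isproj_idem.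
  split=> //; apply: isproj_fix => //; apply/eqP.
  rewrite eq_le isproj_le//= -{1}bv fv; exact: isproj_le.
exists h; split => // v.
have fh w : f (h w) = h w by have /hfg[] : h (h w) = h w by exact: isproj_idem.
have hf w : h w = h (f w).
  have e : f * h = h by apply: bop_ext => z; rewrite bopME fh.
  have : h = h * f by have := congr1 bst e; rewrite (sa_stM sa) pf.1 ph.1.
  by move=> /(congr1 (fun S : bop H => S w)).
rewrite !isproj_rip// ler_pXn2r ?nnegrE ?fnorm_ge0// hf.
exact: isproj_le.
Qed.

Lemma rtr_faithful T : MB T -> rtr (bst T * T) <= 0 -> T = 0.
Proof.
move=> MT h; have h0 := ta_ge0 tr MT.
have e : tau (adjoint ip T \o T) = 0.
  rewrite adjointE -bmul_fun; move: h h0; rewrite lecE /retrace /tauB.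
  case: (tau _) => a b /= h /andP[/eqP -> h']; apply/eqP.
  by rewrite eq_complex/= eqxx andbT eq_le h h'.
by apply: bop_ext => v; rewrite (trace_faithful tauM MT e) bop0E.
Qed.

Lemma least_projection (Xi : set H) : exists e : bop H,
  [/\ N e, isproj e, forall v, Xi v -> e v = v &
      forall f, N f -> isproj f -> (forall v, Xi v -> f v = v) -> f * e = e].
Proof.
pose F f := [/\ N f, isproj f & forall v, Xi v -> f v = v].
have F1 : F 1 by split => // [|v _]; [exact: isproj1|rewrite bop1E].
pose E := [set rtr f | f in F].
have Einf : has_inf E.
  split; first by exists (rtr 1), 1.
  by exists 0 => _ [f [[Mf _] pf _] <-]; apply: (rtr_pos tauM x_gen Mf); exact: isproj_pos.
pose m := inf E.
have mF f : F f -> m <= rtr f by move=> Ff; apply: ge_inf; [exact: Einf.2|exists f].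
have hgex k : exists g, F g /\ rtr g < m + k.+1%:R^-1.
  have k0 : (0 : R) < k.+1%:R^-1 by rewrite invr_gt0.
  by have [_ [f Ff <-] h] := inf_adherent k0 Einf; exists f.
have [g hg] := choice hgex.
have hmt (fg : bop H * bop H) : exists h, F fg.1 -> F fg.2 -> [/\ F h,
    forall v, h v = v <-> fg.1 v = v /\ fg.2 v = v, ople ip h fg.1 & ople ip h fg.2].
  have [[Ff Fg]|nF] := pselect (F fg.1 /\ F fg.2); last by exists 0 => Ff Fg; case: nF.
  case: fg Ff Fg => f g' /= [Nf pf Xf] [Ng pg Xg].
  have [h [Nh ph hv hf]] := projection_meet Nf pf Ng pg.
  have [h' [Nh' ph' hv' hg']] := projection_meet Ng pg Nf pf.
  exists h => _ _; split => //.
    by split=> // v Xv; apply/hv; rewrite Xf ?Xg.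
  have -> : h = h'; last exact: hg'.
  have hh : h' * h = h.
    apply: bop_ext => v; rewrite bopME; apply/hv'.
    by have /hv[] := isproj_idem v ph.
  have hh' : h * h' = h'.
    apply: bop_ext => v; rewrite bopME; apply/hv.
    by have /hv'[] := isproj_idem v ph'.
  by rewrite -hh' -{1}hh -{1}(sa_stK sa (h' * h)) (sa_stM sa) ph.1 ph'.1 hh' ph'.1.
have [mt0 mtP] := choice hmt.
pose mt f h := mt0 (f, h).
pose f := fix f k : bop H := if k is k'.+1 then mt (f k') (g k) else g 0%N.
have Ff k : F (f k).
  elim: k => [|k IH]; first exact: (hg 0%N).1.
  by have [] := mtP (f k, g k.+1) IH (hg k.+1).1.
have Nf k : N (f k) by have [] := Ff k.
have pf k : isproj (f k) by have [] := Ff k.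
have df k : ople ip (f k.+1) (f k).
  by have [] := mtP (f k, g k.+1) (Ff k) (hg k.+1).1.
have fg k : ople ip (f k) (g k).
  case: k => [|k]; first by move=> v.
  by have [] := mtP (f k, g k.+1) (Ff k) (hg k.+1).1.
have ffix k v : f k.+1 v = v -> f k v = v.
  by have [_ h _ _] := mtP (f k, g k.+1) (Ff k) (hg k.+1).1; move=> /h[].
have fdec k j v : f (k + j)%N v = v -> f k v = v.
  by elim: j => [|j IH]; rewrite ?addn0// addnS => /ffix.
have [e [Ne pe ef fe _]] := N_decreasing Nf (fun k => isproj_pos (pf k)) df.
have fke k v : f k (e v) = e v.
  have h1 : f (j + k)%N v @[j --> \oo] --> e v by have := fe v; rewrite -(cvg_shiftn k).
  have h2 := bop_cvg (T := f k) h1.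
  have e2 : (fun j => f k (f (j + k)%N v)) = (fun j => f (j + k)%N v).
    by apply/funext => j; apply: (fdec k j); rewrite addnC isproj_idem.
  rewrite e2 in h2; exact: norm_cvg_unique h2 h1.
have ppe : isproj e.
  split; first exact: pe.1.
  apply: bop_ext => v; rewrite bopME.
  have h1 := fe (e v); have e1 : (fun k => f k (e v)) = cst (e v).
    by apply/funext => k; rewrite fke.
  rewrite e1 in h1; exact: norm_cvg_unique h1 (cvg_cst _).
have Fe : F e.
  split=> // v Xv; have h1 := fe v.
  have e1 : (fun k => f k v) = cst v by apply/funext => k; have [_ _ ->] := Ff k.
  rewrite e1 in h1; exact: norm_cvg_unique h1 (cvg_cst _).
have rte : rtr e <= m.
  apply: le_invSn => k; have := (hg k).2.
  have Mg : MB (g k) by have [[Mgk _] _ _] := (hg k).1.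
  have sg : sadj (g k) by have [_ [sgk _] _] := (hg k).1.
  have h1 := rtr_ople (Nf k).1 Mg (pf k).1 sg (fg k).
  have h2 := rtr_ople Ne.1 (Nf k).1 pe.1 (pf k).1 (ef k).
  by move=> /ltW h; exact: le_trans h2 (le_trans h1 h).
exists e; split => //; first by case: Fe.
move=> f' Nf' pf' Xf'; have Ff' : F f' by [].
have [Fh hv he hf'] := mtP (e, f') Fe Ff'; move: Fh hv he hf'.
set h : bop H := mt0 _ => /= Fh hv he hf'.
have [Nh ph _] := Fh.
have eh : e * h = h.
  by apply: bop_ext => v; rewrite bopME; have /hv[] := isproj_idem v ph.
have he' : h * e = h.
  by have := congr1 bst eh; rewrite (sa_stM sa) ppe.1 ph.1.
have deq : bst (e - h) * (e - h) = e - h.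
  rewrite (sadjB ppe.1 ph.1) mulrBl !mulrBr ppe.2 eh he' ph.2 subrr subr0.
  by [].
have /eqP : e - h = 0.
  apply: rtr_faithful; first exact: (D_B tr Ne.1 Nh.1).
  by rewrite deq (rtrB tr Ne.1 Nh.1) subr_le0 (le_trans rte)// mF.
rewrite subr_eq0 => /eqP eeh; apply: bop_ext => v; rewrite bopME.
by have /hv[] : h (e v) = e v by rewrite -eeh isproj_idem.
Qed.

(* For [p v = v], the powers of the operators [b] of [egorov] give projections of
   the closure fixing [v] and arbitrarily small at a given [w] in the kernel of
   [p]; so the least one vanishes on the kernel of [p]. *)
Lemma nclos_projection p : MB p -> isproj p -> N p.
Proof.
move=> Mp pp.
have [e [Ne pe eX emin]] := least_projection [set v | p v = 0].
have ep v : p v = v -> e v = 0.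
  move=> pv; have [d [Nd pd dX dmin]] := least_projection [set v].
  have dv : d v = v by apply: dX.
  have dw w : p w = 0 -> d w = 0.
    move=> pw; apply: (hn0_eq0 ipH); apply/eqP.
    rewrite -sqrf_eq0 eq_le sqr_ge0 andbT; apply: le_eps => t t0; rewrite add0r.
    have [b [Nb pb b1 bv bw]] := egorov Mp pp.1 pv pw t0.
    have [f [Nf pf fb lefb]] := fixed_projection Nb pb b1.
    have fd : f * d = d by apply: dmin => // _ ->; apply/fb.
    have df : d * f = d by have := congr1 bst fd; rewrite (sa_stM sa) pf.1 pd.1.
    rewrite (le_trans _ bw)// (le_trans _ (lefb w))// (isproj_rip w pf).
    rewrite ler_pXn2r ?nnegrE ?fnorm_ge0// -{1}df bopME; exact: isproj_le.
  have : (1 - d) * e = e.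
    apply: emin; [exact: N_B|exact: isproj_compl|].
    by move=> w /dw dw0; rewrite bopDE bopNE bop1E dw0 subr0.
  move/eqP; rewrite mulrBl mul1r subr_eq addrC -subr_eq subrr eq_sym => /eqP de.
  have : e * d = 0.
    by have := congr1 bst de; rewrite (sa_stM sa) pe.1 pd.1 (st0 sa).
  by move=> /(congr1 (fun S : bop H => S v)); rewrite bopME dv bop0E.
have -> : p = 1 - e.
  apply: bop_ext => v; rewrite bopDE bopNE bop1E.
  have h1 : e (p v) = 0 by apply: ep; exact: isproj_idem.
  have h2 : e (v - p v) = v - p v.
    by apply: eX; rewrite /= bopB_lin isproj_idem// subrr.
  move: h2; rewrite bopB_lin h1 subr0 => ->.
  by rewrite opprB addrC subrK.
exact: N_B.
Qed.

End TwoNormClosure.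

(** * Matrices *)

Section MatrixAlgebra.
Context {R : realType}.
Local Notation C := R[i].

Definition nsq (z : C) : R := complex.Re z ^+ 2 + complex.Im z ^+ 2.

Lemma nsq_ge0 z : 0 <= nsq z. Proof. by rewrite addr_ge0 ?sqr_ge0. Qed.

Lemma conj_mul_nsq (z : C) : Num.conj z * z = (nsq z)%:C.
Proof.
case: z => a b; apply/eqP; rewrite eq_complex/= /nsq/=.
by apply/andP; split; apply/eqP; ring.
Qed.

Lemma nsqM (z w : C) : nsq (z * w) = nsq z * nsq w.
Proof. by case: z => a b; case: w => c d; rewrite /nsq/=; ring. Qed.

Lemma nsq_real (a : R) : nsq a%:C = a ^+ 2.
Proof. by rewrite /nsq/= expr0n/= addr0. Qed.

Section FixedSize.
Variable k : nat.
Local Notation Mk := 'M[C]_k.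
Implicit Types (a b x y u : Mk).
Local Notation st := (@mxadjoint R k k).

Definition msc (c : C) : Mk := c%:M.

Lemma mx_star_alg : star_alg msc st.
Proof.
split; rewrite /msc /mxadjoint.
- by [].
- by move=> c d; exact: raddfD.
- by move=> c d; exact: scalar_mxM.
- by move=> c x; exact: (esym (scalar_mxC c x)).
- by move=> c; rewrite tr_scalar_mx map_scalar_mx.
- by move=> x y; rewrite linearD/= map_mxD.
- by move=> x y; rewrite [(x * y)^T]trmx_mul map_mxM.
- by move=> x; apply/matrixP => i j; rewrite !mxE conjCK.
Qed.

Lemma mxtrace_star x : \tr (st x *m x) = (\sum_i \sum_j nsq (x i j))%:C.
Proof.
rewrite exchange_big/= rmorph_sum/= /mxtrace; apply: eq_bigr => i _.
rewrite rmorph_sum/= mxE; apply: eq_bigr => j _.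
by rewrite !mxE conj_mul_nsq.
Qed.

Lemma ReC (c : R) : complex.Re c%:C = c. Proof. by []. Qed.

Hypothesis k0 : (0 < k)%N.
Let kR0 : 0 < (k%:R : R). Proof. by rewrite ltr0n. Qed.

Lemma natrC m : (m%:R : C) = (m%:R : R)%:C.
Proof. by rewrite rmorph_nat. Qed.

Lemma mx_tracial : tracial msc st setT (@ntrace R k).
Proof.
split=> //.
- exact: mx_star_alg.
- move=> c x y _ _; rewrite /ntrace [msc c * x]mul_scalar_mx mxtraceD mxtraceZ.
  by rewrite mulrDl mulrA.
- by move=> x y _ _; rewrite /ntrace [x * y]/(x *m y) mxtrace_mulC.
- move=> x _; rewrite /ntrace [st x * x]/(st x *m x) mxtrace_star.
  rewrite mulr_ge0 ?invr_ge0 ?ler0n// ler0c.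
  by apply: sumr_ge0 => i _; apply: sumr_ge0 => j _; exact: nsq_ge0.
- by rewrite /ntrace mxtrace1 divff// pnatr_eq0 -lt0n.
Qed.
Let tr := mx_tracial.
Let sa := mx_star_alg.
Local Notation rtr := (@retrace R Mk (@ntrace R k)).
Local Notation n2 := (@norm2 R Mk st (@ntrace R k)).

Lemma rtrE x : rtr x = complex.Re (\tr x) / k%:R.
Proof.
rewrite /rtr /ntrace natrC -fmorphV/= mulrC ReC_mul mulrC.
by [].
Qed.

Lemma n2_entries x : n2 x ^+ 2 = (\sum_i \sum_j nsq (x i j)) / k%:R.
Proof. by rewrite (n2_sqr tr)// rtrE [st x * x]/(st x *m x) mxtrace_star. Qed.

Lemma n2_le_entries x y :
  \sum_i \sum_j nsq (x i j) <= \sum_i \sum_j nsq (y i j) -> n2 x <= n2 y.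
Proof.
move=> h; have kV : 0 <= (k%:R : R)^-1 by rewrite invr_ge0.
have := ler_wpM2r kV h; rewrite -!n2_entries.
by rewrite ler_sqr ?nnegrE ?n2_ge0.
Qed.

Definition unitary u := st u * u = 1 /\ u * st u = 1.

Lemma n2_unitaryl u x : unitary u -> n2 (u * x) = n2 x.
Proof.
move=> [uu _]; rewrite /norm2 (sa_stM sa) -mulrA (mulrA (st u)) uu mul1r.
by [].
Qed.

Lemma n2_unitaryr u x : unitary u -> n2 (x * u) = n2 x.
Proof.
move=> [_ uu]; rewrite /norm2 (sa_stM sa) (rtr_comm tr)//.
rewrite (mulrA _ (st u)) -(mulrA x) uu mulr1 (rtr_comm tr)//.
Qed.

Lemma unitary_st u : unitary u -> unitary (st u).
Proof. by move=> [h1 h2]; split; rewrite (sa_stK sa). Qed.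

Lemma hermitian_spectral b : st b = b -> exists u (lam : 'I_k -> R),
  unitary u /\ b = st u * diag_mx (\row_i (lam i)%:C) * u.
Proof.
move=> hb.
have hh : b \is hermsymmx.
  apply/is_hermitianmxP; rewrite expr0 scale1r -{1}hb.
  by apply/matrixP => i j; rewrite !mxE.
have hu := spectral_unitarymx b.
have e : st (spectralmx b) = invmx (spectralmx b).
  by rewrite invmx_unitary//; apply/matrixP => i j; rewrite !mxE.
have hd := hermitian_spectral_diag_real hh.
exists (spectralmx b), (fun i => complex.Re (spectral_diag b 0 i)); split.
  split; rewrite e.
    exact: (mulVmx (spectral_unit b)).
  exact: (mulmxV (spectral_unit b)).
have -> : (\row_i (complex.Re (spectral_diag b 0 i))%:C) = spectral_diag b.
  apply/matrixP => i j; rewrite ord1 mxE RRe_real//.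
  exact: (mxOverP hd 0 j).
rewrite e; exact/orthomx_spectralP/hermitian_normalmx.
Qed.

Definition dmx (d : 'I_k -> R) : Mk := diag_mx (\row_i (d i)%:C).

Lemma dmxM d e : dmx d * dmx e = dmx (fun i => d i * e i).
Proof.
rewrite [LHS]mulmx_diag; congr diag_mx; apply/matrixP => i j.
by rewrite !mxE rmorphM.
Qed.

Lemma dmxB d e : dmx d - dmx e = dmx (fun i => d i - e i).
Proof. by apply/matrixP => i j; rewrite !mxE -mulrnBl rmorphB. Qed.

Lemma dmx_st d : st (dmx d) = dmx d.
Proof.
rewrite /mxadjoint tr_diag_mx map_diag_mx; congr diag_mx; apply/matrixP => i j.
by rewrite !mxE; apply/eqP; rewrite eq_complex/= oppr0 !eqxx.
Qed.

Lemma dmx_cst (c : R) : dmx (fun=> c) = msc c%:C.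
Proof. by apply/matrixP => i j; rewrite !mxE. Qed.

Lemma dmxX d m : dmx d ^+ m = dmx (fun i => d i ^+ m).
Proof.
elim: m => [|m IH]; first by rewrite expr0 dmx_cst.
by rewrite exprS IH dmxM; congr dmx; apply/funext => i; rewrite exprS.
Qed.

Lemma dmx_mulE d x i j : (dmx d * x) i j = (d i)%:C * x i j.
Proof. by rewrite [dmx d * x]mul_diag_mx !mxE. Qed.

Lemma dmx_mulrE d x i j : (x * dmx d) i j = x i j * (d j)%:C.
Proof. by rewrite [x * dmx d]mul_mx_diag !mxE. Qed.

Lemma rtr_dmx d : rtr (dmx d) = (\sum_i d i) / k%:R.
Proof.
rewrite rtrE; congr (_ / _); rewrite -[RHS]ReC rmorph_sum/= /mxtrace.
by congr complex.Re; apply: eq_bigr => i _; rewrite !mxE eqxx.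
Qed.

Lemma n2_dmx_le d x (K : R) : 0 <= K -> (forall i, `|d i| <= K) ->
  n2 (dmx d * x) <= K * n2 x.
Proof.
move=> K0 dK; rewrite -(ler_pXn2r (n:=2))// ?nnegrE ?mulr_ge0 ?n2_ge0//.
rewrite exprMn !n2_entries mulrA ler_wpM2r ?invr_ge0 ?(ltW kR0)//.
rewrite mulr_sumr; apply: ler_sum => i _; rewrite mulr_sumr; apply: ler_sum => j _.
rewrite dmx_mulE nsqM nsq_real ler_wpM2r ?nsq_ge0//.
by rewrite -(real_normK (num_real (d i))) ler_pXn2r ?nnegrE.
Qed.

Lemma n2_dmx_le2 d e x : (forall i, `|d i| <= `|e i|) ->
  n2 (dmx d * x) <= n2 (dmx e * x).
Proof.
move=> de; apply: n2_le_entries.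
apply: ler_sum => i _; apply: ler_sum => j _.
rewrite !dmx_mulE !nsqM !nsq_real ler_wpM2r ?nsq_ge0//.
rewrite -(real_normK (num_real (d i))) -(real_normK (num_real (e i))).
by rewrite ler_pXn2r ?nnegrE.
Qed.

Lemma unitary_conjX u x m : unitary u -> (st u * x * u) ^+ m = st u * x ^+ m * u.
Proof.
move=> [uu uu']; elim: m => [|m IH]; first by rewrite !expr0 mulr1 uu.
rewrite !exprS IH !mulrA; congr (_ * _ * _).
by rewrite -(mulrA _ u) uu' mulr1.
Qed.

Lemma rtr_unitary_conj u x : unitary u -> rtr (st u * x * u) = rtr x.
Proof. by move=> [_ uu]; rewrite (rtr_comm tr)// mulrA uu mul1r. Qed.

Lemma unitary_conj_st u x : st (st u * x * u) = st u * st x * u.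
Proof. by rewrite !(sa_stM sa) (sa_stK sa) mulrA. Qed.

Definition clip (c t : R) := Num.max (- c) (Num.min c t).

Lemma clip_le c t : 0 <= c -> `|clip c t| <= c.
Proof.
move=> c0; rewrite ler_norml /clip le_max lexx/= ge_max ge_min lexx/= andbT.
lra.
Qed.

Lemma clip_dist c t m : 0 < c -> (t - clip c t) ^+ 2 * c ^+ (2 * m) <= t ^+ (2 * m).+2.
Proof.
move=> c0.
have [tc|tc] := leP `|t| c.
  have -> : clip c t = t.
    by move: tc; rewrite ler_norml /clip => /andP[h1 h2]; rewrite min_r// max_r.
  rewrite subrr expr0n/= mul0r -[(2 * m).+2]/(2 + 2 * m)%N -mulnS exprM.
  by rewrite exprn_ge0// sqr_ge0.
have h1 : (t - clip c t) ^+ 2 <= t ^+ 2.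
  have h : `|t - clip c t| <= `|t|.
    move: tc; rewrite /clip; case: (lerP 0 t) => t0.
      rewrite ger0_norm// => tc; rewrite min_l ?(ltW tc)// max_r; last by lra.
      by rewrite ger0_norm; lra.
    rewrite ltr0_norm// => tc; rewrite min_r; last by lra.
    rewrite max_l; last by lra.
    by rewrite ltr0_norm; lra.
  by rewrite -(real_normK (num_real t)) -(real_normK (num_real (t - _))) ler_pXn2r ?nnegrE.
rewrite -[(2 * m).+2]/(2 + 2 * m)%N exprD.
apply: ler_pM; rewrite ?sqr_ge0 ?exprn_ge0 ?(ltW c0)//.
rewrite !exprM; apply: lerXn2r; rewrite ?nnegrE ?sqr_ge0//.
by rewrite -(real_normK (num_real t)) ler_pXn2r ?nnegrE ?(ltW c0)// ltW.
Qed.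

Lemma truncation b (c : R) m : st b = b -> 0 < c -> exists b', [/\ st b' = b',
  opbd st setT (@ntrace R k) c b' &
  n2 (b - b') ^+ 2 * c ^+ (2 * m) <= rtr (b ^+ (2 * m).+2)].
Proof.
move=> hb c0; have [u [lam [uu bE]]] := hermitian_spectral hb.
pose b' := st u * dmx (fun i => clip c (lam i)) * u.
exists b'; split.
- by rewrite /b' unitary_conj_st dmx_st.
- split=> [|y _]; first exact: ltW.
  rewrite /b' -!mulrA n2_unitaryl; last exact: unitary_st.
  rewrite -(n2_unitaryl y uu); apply: n2_dmx_le; first exact: ltW.
  by move=> i; apply: clip_le; exact: ltW.
have -> : b - b' = st u * dmx (fun i => lam i - clip c (lam i)) * u.
  by rewrite bE /b' -/(dmx lam) -mulrBl -mulrBr dmxB.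
rewrite (n2_unitaryr _ uu) (n2_unitaryl _ (unitary_st uu)) (n2_sqr tr)// dmx_st dmxM.
rewrite bE -/(dmx lam) unitary_conjX// rtr_unitary_conj// dmxX !rtr_dmx.
rewrite mulrAC ler_wpM2r ?invr_ge0 ?(ltW kR0)// mulr_suml; apply: ler_sum => i _.
by rewrite -expr2; exact: clip_dist.
Qed.

Lemma euclid_norm_sqr (v : 'cV[C]_k) : euclid_norm v ^+ 2 = \sum_i nsq (v i 0).
Proof.
have h : complex.Re (\tr (mxadjoint v *m v)) = \sum_i nsq (v i 0).
  rewrite -[RHS]ReC; congr complex.Re.
  rewrite /mxtrace big_ord1 mxE rmorph_sum/=; apply: eq_bigr => i _.
  by rewrite !mxE conj_mul_nsq.
by rewrite /euclid_norm h sqr_sqrtr// sumr_ge0// => i _; exact: nsq_ge0.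
Qed.

Lemma euclid_norm_ge0 (v : 'cV[C]_k) : 0 <= euclid_norm v.
Proof. exact: sqrtr_ge0. Qed.

Lemma euclid_normZ (c : R) (v : 'cV[C]_k) : euclid_norm (c%:C *: v) = `|c| * euclid_norm v.
Proof.
apply/eqP; rewrite -(eqrXn2 (n:=2)) ?mulr_ge0 ?euclid_norm_ge0//.
rewrite exprMn !euclid_norm_sqr real_normK ?num_real// mulr_sumr.
by apply/eqP; apply: eq_bigr => i _; rewrite mxE nsqM nsq_real.
Qed.

Lemma nsq_sum (I : finType) (F : I -> C) :
  nsq (\sum_i F i) <= #|I|%:R * \sum_i nsq (F i).
Proof.
have cst_sum (c : R) : \sum_(i : I) c = #|I|%:R * c.
  by rewrite mulr_natl sumr_const; congr (_ *+ _); apply: eq_card.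
have h (G : I -> R) : (\sum_i G i) ^+ 2 <= #|I|%:R * \sum_i G i ^+ 2.
  have : 0 <= \sum_i \sum_j (G i - G j) ^+ 2.
    by apply: sumr_ge0 => i _; apply: sumr_ge0 => j _; exact: sqr_ge0.
  have -> : \sum_i \sum_j (G i - G j) ^+ 2 =
     2 * (#|I|%:R * (\sum_i G i ^+ 2) - (\sum_i G i) ^+ 2).
    transitivity (\sum_i (#|I|%:R * G i ^+ 2 + (- 2 * \sum_j G j) * G i + \sum_j G j ^+ 2)).
      apply: eq_bigr => i _.
      transitivity (\sum_j (G i ^+ 2 + (- 2 * G i) * G j + G j ^+ 2)).
        by apply: eq_bigr => j _; ring.
      rewrite !big_split/= cst_sum -mulr_sumr.
      by ring.
    rewrite !big_split/= cst_sum -!mulr_sumr.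
    by ring.
  lra.
rewrite /nsq (raddf_sum (@complex.Re R : Rcomplex R -> R)) (raddf_sum (@complex.Im R : Rcomplex R -> R)).
by rewrite big_split/= mulrDr lerD.
Qed.

Lemma mx_opnorm_le a (rho : R) (v : 'cV[C]_k) : mx_opnorm a <= rho ->
  euclid_norm (a *m v) <= rho * euclid_norm v.
Proof.
set S := [set euclid_norm (a *m w) | w in [set w : 'cV[C]_k | euclid_norm w <= 1]].
pose B := k%:R * \sum_i \sum_j nsq (a i j).
have B0 : 0 <= B.
  by rewrite mulr_ge0// sumr_ge0// => i _; apply: sumr_ge0 => j _; exact: nsq_ge0.
have hB w : euclid_norm (a *m w) ^+ 2 <= B * euclid_norm w ^+ 2.
  rewrite !euclid_norm_sqr /B -mulrA mulr_suml mulr_sumr; apply: ler_sum => i _.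
  rewrite mxE (le_trans (nsq_sum _))// card_ord ler_wpM2l//.
  rewrite mulr_suml; apply: ler_sum => j _; rewrite nsqM ler_wpM2l ?nsq_ge0//.
  by rewrite (bigD1 j)//= lerDl sumr_ge0// => l _; exact: nsq_ge0.
have Sub : has_ubound S.
  exists (B + 1) => _ [w /= w1 <-].
  have h1 : euclid_norm (a *m w) ^+ 2 <= B.
    rewrite (le_trans (hB w))// ler_piMr//.
    by rewrite expr_le1// euclid_norm_ge0.
  have := sqr_ge0 (euclid_norm (a *m w) - 1); rewrite sqrrB1 mulr2n.
  have := euclid_norm_ge0 (a *m w); lra.
move=> arho; have [v0|v0] := eqVneq (euclid_norm v) 0.
  have := hB v; rewrite v0 expr0n/= !mulr0 => h.
  have : euclid_norm (a *m v) ^+ 2 = 0 by apply/eqP; rewrite eq_le h sqr_ge0.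
  by move/eqP; rewrite sqrf_eq0 => /eqP->.
have vp : 0 < euclid_norm v by rewrite lt_def v0 euclid_norm_ge0.
have : S (euclid_norm (a *m ((euclid_norm v)^-1%:C *: v))).
  exists ((euclid_norm v)^-1%:C *: v) => //=.
  by rewrite euclid_normZ gtr0_norm ?invr_gt0// mulVf.
move=> /(ub_le_sup Sub) h.
have := le_trans h arho; rewrite -scalemxAr euclid_normZ gtr0_norm ?invr_gt0//.
by rewrite mulrC ler_pdivrMr.
Qed.

Lemma mx_opnorm_opbd a (rho : R) : mx_opnorm a <= rho -> 0 <= rho ->
  opbd st setT (@ntrace R k) rho a.
Proof.
move=> arho rho0; split => // y _.
rewrite -(ler_pXn2r (n:=2))// ?nnegrE ?mulr_ge0 ?n2_ge0//.
rewrite exprMn !n2_entries mulrA ler_wpM2r ?invr_ge0 ?(ltW kR0)//.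
rewrite [leLHS]exchange_big [X in _ <= _ * X]exchange_big/= mulr_sumr; apply: ler_sum => j _.
have : euclid_norm (a *m col j y) ^+ 2 <= (rho * euclid_norm (col j y)) ^+ 2.
  rewrite ler_pXn2r ?nnegrE ?mulr_ge0 ?euclid_norm_ge0//.
  exact: mx_opnorm_le.
rewrite exprMn (euclid_norm_sqr (a *m col j y)) (euclid_norm_sqr (col j y)).
have -> : \sum_i nsq ((a *m col j y) i 0) = \sum_i nsq ((a * y) i j).
  apply: eq_bigr => i _; rewrite [a * y]/(a *m y) !mxE; congr nsq.
  by apply: eq_bigr => l _; rewrite mxE.
by have -> : \sum_i nsq (col j y i 0) = \sum_i nsq (y i j) by apply: eq_bigr => i _; rewrite mxE.
Qed.

End FixedSize.
End MatrixAlgebra.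

(** * Coding of real vectors *)

Section Coding.
Context {R : realType}.

Definition codes (d T : nat) : {set {ffun 'I_d -> 'I_(T * d).+1 * bool}} :=
  [set f : {ffun 'I_d -> 'I_(T * d).+1 * bool} | (\sum_(p < d) (f p).1 <= T * d)%N].

(* The weight [q ^ (\sum_p |z_p| - T d) >= 1] with [q = T / (T + 1)] turns the
   count of lattice points into a product of geometric series. *)
Lemma card_codes d T : (0 < T)%N ->
  (#|codes d T|%:R : R) <= (2 * expR 1 * T.+1%:R) ^+ d.
Proof.
move=> T0; pose q : R := T%:R / T.+1%:R.
have T0R : 0 < (T%:R : R) by rewrite ltr0n.
have q0 : 0 < q by rewrite divr_gt0.
have q1 : 1 - q = T.+1%:R^-1.
  by rewrite /q -natr1; field; rewrite natr1 pnatr_eq0.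
have qV : q^-1 = 1 + T%:R^-1.
  by rewrite /q invf_div -natr1; field; rewrite gt_eqF.
pose L := (T * d)%N.
have geo : \sum_(z < L.+1) q ^+ z <= T.+1%:R.
  have : (1 - q) * (\sum_(z < L.+1) q ^+ z) <= 1.
    have -> : (1 - q) * (\sum_(z < L.+1) q ^+ z) = 1 - q ^+ L.+1.
      by rewrite -[in RHS](expr1n _ L.+1) subrXX; congr (_ * _); apply: eq_bigr => i _; rewrite expr1n mul1r.
    by rewrite gerBl exprn_ge0 ?ltW.
  by rewrite q1 -ler_pdivlMl ?invr_gt0// invrK mulr1.
have prodE : \prod_(p < d) \sum_(zb : 'I_L.+1 * bool) q ^+ zb.1 =
    \sum_(f : {ffun 'I_d -> 'I_L.+1 * bool}) q ^+ (\sum_(p < d) (f p).1).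
  rewrite (bigA_distr_bigA (fun (p : 'I_d) (zb : 'I_L.+1 * bool) => q ^+ zb.1)).
  by apply: eq_bigr => f _; rewrite prodrXr.
have h1 : (#|codes d T|%:R : R) <= q^-1 ^+ L *
   \sum_(f : {ffun 'I_d -> 'I_L.+1 * bool}) q ^+ (\sum_(p < d) (f p).1).
  rewrite mulr_sumr [leRHS](bigID (fun f => f \in codes d T))/=.
  rewrite -[leLHS]addr0 lerD//; last first.
    by apply: sumr_ge0 => f _; apply: mulr_ge0; apply: exprn_ge0; rewrite ?invr_ge0 ltW.
  rewrite -sum1_card natr_sum; apply: ler_sum => f.
  rewrite inE => fL; rewrite exprVn ler_pdivlMl ?exprn_gt0// mulr1.
  apply: ler_wiXn2l => //; first exact: ltW.
  by rewrite -subr_ge0 q1 invr_ge0.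
apply: le_trans h1 _; rewrite -prodE prodr_const card_ord.
have -> : \sum_(zb : 'I_L.+1 * bool) q ^+ zb.1 = 2 * \sum_(z < L.+1) q ^+ z.
  rewrite -(pair_bigA _ (fun (z : 'I_L.+1) (b : bool) => q ^+ z))/= mulr_sumr.
  by apply: eq_bigr => z _; rewrite big_bool/=; ring.
have -> : q^-1 ^+ L = (q^-1 ^+ T) ^+ d by rewrite -exprM.
rewrite -exprMn; apply: lerXn2r.
- rewrite nnegrE mulr_ge0 ?exprn_ge0 ?invr_ge0 ?(ltW q0)// mulr_ge0//.
  by apply: sumr_ge0 => z _; rewrite exprn_ge0// ltW.
- by rewrite nnegrE !mulr_ge0// expR_ge0.
have qT : q^-1 ^+ T <= expR 1.
  have -> : expR 1 = expR (T%:R^-1 : R) ^+ T.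
    by rewrite -expRM_natr mulVf// gt_eqF.
  apply: lerXn2r; rewrite ?nnegrE ?expR_ge0 ?invr_ge0 ?(ltW q0)//.
  by rewrite qV expR_ge1Dx.
rewrite mulrCA -mulrA ler_wpM2l// ler_pM//.
  by rewrite exprn_ge0// invr_ge0 ltW.
by apply: sumr_ge0 => z _; rewrite exprn_ge0// ltW.
Qed.

Section Encode.
Variables (d T : nat) (J : finType) (E : R).
Hypotheses (Jd : (#|J| <= d)%N) (T0 : (0 < T)%N) (E0 : 0 < E).

Let s := Num.sqrt (E / d%:R).

Definition encode (y : J -> R) : {ffun 'I_d -> 'I_(T * d).+1 * bool} :=
  [ffun p : 'I_d => if insub (val p) : option 'I_#|J| is Some p'
     then (inord (Num.truncn (`|y (enum_val p')| / s)), 0 <= y (enum_val p'))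
     else (ord0, true)].

Lemma sum_sqr_le (y : J -> R) :
  (\sum_j `|y j|) ^+ 2 <= d%:R * \sum_j y j ^+ 2.
Proof.
have := nsq_sum (fun j => (`|y j|)%:C).
rewrite -rmorph_sum/= nsq_real.
have -> : \sum_j nsq (`|y j|)%:C = \sum_j y j ^+ 2.
  by apply: eq_bigr => j _; rewrite nsq_real real_normK ?num_real.
move=> h; apply: le_trans h _; rewrite ler_wpM2r ?ler_nat//.
by apply: sumr_ge0 => j _; exact: sqr_ge0.
Qed.

Hypothesis d0 : (0 < d)%N.

Let s0 : 0 < s. Proof. by rewrite sqrtr_gt0 divr_gt0// ltr0n. Qed.
Let s2 : s ^+ 2 * d%:R = E.
Proof.
rewrite sqr_sqrtr; last by rewrite divr_ge0 ?(ltW E0).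
by rewrite divfK// pnatr_eq0 -lt0n.
Qed.

Lemma sum_trunc_le (y : J -> R) : \sum_j y j ^+ 2 <= T%:R ^+ 2 * E ->
  (\sum_j Num.truncn (`|y j| / s) <= T * d)%N.
Proof.
move=> yT; rewrite -(ler_nat R) natr_sum.
apply: (@le_trans _ _ (\sum_j `|y j| / s)).
  by apply: ler_sum => j _; rewrite truncn_le divr_ge0 ?(ltW s0).
rewrite -mulr_suml ler_pdivrMr//.
rewrite -(ler_pXn2r (n:=2))// ?nnegrE ?mulr_ge0 ?(ltW s0)//; last by apply: sumr_ge0.
rewrite (le_trans (sum_sqr_le _))// natrM.
apply: (@le_trans _ _ (d%:R * (T%:R ^+ 2 * E))); first by rewrite ler_wpM2l.
by rewrite -s2 !exprMn le_eqVlt; apply/orP; left; apply/eqP; ring.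
Qed.

Lemma trunc_bound (y : J -> R) j : \sum_j y j ^+ 2 <= T%:R ^+ 2 * E ->
  (Num.truncn (`|y j| / s) < (T * d).+1)%N.
Proof.
move=> /sum_trunc_le; rewrite ltnS; apply: leq_trans.
by rewrite (bigD1 j)//= leq_addr.
Qed.

Lemma encode_codes (y : J -> R) : \sum_j y j ^+ 2 <= T%:R ^+ 2 * E ->
  encode y \in codes d T.
Proof.
move=> yT; rewrite inE.
have := sum_trunc_le yT; apply: leq_trans.
rewrite [leqRHS](reindex_onto (@enum_val J predT) enum_rank)/=; last first.
  by move=> j _; rewrite enum_rankK.
pose G (p : nat) : nat := if insub p : option 'I_#|J| is Some p'
  then Num.truncn (`|y (enum_val p')| / s) else 0%N.
have -> : (\sum_(p < d) (encode y p).1 = \sum_(p < d) G p)%N.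
  apply: eq_bigr => p _; rewrite ffunE /G; case: insubP => //= p' _ _.
  by rewrite inordK// trunc_bound.
rewrite -(big_mkord xpredT G) (big_cat_nat (n := #|J|))//=.
have -> : (\sum_(#|J| <= p < d) G p = 0)%N.
  rewrite big_nat_cond big1// => p; rewrite andbT => /andP[Jp _].
  by rewrite /G insubF//; apply/negbTE; rewrite -leqNgt.
rewrite addn0.
rewrite big_mkord; under [leqRHS]eq_bigl do rewrite enum_valK eqxx.
by rewrite leq_eqVlt; apply/orP; left; apply/eqP/eq_bigr => p _; rewrite /G valK.
Qed.

Lemma encode_close (y y' : J -> R) :
  \sum_j y j ^+ 2 <= T%:R ^+ 2 * E -> \sum_j y' j ^+ 2 <= T%:R ^+ 2 * E ->
  encode y = encode y' -> \sum_j (y j - y' j) ^+ 2 <= E.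
Proof.
move=> yT yT' ey.
have h j : (y j - y' j) ^+ 2 <= s ^+ 2.
  have jd : (enum_rank j < d)%N by exact: leq_trans (ltn_ord _) Jd.
  have := congr1 (fun f : {ffun 'I_d -> 'I_(T * d).+1 * bool} => f (Ordinal jd)) ey.
  rewrite !ffunE/= valK enum_rankK => -[] /(congr1 val).
  rewrite /= !inordK ?trunc_bound// => ht hs.
  have t1 := truncn_itv (divr_ge0 (normr_ge0 (y j)) (ltW s0)).
  have t2 := truncn_itv (divr_ge0 (normr_ge0 (y' j)) (ltW s0)).
  rewrite ht in t1; move: t1 t2; set N := (Num.truncn _).
  rewrite -natr1 !ler_pdivlMr// !ltr_pdivrMr// mulrDl mul1r => /andP[a1 a2] /andP[b1 b2].
  have : `|y j - y' j| <= s.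
    move: hs a1 a2 b1 b2; move: (N%:R * s) => z.
    have [y0|y0] := leP 0 (y j); have [y0'|y0'] := leP 0 (y' j) => // _.
      by rewrite (ger0_norm y0) (ger0_norm y0') ler_norml; lra.
    by rewrite (ltr0_norm y0) (ltr0_norm y0') ler_norml; lra.
  by rewrite -(real_normK (num_real (y j - _))) ler_pXn2r ?nnegrE// ltW.
apply: (@le_trans _ _ (\sum_(j : J) s ^+ 2)); first exact: ler_sum.
rewrite sumr_const -[_ *+ _]mulr_natr -s2 ler_wpM2l ?sqr_ge0// ler_nat.
exact: Jd.
Qed.

End Encode.

Lemma encode_inj (d T : nat) (J : finType) (E : R) (y y' : J -> R) :
  (#|J| <= d)%N -> (0 < T)%N -> 0 < E ->
  \sum_j y j ^+ 2 <= T%:R ^+ 2 * E -> \sum_j y' j ^+ 2 <= T%:R ^+ 2 * E ->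
  encode d T E y = encode d T E y' -> \sum_j (y j - y' j) ^+ 2 <= E.
Proof.
move=> Jd T0 E0 h h' e; have [d0|d0] := posnP d; last exact: encode_close e.
rewrite big1 ?ltW// => j _; have : (0 < #|J|)%N by apply/card_gt0P; exists j.
by move: Jd; rewrite d0; case: #|J|.
Qed.

Lemma encode_in (d T : nat) (J : finType) (E : R) (y : J -> R) :
  (#|J| <= d)%N -> (0 < T)%N -> 0 < E -> \sum_j y j ^+ 2 <= T%:R ^+ 2 * E ->
  encode d T E y \in codes d T.
Proof.
move=> Jd T0 E0 h; have [d0|d0] := posnP d; last exact: encode_codes.
by subst d; rewrite inE big_ord0.
Qed.

Lemma covering_number_le (Y : Type) (dist : Y -> Y -> R) (A : set Y) (eps : R)
  (F : finType) (B : {set F}) (code : Y -> F) :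
  (forall y, A y -> code y \in B) ->
  (forall y y', A y -> A y' -> code y = code y' -> dist y y' < eps) ->
  (covering_number dist A eps <= (#|B|%:R)%:E)%E.
Proof.
move=> cB hd.
pose B' := [set f in B | `[< exists2 y, A y & code y = f >]].
have hB' f : f \in B' -> exists2 y, A y & code y = f.
  by rewrite inE => /andP[_ /asboolP].
have hex (i : 'I_#|B'|) : exists y, A y /\ code y = enum_val i.
  by have [y Ay cy] := hB' _ (enum_valP i); exists y.
have [s hs] := choice hex.
apply: (@le_trans _ _ (#|B'|%:R)%:E%E); last first.
  by rewrite lee_fin ler_nat subset_leq_card//; apply/fintype.subsetP => f; rewrite inE => /andP[].
apply: ereal_inf_lbound; exists #|B'| => //=; exists s; split; first by move=> i; exact: (hs i).1.
move=> y Ay; have yB : code y \in B'.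
  by rewrite inE cB//=; apply/asboolP; exists y.
exists (enum_rank_in yB (code y)); apply: hd => //; first exact: (hs _).1.
by rewrite (hs _).2 enum_rankK_in.
Qed.

End Coding.

(** * Families of projections *)

Section ProjectionFamilies.
Context {R : realType}.
Local Notation C := R[i].
Variables (A : pzRingType) (sc : C -> A) (st : A -> A) (D : set A) (tau : A -> C).
Hypothesis tr : tracial sc st D tau.
Let sa := ta_alg tr.
Local Notation n2 := (norm2 st tau).
Variable r : nat.
Implicit Types (E F : 'I_r -> A) (x y : A).

Record pfam E : Prop := Pfam {
  pf_D : forall i, D (E i) ;
  pf_st : forall i, st (E i) = E i ;
  pf_idem : forall i, E i * E i = E i ;
  pf_orth : forall i j, i != j -> E i * E j = 0 ;
  pf_sum : \sum_i E i = 1 }.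

Definition pfcomb E : A := \sum_(i < r) sc ((i%:R : R)%:C) * E i.

Lemma proj_opbd p : D p -> st p = p -> p * p = p -> opbd st D tau 1 p.
Proof.
move=> Dp sp pp; split=> // y Dy; rewrite mul1r.
rewrite -(ler_pXn2r (n:=2))// ?nnegrE ?n2_ge0//.
have Dpy := ta_M tr Dp Dy.
have Dq := D_B tr (D_1 tr) Dp; have Dqy := ta_M tr Dq Dy.
have -> : n2 y ^+ 2 = n2 (p * y) ^+ 2 + n2 ((1 - p) * y) ^+ 2.
  rewrite -[in LHS](mul1r y) -[X in X * y](subrK p 1) addrC mulrDl.
  rewrite (n2D_sqr tr Dpy Dqy) (sa_stM sa) sp -mulrA (mulrA p) mulrBr mulr1 pp.
  by rewrite subrr mul0r mulr0 (rtr0 tr) mulr0 addr0.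
by rewrite lerDl sqr_ge0.
Qed.

Lemma pf_opbd E i : pfam E -> opbd st D tau 1 (E i).
Proof.
by move=> pE; apply: proj_opbd; [exact: pf_D|exact: pf_st|exact: pf_idem].
Qed.

Lemma proj_le p y : opbd st D tau 1 p -> D y -> n2 (p * y) <= n2 y.
Proof. by move=> [_ h] Dy; have := h _ Dy; rewrite mul1r. Qed.

Lemma proj_ler p y : D p -> opbd st D tau 1 p -> D y -> n2 (y * p) <= n2 y.
Proof. by move=> Dp hp Dy; have := opbdr tr Dp Dy hp; rewrite mul1r. Qed.

Lemma pf_n2_le1 E i : pfam E -> n2 (E i) <= 1.
Proof.
by move=> pE; have := proj_le (pf_opbd i pE) (D_1 tr); rewrite mulr1 (n21 tr).
Qed.

Lemma D_pfcomb E : pfam E -> D (pfcomb E).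
Proof.
move=> pE; apply: (D_sum tr) => i; apply: (ta_M tr); first exact: (ta_sc tr).
exact: pf_D.
Qed.

Lemma pfcomb_mulr E i : pfam E -> pfcomb E * E i = sc ((i%:R : R)%:C) * E i.
Proof.
move=> pE; rewrite mulr_suml (bigD1 i)//= -mulrA pf_idem// big1 ?addr0// => j ji.
by rewrite -mulrA pf_orth// mulr0.
Qed.

Lemma pfcomb_mull E i : pfam E -> E i * pfcomb E = sc ((i%:R : R)%:C) * E i.
Proof.
move=> pE; rewrite mulr_sumr (bigD1 i)//= mulrA -(sa_scC sa) -mulrA pf_idem//.
rewrite big1 ?addr0// => j ji.
by rewrite mulrA -(sa_scC sa) -mulrA pf_orth ?mulr0// eq_sym.
Qed.

Lemma pf_cross E F i j : pfam E -> pfam F -> i != j ->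
  n2 (F j * E i) <= n2 (pfcomb E - pfcomb F).
Proof.
move=> pE pF ij; have DE := pf_D pE i; have DF := pf_D pF j.
have DG := D_B tr (D_pfcomb pE) (D_pfcomb pF).
have DFE := ta_M tr DF DE.
have e : F j * (pfcomb E - pfcomb F) * E i =
    sc ((i%:R - j%:R : R)%:C) * (F j * E i).
  rewrite mulrBr mulrBl -[F j * _ * E i]mulrA pfcomb_mulr// pfcomb_mull//.
  by rewrite mulrA -(sa_scC sa) rmorphB (sa_scD sa) (scN sa) mulrDl mulNr -!mulrA.
have h : n2 (F j * (pfcomb E - pfcomb F) * E i) <= n2 (pfcomb E - pfcomb F).
  rewrite (le_trans (proj_ler DE (pf_opbd i pE) (ta_M tr DF DG)))//.
  exact: (proj_le (pf_opbd j pF) DG).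
apply: le_trans h; rewrite e (n2Z tr _ DFE) ler_peMl ?n2_ge0//.
have [lij|lji|eij] := ltngtP i j; last by move: ij; rewrite -val_eqE/= eij eqxx.
  rewrite distrC -natrB ?(ltnW lij)// normr_nat.
  by rewrite -[leLHS]/(1%:R) ler_nat subn_gt0.
rewrite -natrB ?(ltnW lji)// normr_nat.
by rewrite -[leLHS]/(1%:R) ler_nat subn_gt0.
Qed.

Lemma pf_dist E F i : pfam E -> pfam F ->
  n2 (E i - F i) <= 2 * r%:R * n2 (pfcomb E - pfcomb F).
Proof.
move=> pE pF.
have DFE a b : D (F a * E b) by apply: (ta_M tr); exact: pf_D.
have DS (P : pred 'I_r) (f : 'I_r -> A) : (forall j, D (f j)) -> D (\sum_(j | P j) f j).
  by move=> Df; rewrite big_mkcond; apply: (D_sum tr) => j; case: ifP => // _; exact: (D_0 tr).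
have n2S (f : 'I_r -> A) : (forall j, D (f j)) ->
    (forall j, j != i -> n2 (f j) <= n2 (pfcomb E - pfcomb F)) ->
    n2 (\sum_(j | j != i) f j) <= r%:R * n2 (pfcomb E - pfcomb F).
  move=> Df hf; rewrite big_mkcond.
  have Df' j : D (if j != i then f j else 0) by case: ifP => // _; exact: (D_0 tr).
  apply: le_trans (n2_sum tr _ Df') _.
  apply: (@le_trans _ _ (\sum_(j < r) n2 (pfcomb E - pfcomb F))).
    apply: ler_sum => j _; case: ifP => ji; first exact: hf.
    by rewrite (n20 tr) n2_ge0.
  by rewrite sumr_const card_ord mulr_natl.
have -> : E i - F i = \sum_(j | j != i) F j * E i - \sum_(j | j != i) F i * E j.
  have e1 : E i = F i * E i + \sum_(j | j != i) F j * E i.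
    by rewrite -[LHS]mul1r -(pf_sum pF) mulr_suml (bigD1 i).
  have e2 : F i = F i * E i + \sum_(j | j != i) F i * E j.
    by rewrite -[LHS]mulr1 -(pf_sum pE) mulr_sumr (bigD1 i).
  transitivity (F i * E i + \sum_(j | j != i) F j * E i -
      (F i * E i + \sum_(j | j != i) F i * E j)); first by rewrite -e1 -e2.
  by rewrite opprD addrACA subrr add0r.
rewrite (le_trans (n2B tr (DS _ _ (fun j => DFE _ _)) (DS _ _ (fun j => DFE _ _))))//.
rewrite -mulrA mulr_natl mulr2n lerD// n2S// => j ji; apply: pf_cross => //.
by rewrite eq_sym.
Qed.

Lemma pf_rounding E (h : 'I_r -> A) (eta : R) i : pfam E -> (forall j, D (h j)) ->
  n2 (1 - \sum_j h j) <= eta -> (forall j, n2 ((1 - E j) * h j) <= eta) ->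
  n2 (E i - h i) <= r.+2%:R * eta.
Proof.
move=> pE Dh h1 hE.
have DE := pf_D pE; have D1 := D_1 tr.
have Dq j : D ((1 - E j) * h j) by apply: (ta_M tr) => //; exact: (D_B tr).
have DQ j : D (E i * ((1 - E j) * h j)) by apply: (ta_M tr).
have Ds : D (1 - \sum_j h j) by apply: (D_B tr) => //; exact: (D_sum tr).
have Df' j : D (if j != i then E i * ((1 - E j) * h j) else 0).
  by case: ifP => // _; exact: (D_0 tr).
have e : E i - h i = E i * (1 - \sum_j h j) +
    (\sum_j (if j != i then E i * ((1 - E j) * h j) else 0) - (1 - E i) * h i).
  have -> : \sum_j (if j != i then E i * ((1 - E j) * h j) else 0) =
      \sum_(j | j != i) E i * h j.
    rewrite -big_mkcond/=; apply: eq_bigr => j ji.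
    by rewrite mulrA mulrBr mulr1 pf_orth ?subr0// eq_sym.
  rewrite mulrBr mulr1 mulr_sumr (bigD1 i)//= opprD mulrBl mul1r.
  move: (E i * h i) (\sum_(_ | _) _) => b S.
  by rewrite -[RHS]addrA -[- b - S + _]addrA addKr opprB addKr.
have eta0 : 0 <= eta by apply: le_trans h1; exact: n2_ge0.
rewrite e (le_trans (n2D tr (ta_M tr (DE i) Ds) (D_B tr (D_sum tr _ Df') (Dq i))))//.
have a1 := le_trans (proj_le (pf_opbd i pE) Ds) h1.
have a2 := n2B tr (D_sum tr (index_enum _) Df') (Dq i).
have a3 : n2 (\sum_j (if j != i then E i * ((1 - E j) * h j) else 0)) <= r%:R * eta.
  apply: le_trans (n2_sum tr _ Df') _.
  apply: (@le_trans _ _ (\sum_(j < r) eta)); last by rewrite sumr_const card_ord mulr_natl.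
  apply: ler_sum => j _; case: ifP => _; last by rewrite (n20 tr).
  exact: le_trans (proj_le (pf_opbd i pE) (Dq j)) (hE j).
apply: le_trans (lerD a1 (le_trans a2 (lerD a3 (hE i)))) _.
by rewrite -(natr1 r.+1) -(natr1 r) !mulrDl !mul1r addrA [eta + _]addrC.
Qed.

End ProjectionFamilies.

Section SpectralFamilies.
Context {R : realType}.
Local Notation C := R[i].
Variables (k r : nat).
Hypothesis k0 : (0 < k)%N.
Local Notation Mk := 'M[C]_k.
Local Notation st := (@mxadjoint R k k).
Local Notation ntr := (@ntrace R k).
Let tr := mx_tracial (R := R) k0.
Let sa := mx_star_alg (R := R) k.
Local Notation rtr := (@retrace R Mk ntr).
Local Notation n2 := (@norm2 R Mk st ntr).

Definition efam (u : Mk) (c : 'I_k -> 'I_r) (i : 'I_r) : Mk :=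
  st u * dmx (fun s => (c s == i)%:R) * u.

Lemma efam_pfam u c : unitary u -> pfam st setT (efam u c).
Proof.
move=> uu; have conjM a b : (st u * a * u) * (st u * b * u) = st u * (a * b) * u.
  by rewrite -!mulrA (mulrA u) uu.2 mul1r.
split=> //.
- by move=> i; rewrite /efam unitary_conj_st dmx_st.
- move=> i; rewrite conjM dmxM; congr (_ * dmx _ * _); apply/funext => s.
  by case: eqP => _; rewrite ?mulr1 ?mulr0.
- move=> i j ij; rewrite conjM dmxM.
  have -> : (fun s => (c s == i)%:R * (c s == j)%:R) = (fun=> 0 : R).
    apply/funext => s; case: eqP => [->|_]; last by rewrite mul0r.
    by rewrite (negbTE ij) mulr0.
  by rewrite dmx_cst /msc raddf0 mulr0 mul0r.
rewrite -mulr_suml -mulr_sumr.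
have -> : \sum_i dmx (fun s => (c s == i)%:R) = 1 :> Mk.
  apply/matrixP => s t; rewrite summxE mxE (bigD1 (c s))//= !mxE eqxx big1 ?addr0//.
  by move=> i ci; rewrite !mxE eq_sym (negbTE ci) mul0rn.
by rewrite mulr1 uu.1.
Qed.

Lemma pfcomb_efam u c : pfcomb (@msc R k) (efam u c) =
  st u * dmx (fun s => (c s)%:R) * u.
Proof.
rewrite /pfcomb /efam; transitivity (\sum_(i < r) st u * (msc k (i%:R : R)%:C *
   dmx (fun s => (c s == i)%:R)) * u).
  by apply: eq_bigr => i _; rewrite !mulrA (sa_scC sa).
rewrite -mulr_suml -mulr_sumr; congr (_ * _ * _).
apply/matrixP => s t; rewrite summxE mxE (bigD1 (c s))//= big1 ?addr0.
  by rewrite -dmx_cst dmxM !mxE eqxx mulr1.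
by move=> i ci; rewrite -dmx_cst dmxM !mxE eq_sym (negbTE ci) mulr0 mul0rn.
Qed.

Lemma efam_entries u c (x : Mk) i j : unitary u ->
  n2 (efam u c i * x * efam u c j) ^+ 2 =
  (\sum_s \sum_t ((c s == i) && (c t == j))%:R * nsq ((u * x * st u) s t)) / k%:R.
Proof.
move=> uu; have -> : efam u c i * x * efam u c j =
   st u * (dmx (fun s => (c s == i)%:R) * (u * x * st u) * dmx (fun s => (c s == j)%:R)) * u.
  by rewrite /efam !mulrA.
rewrite (n2_unitaryr _ _ uu)// (n2_unitaryl _ (unitary_st uu)) n2_entries//.
congr (_ / _); apply: eq_bigr => s _; apply: eq_bigr => t _.
rewrite dmx_mulrE dmx_mulE !nsqM !nsq_real; case: eqP; case: eqP => _ _ /=; ring.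
Qed.

Lemma rtr_efam u c i : unitary u ->
  rtr (efam u c i) = #|[pred s | c s == i]|%:R / k%:R.
Proof.
move=> uu; rewrite rtr_unitary_conj// rtr_dmx//; congr (_ / _).
by rewrite -sum1_card natr_sum [RHS]big_mkcond/=; apply: eq_bigr => s _; rewrite inE; case: eqP.
Qed.

Lemma spectral_family (g : Mk) : (0 < r)%N -> st g = g ->
  exists u c, unitary u /\ forall i (y : Mk),
    n2 ((1 - efam u c i) * y) <= 2 * n2 ((g - msc k (i%:R : R)%:C) * y).
Proof.
move=> r0 gg; have [u [lam [uu gE]]] := hermitian_spectral gg.
have hc s : exists i : 'I_r, forall j : 'I_r, j != i -> 2^-1 <= `|lam s - j%:R|.
  have [[i hi]|h] := pselect (exists i : 'I_r, `|lam s - i%:R| < 2^-1); last first.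
    exists (Ordinal r0) => j _; rewrite leNgt; apply/negP => hj; apply: h.
    by exists j.
  exists i => j ji; have : (1 : R) <= `|j%:R - i%:R|.
    have [lij|lji|eij] := ltngtP i j; last by move: ji; rewrite -val_eqE/= eij eqxx.
      by rewrite -natrB ?(ltnW lij)// normr_nat -[leLHS]/(1%:R) ler_nat subn_gt0.
    by rewrite distrC -natrB ?(ltnW lji)// normr_nat -[leLHS]/(1%:R) ler_nat subn_gt0.
  have := ler_normD (j%:R - lam s) (lam s - i%:R); rewrite addrA subrK (distrC j%:R (lam s)).
  by move: hi; lra.
have [c hc'] := choice hc; exists u, c; split=> // i y.
have -> : 1 - efam u c i = st u * dmx (fun s => (c s != i)%:R) * u.
  have -> : 1 = st u * dmx (fun=> 1) * u by rewrite dmx_cst /msc mulr1 uu.1.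
  rewrite /efam -mulrBl -mulrBr dmxB; congr (_ * dmx _ * _); apply/funext => s.
  by case: eqP => _; rewrite ?subrr ?subr0.
have -> : g - msc k (i%:R : R)%:C = st u * dmx (fun s => lam s - i%:R) * u.
  have -> : msc k (i%:R : R)%:C = st u * dmx (fun=> i%:R) * u.
    by rewrite dmx_cst -(sa_scC sa) -mulrA uu.1 mulr1.
  by rewrite gE -/(dmx lam) -mulrBl -mulrBr dmxB.
rewrite -!mulrA !(n2_unitaryl _ (unitary_st uu)).
have -> : 2 * n2 (dmx (fun s => lam s - i%:R) * (u * y)) =
    n2 (dmx (fun s => 2 * (lam s - i%:R)) * (u * y)).
  have -> : dmx (fun s => 2 * (lam s - i%:R)) = msc k (2 : R)%:C * dmx (fun s => lam s - i%:R).
    by rewrite -dmx_cst dmxM.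
  by rewrite -mulrA (n2Z tr)// ger0_norm.
apply: n2_dmx_le2 => // s; case: (eqVneq (c s) i) => [_|ci] /=.
  by rewrite normr0.
rewrite normr1 normrM ger0_norm// -ler_pdivrMl// mulr1.
by apply: hc'; rewrite eq_sym.
Qed.

Definition coord (x : Mk) (st : 'I_k * 'I_k) : R :=
  if (st.1 <= st.2)%N then complex.Re (x st.1 st.2) else complex.Im (x st.1 st.2).

Lemma coordB x y p : coord (x - y) p = coord x p - coord y p.
Proof.
by rewrite /coord !mxE; case: ifP => _; case: (x _ _) => a b; case: (y _ _).
Qed.

Lemma coord_le x p : coord x p ^+ 2 <= nsq (x p.1 p.2).
Proof. by rewrite /coord /nsq; case: ifP => _; rewrite ?lerDl ?lerDr sqr_ge0. Qed.

Lemma hermitian_coord (x : Mk) (P : pred ('I_k * 'I_k)) : st x = x ->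
  (forall s t, P (s, t) = P (t, s)) ->
  \sum_(p | P p) nsq (x p.1 p.2) <= 2 * \sum_(p | P p) coord x p ^+ 2.
Proof.
move=> hx Psym.
have xC s t : x s t = Num.conj (x t s) by rewrite -[in LHS]hx !mxE.
have -> : 2 * \sum_(p | P p) coord x p ^+ 2 =
    \sum_(p | P p) (coord x p ^+ 2 + coord x (p.2, p.1) ^+ 2).
  rewrite mulr2n mulrDl mul1r big_split/=; congr (_ + _).
  rewrite [RHS](reindex_inj (h := fun p : 'I_k * 'I_k => (p.2, p.1)))/=; last first.
    by move=> [a b] [c d] /= [-> ->].
  by apply: eq_big => [[s t]|[s t] _] //=; rewrite Psym.
apply: ler_sum => -[s t] _ /=; rewrite /coord/= /nsq.
have [est|nst] := eqVneq s t.
  rewrite est leqnn; have := xC t t; case: (x t t) => a b [] /= hb.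
  have -> : b = 0 by lra.
  by rewrite expr0n/= addr0 lerDl sqr_ge0.
have := xC s t; case: (x s t) => a b; case: (x t s) => a' b' /= [-> ->].
rewrite -val_eqE in nst; case: (ltngtP s t) nst => //= lst _; rewrite sqrrN//.
by rewrite addrC.
Qed.

End SpectralFamilies.

(** * Covering the microstates *)

Section GoodCover.
Context {R : realType}.
Local Notation C := R[i].
Variables (k r n : nat).
Hypothesis k0 : (0 < k)%N.
Local Notation Mk := 'M[C]_k.
Local Notation st := (@mxadjoint R k k).
Local Notation ntr := (@ntrace R k).
Let tr := mx_tracial (R := R) k0.
Let sa := mx_star_alg (R := R) k.
Local Notation n2 := (@norm2 R Mk st ntr).
Let kR0 : 0 < (k%:R : R). Proof. by rewrite ltr0n. Qed.

Variable alw : 'I_n -> rel 'I_r.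
Hypothesis alw_sym : forall l i j, alw l i j = alw l j i.

Definition alw_ix (c : 'I_k -> 'I_r) (p : 'I_n * ('I_k * 'I_k)) :=
  alw p.1 (c p.2.1) (c p.2.2).

(* [w.1] is a unitary with a partition of the eigenbasis into [r] classes, i.e. a
   family of projections; [w.2] replaces [a] by bounded Hermitian matrices.  The
   pairs [(i, j)] allowed by [alw l] index the blocks which are not negligible. *)
Record good (B theta : R) (d : nat) (a : 'I_n -> Mk)
    (w : Mk * ('I_k -> 'I_r) * ('I_n -> Mk)) : Prop := Good {
  gd_u : unitary w.1.1 ;
  gd_st : forall l, st (w.2 l) = w.2 l ;
  gd_bd : forall l, opbd st setT ntr B (w.2 l) ;
  gd_dist : forall l, n2 (a l - w.2 l) <= theta ;
  gd_off : forall l i j, ~~ alw l i j ->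
    n2 (efam w.1.1 w.1.2 i * w.2 l * efam w.1.1 w.1.2 j) <= theta ;
  gd_card : (#|[pred p | alw_ix w.1.2 p]| <= d)%N }.

Lemma tuple_dist_le (a b : 'I_n -> Mk) (t : R) : 0 <= t ->
  (forall l, n2 (a l - b l) <= t) -> tuple_dist a b <= n%:R * t.
Proof.
move=> t0 h; rewrite -(ler_pXn2r (n:=2))// ?nnegrE ?sqrtr_ge0 ?mulr_ge0//.
have e l : complex.Re (ntrace (mxadjoint (a l - b l) *m (a l - b l))) = n2 (a l - b l) ^+ 2.
  by rewrite (n2_sqr tr).
rewrite sqr_sqrtr; last by apply: sumr_ge0 => l _; rewrite e sqr_ge0.
apply: (@le_trans _ _ (\sum_(l < n) t ^+ 2)).
  by apply: ler_sum => l _; rewrite e ler_pXn2r ?nnegrE ?n2_ge0.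
rewrite sumr_const card_ord -[_ *+ n]mulr_natl exprMn ler_wpM2r ?sqr_ge0//.
by rewrite -natrX ler_nat; case: (n) => // m; rewrite expnS expn1 leq_pmulr.
Qed.

Lemma compress_diff (u u' : Mk) (c c' : 'I_k -> 'I_r) i j (B e : R) (x : Mk) :
  unitary u -> unitary u' -> opbd st setT ntr B x ->
  (forall i, n2 (efam u' c' i - efam u c i) <= e) ->
  n2 (efam u' c' i * x * efam u' c' j) <= n2 (efam u c i * x * efam u c j) + 2 * B * e.
Proof.
move=> uu uu' hx he; have pE := efam_pfam c uu; have pF := efam_pfam c' uu'.
set E := efam u c in pE he *; set F := efam u' c' in pF he *.
have -> : F i * x * F j = E i * x * E j + ((F i - E i) * x * F j + E i * x * (F j - E j)).
  rewrite !mulrBl mulrBr.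
  by move: (F i * x * F j) (E i * x * F j) (E i * x * E j) => a b d; rewrite addrC addrA !subrK.
rewrite (le_trans (n2D tr _ _))// lerD2l (le_trans (n2D tr _ _))//.
have h1 : n2 ((F i - E i) * x * F j) <= B * e.
  rewrite (le_trans (proj_ler tr _ (pf_opbd tr j pF) _))//.
  by rewrite (le_trans (opbdr tr _ _ hx))// ler_wpM2l ?hx.1.
have h2 : n2 (E i * x * (F j - E j)) <= B * e.
  rewrite -mulrA; apply: le_trans (proj_le (pf_opbd tr i pE) I) _.
  by apply: le_trans (hx.2 _ I) _; rewrite ler_wpM2l ?hx.1.
by rewrite -[leRHS]mulrA [leRHS]mulr_natl [leRHS]mulr2n; exact: (lerD h1 h2).
Qed.

Lemma pfcomb_dist (u u' : Mk) (c c' : 'I_k -> 'I_r) i : unitary u -> unitary u' ->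
  n2 (efam u c i - efam u' c' i) <=
    2 * r%:R * n2 (pfcomb (@msc R k) (efam u c) - pfcomb (@msc R k) (efam u' c')).
Proof. by move=> uu uu'; apply: (pf_dist tr); exact: efam_pfam. Qed.

Lemma pfcomb_st (u : Mk) (c : 'I_k -> 'I_r) :
  st (pfcomb (@msc R k) (efam u c)) = pfcomb (@msc R k) (efam u c).
Proof. by rewrite !pfcomb_efam// unitary_conj_st dmx_st. Qed.

Lemma pfcomb_nsq (u : Mk) (c : 'I_k -> 'I_r) : unitary u ->
  \sum_(p : 'I_k * 'I_k) nsq (pfcomb (@msc R k) (efam u c) p.1 p.2) <= k%:R * r%:R ^+ 2.
Proof.
move=> uu; rewrite -(pair_bigA _ (fun s t => nsq (pfcomb (@msc R k) (efam u c) s t)))/=.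
have h := n2_entries k0 (pfcomb (@msc R k) (efam u c)).
rewrite mulrC -ler_pdivrMr// -h pfcomb_efam//.
rewrite (n2_unitaryr k0 _ uu) (n2_unitaryl _ (unitary_st uu)).
rewrite ler_pXn2r ?nnegrE ?n2_ge0//.
have : n2 (dmx (fun s => (c s)%:R) * 1) <= r%:R * n2 1.
  apply: n2_dmx_le => // s; rewrite normr_nat ler_nat ltnW//.
by rewrite mulr1 (n21 tr) mulr1.
Qed.

Lemma hermitian_dist_coord (x y : Mk) (e : R) : st x = x -> st y = y -> 0 <= e ->
  \sum_p (coord x p - coord y p) ^+ 2 <= k%:R * e ^+ 2 -> n2 (x - y) <= 2 * e.
Proof.
move=> sx sy e0 h; rewrite -(ler_pXn2r (n:=2))// ?nnegrE ?n2_ge0 ?mulr_ge0//.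
rewrite n2_entries// ler_pdivrMr// (pair_bigA _ (fun s t => nsq ((x - y) s t)))/=.
have sxy : st (x - y) = x - y by rewrite (stB sa) sx sy.
apply: le_trans (hermitian_coord (P := xpredT) sxy _) _ => //.
apply: (@le_trans _ _ (2 * (k%:R * e ^+ 2))).
  rewrite ler_wpM2l//; apply: le_trans h; apply: ler_sum => p _.
  by rewrite coordB.
by rewrite exprMn; have := sqr_ge0 e; have := kR0; nra.
Qed.

Lemma blocks_dist (u : Mk) (c : 'I_k -> 'I_r) l (x : Mk) (e m : R) :
  unitary u -> st x = x -> 0 <= e -> 0 <= m ->
  (forall i j, ~~ alw l i j -> n2 (efam u c i * x * efam u c j) <= m) ->
  \sum_(p | alw l (c p.1) (c p.2)) coord (u * x * st u) p ^+ 2 <= k%:R * e ^+ 2 ->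
  n2 x <= 2 * e + r%:R * m.
Proof.
move=> uu sx e0 m0 hoff hin.
set y := u * x * st u.
have sy : st y = y by rewrite /y !(sa_stM sa) (sa_stK sa) sx mulrA.
have ny : n2 x = n2 y by rewrite /y (n2_unitaryr k0 _ (unitary_st uu)) n2_unitaryl.
rewrite -(ler_pXn2r (n:=2))// ?nnegrE ?n2_ge0 ?addr_ge0 ?mulr_ge0//.
rewrite ny n2_entries// (pair_bigA _ (fun s t => nsq (y s t)))/=.
rewrite (bigID (fun p : 'I_k * 'I_k => alw l (c p.1) (c p.2)))/= mulrDl.
have h1 : (\sum_(p | alw l (c p.1) (c p.2)) nsq (y p.1 p.2)) / k%:R <= 2 * e ^+ 2.
  rewrite ler_pdivrMr//.
  apply: le_trans (hermitian_coord (P := fun p => alw l (c p.1) (c p.2)) sy _) _.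
    by move=> s t /=; rewrite alw_sym.
  by have := hin; rewrite -/y; lra.
have h2 : (\sum_(p | ~~ alw l (c p.1) (c p.2)) nsq (y p.1 p.2)) / k%:R <= (r%:R * m) ^+ 2.
  apply: (@le_trans _ _ (\sum_i \sum_(j | ~~ alw l i j) n2 (efam u c i * x * efam u c j) ^+ 2)).
    have -> : \sum_i \sum_(j | ~~ alw l i j) n2 (efam u c i * x * efam u c j) ^+ 2 =
       (\sum_i \sum_(j | ~~ alw l i j) \sum_p ((c p.1 == i) && (c p.2 == j))%:R * nsq (y p.1 p.2)) / k%:R.
      rewrite mulr_suml; apply: eq_bigr => i _; rewrite mulr_suml; apply: eq_bigr => j _.
      rewrite efam_entries// (pair_bigA _ (fun s t => ((c s == i) && (c t == j))%:R * nsq ((u * x * st u) s t))).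
      by [].
    rewrite ler_wpM2r ?invr_ge0 ?(ltW kR0)//.
    have -> : \sum_i \sum_(j | ~~ alw l i j) \sum_p ((c p.1 == i) && (c p.2 == j))%:R * nsq (y p.1 p.2)
       = \sum_p \sum_i \sum_(j | ~~ alw l i j) ((c p.1 == i) && (c p.2 == j))%:R * nsq (y p.1 p.2).
      rewrite [RHS]exchange_big/=; apply: eq_bigr => i _; by rewrite exchange_big.
    rewrite big_mkcond/=; apply: ler_sum => p _; case: ifP => hp; last first.
      by apply: sumr_ge0 => i _; apply: sumr_ge0 => j _; rewrite mulr_ge0 ?nsq_ge0.
    rewrite (bigD1 (c p.1))//= (bigD1 (c p.2))//= !eqxx mul1r -addrA lerDl addr_ge0//.
      by apply: sumr_ge0 => j _; rewrite mulr_ge0 ?nsq_ge0.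
    by apply: sumr_ge0 => i _; apply: sumr_ge0 => j _; rewrite mulr_ge0 ?nsq_ge0.
  apply: (@le_trans _ _ (\sum_(i < r) \sum_(j < r) m ^+ 2)).
    apply: ler_sum => i _; rewrite big_mkcond/=; apply: ler_sum => j _.
    case: ifP => hij; last exact: sqr_ge0.
    by rewrite ler_pXn2r ?nnegrE ?n2_ge0// hoff.
  by rewrite !sumr_const !card_ord -mulrnA -[_ *+ _]mulr_natl natrM exprMn -expr2.
have h3 : 0 <= e * (r%:R * m) by rewrite !mulr_ge0.
rewrite sqrrD exprMn mulr2n; have := sqr_ge0 e; move: h1 h2 h3; lra.
Qed.

End GoodCover.

Section CoverTheorem.
Context {R : realType}.
Local Notation C := R[i].
Variables (k r n : nat).
Hypothesis k0 : (0 < k)%N.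
Local Notation Mk := 'M[C]_k.
Local Notation st := (@mxadjoint R k k).
Local Notation ntr := (@ntrace R k).
Let tr := mx_tracial (R := R) k0.
Let sa := mx_star_alg (R := R) k.
Local Notation n2 := (@norm2 R Mk st ntr).
Let kR0 : 0 < (k%:R : R). Proof. by rewrite ltr0n. Qed.
Variable alw : 'I_n -> rel 'I_r.
Hypothesis alw_sym : forall l i j, alw l i j = alw l j i.

(* Codes are chosen in two steps: the code of [\sum_i i E_i] selects a
   representative frame, in which the allowed entries are then coded. *)
Lemma good_cover (A : set ('I_n -> Mk)) (B theta eps e1 e2 : R) (d T1 T2 : nat) :
  (forall a, A a -> exists w, good alw B theta d a w) ->
  0 <= B -> 0 <= theta -> 0 < e1 -> 0 < e2 -> (0 < T1)%N -> (0 < T2)%N ->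
  r%:R <= T1%:R * e1 -> n%:R * B ^+ 2 <= T2%:R ^+ 2 * e2 ^+ 2 ->
  n%:R * (2 * theta + (2 * e2 + r%:R * (2 * (theta + 2 * B * (4 * r%:R * e1))))) < eps ->
  (covering_number (@tuple_dist R n k) A eps <=
    ((#|codes (k * k) T1| * #|codes d T2|)%:R)%:E)%E.
Proof.
move=> hA B0 th0 e10 e20 T10 T20 hT1 hT2 heps.
have aux (t z : R) : t + (z + t) <= 2 * t + z by lra.
have [[a0 Aa0]|A0] := pselect (A !=set0); last first.
  apply: (@le_trans _ _ 0%E); last by rewrite lee_fin ler0n.
  apply: ereal_inf_lbound; exists 0%N => //=.
  exists (fun=> (fun=> 0)); split; first by case.
  by move=> y Ay; case: A0; exists y.
have [w0 _] := hA _ Aa0.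
have hw' a : exists w, A a -> good alw B theta d a w.
  have [Aa|nA] := pselect (A a); first by have [w gw] := hA _ Aa; exists w.
  by exists w0.
have [w hw] := choice hw'.
pose G a := pfcomb (@msc R k) (efam (w a).1.1 (w a).1.2).
have stG a : st (G a) = G a by exact: pfcomb_st.
pose E1 : R := k%:R * e1 ^+ 2; pose E2 : R := k%:R * e2 ^+ 2.
have E10 : 0 < E1 by rewrite mulr_gt0 ?exprn_gt0.
have E20 : 0 < E2 by rewrite mulr_gt0 ?exprn_gt0.
have [code1 code1E] : exists f, forall a, f a = encode (k * k) T1 E1 (coord (G a)).
  by exists (fun a => encode (k * k) T1 E1 (coord (G a))).
have ck : (#|{: 'I_k * 'I_k}| <= k * k)%N by rewrite card_prod !card_ord.
have b1 a : A a -> \sum_p coord (G a) p ^+ 2 <= T1%:R ^+ 2 * E1.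
  move=> Aa; apply: (@le_trans _ _ (\sum_(p : 'I_k * 'I_k) nsq (G a p.1 p.2))).
    by apply: ler_sum => p _; exact: coord_le.
  apply: le_trans (pfcomb_nsq k0 _ (gd_u (hw _ Aa))) _.
  rewrite /E1 [leRHS]mulrCA ler_wpM2l ?(ltW kR0)// -exprMn ler_pXn2r ?nnegrE//.
  by rewrite mulr_ge0 ?(ltW e10).
have hrep (f : {ffun 'I_(k * k) -> 'I_(T1 * (k * k)).+1 * bool}) :
    exists b, forall a, A a -> code1 a = f -> A b /\ code1 b = f.
  have [[b [Ab bf]]|h] := pselect (exists b, A b /\ code1 b = f).
    by exists b.
  by exists a0 => a Aa af; case: h; exists a.
have [rep hrep'] := choice hrep.
pose J c := {p : 'I_n * ('I_k * 'I_k) | p \in [pred p | alw_ix alw c p]}.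
pose y2 b a (p : 'I_n * ('I_k * 'I_k)) : R :=
  coord ((w b).1.1 * (w a).2 p.1 * st (w b).1.1) p.2.
have [code2 code2E] : exists f, forall b a, f b a =
    encode d T2 E2 (fun p : J (w b).1.2 => y2 b a (val p)).
  by exists (fun b a => encode d T2 E2 (fun p : J (w b).1.2 => y2 b a (val p))).
pose code a := (code1 a, code2 (rep (code1 a)) a).
have sumJ c (F : 'I_n * ('I_k * 'I_k) -> R) :
    \sum_(p : J c) F (val p) = \sum_(p | alw_ix alw c p) F p.
  by rewrite -(big_sub [pred p | alw_ix alw c p] F); apply: eq_bigl.
have cardJ b : A b -> (#|{: J (w b).1.2}| <= d)%N.
  by move=> Ab; rewrite card_sig; exact: gd_card (hw _ Ab).
have b2 b a : A a -> A b ->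
    \sum_(p : J (w b).1.2) y2 b a (val p) ^+ 2 <= T2%:R ^+ 2 * E2.
  move=> Aa Ab; have ub := gd_u (hw _ Ab).
  rewrite (sumJ _ (fun p => y2 b a p ^+ 2)).
  apply: (@le_trans _ _ (\sum_(p : 'I_n * ('I_k * 'I_k)) y2 b a p ^+ 2)).
    by rewrite [leRHS](bigID (alw_ix alw (w b).1.2))/= lerDl sumr_ge0// => p _; exact: sqr_ge0.
  rewrite -(pair_bigA _ (fun l p => y2 b a (l, p) ^+ 2))/=.
  apply: (@le_trans _ _ (\sum_(l < n) k%:R * B ^+ 2)); last first.
    rewrite sumr_const card_ord -[_ *+ n]mulr_natl /E2 [leLHS]mulrCA [leRHS]mulrCA.
    by rewrite ler_wpM2l ?(ltW kR0).
  apply: ler_sum => l _; rewrite /y2/=; set z := _ * _ * _.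
  apply: (@le_trans _ _ (\sum_(p : 'I_k * 'I_k) nsq (z p.1 p.2))).
    by apply: ler_sum => p _; exact: coord_le.
  rewrite -(pair_bigA _ (fun s t => nsq (z s t)))/=.
  rewrite mulrC -ler_pdivrMr// -n2_entries// ler_pXn2r ?nnegrE ?n2_ge0//.
  rewrite /z (n2_unitaryr k0 _ (unitary_st ub)) n2_unitaryl//.
  by have := (gd_bd (hw _ Aa) l).2 1 I; rewrite mulr1 (n21 tr) mulr1.
have hB : forall a, A a -> code a \in finset.setX (codes (k * k) T1) (codes d T2).
  move=> a Aa; rewrite finset.in_setX; apply/andP; split.
    by rewrite code1E; exact: (encode_in ck T10 E10 (b1 _ Aa)).
  have [Ab _] := hrep' _ _ Aa erefl.
  by rewrite code2E; exact: (encode_in (cardJ _ Ab) T20 E20 (b2 _ _ Aa Ab)).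
rewrite -(finset.cardsX (codes (k * k) T1) (codes d T2)).
apply: (covering_number_le (code := code) hB) => a a' Aa Aa'.
rewrite /code => /pair_equal_spec[ec1 ec2].
have [Ab cb] := hrep' _ _ Aa erefl.
set b := rep (code1 a) in Ab cb; rewrite -ec1 -/b in ec2.
have ub := gd_u (hw _ Ab); have ua := gd_u (hw _ Aa); have ua' := gd_u (hw _ Aa').
have hG a1 : A a1 -> code1 a1 = code1 b -> n2 (G b - G a1) <= 2 * e1.
  move=> Aa1 e; apply: (hermitian_dist_coord k0 (stG b) (stG a1) (ltW e10)).
  move/esym: e; rewrite !code1E => e.
  exact: (encode_inj ck T10 E10 (b1 _ Ab) (b1 _ Aa1) e).
have hE a1 : A a1 -> code1 a1 = code1 b -> forall i,
    n2 (efam (w b).1.1 (w b).1.2 i - efam (w a1).1.1 (w a1).1.2 i) <= 4 * r%:R * e1.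
  move=> Aa1 e i; apply: le_trans (pfcomb_dist k0 _ _ _ ub (gd_u (hw _ Aa1))) _.
  have : 2 * r%:R * n2 (G b - G a1) <= 2 * r%:R * (2 * e1).
    by rewrite ler_wpM2l ?mulr_ge0// hG.
  by rewrite /G; lra.
pose m : R := 2 * (theta + 2 * B * (4 * r%:R * e1)).
have m0 : 0 <= m by rewrite !(mulr_ge0, addr_ge0)// ltW.
have hoff a1 l i j : A a1 -> code1 a1 = code1 b -> ~~ alw l i j ->
    n2 (efam (w b).1.1 (w b).1.2 i * (w a1).2 l * efam (w b).1.1 (w b).1.2 j) <=
      theta + 2 * B * (4 * r%:R * e1).
  move=> Aa1 e nal; have g1 := hw _ Aa1.
  apply: le_trans (compress_diff k0 i j (gd_u g1) ub (gd_bd g1 l) (hE _ Aa1 e)) _.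
  by rewrite lerD2r; exact: (gd_off g1 nal).
have main l : n2 ((w a).2 l - (w a').2 l) <= 2 * e2 + r%:R * m.
  apply: (@blocks_dist _ _ _ _ k0 _ alw_sym (w b).1.1 (w b).1.2 l) => //.
  - by rewrite (stB sa) (gd_st (hw _ Aa)) (gd_st (hw _ Aa')).
  - exact: ltW.
  - move=> i j nal; rewrite mulrBr mulrBl.
    apply: le_trans (n2B tr _ _) _ => //.
    by rewrite /m mulrDl mul1r lerD// hoff// -?ec1 ?cb.
  move: ec2; rewrite !code2E => ec2.
  have {ec2} := encode_inj (cardJ _ Ab) T20 E20 (b2 _ _ Aa Ab) (b2 _ _ Aa' Ab) ec2.
  rewrite (sumJ _ (fun p => (y2 b a p - y2 b a' p) ^+ 2)); apply: le_trans.
  rewrite big_mkcond [leRHS]big_mkcond/=.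
  rewrite -(pair_bigA _ (fun l p => if alw_ix alw (w b).1.2 (l, p) then (y2 b a (l, p) - y2 b a' (l, p)) ^+ 2 else 0))/=.
  rewrite (bigD1 l)//= -[leLHS]addr0 lerD//.
    apply: ler_sum => p _; rewrite /alw_ix/=; case: ifP => // _.
    by rewrite /y2/= mulrBr mulrBl coordB.
  by apply: sumr_ge0 => l' _; apply: sumr_ge0 => p _; case: ifP => // _; exact: sqr_ge0.
apply: le_lt_trans heps; apply: tuple_dist_le => //.
  by rewrite !(mulr_ge0, addr_ge0)// ltW.
move=> l; have -> : a l - a' l = (a l - (w a).2 l) + (((w a).2 l - (w a').2 l) + ((w a').2 l - a' l)).
  move: (a l) (a' l) ((w a).2 l) ((w a').2 l) => z1 z2 z3 z4.
  by rewrite [z3 - z4 + _]addrA subrK addrA subrK.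
apply: le_trans (n2D tr _ _) _ => //.
have h1 := gd_dist (hw _ Aa) l; have h2 := gd_dist (hw _ Aa') l.
have h3 := n2D tr (x := (w a).2 l - (w a').2 l) (y := (w a').2 l - a' l) I I.
rewrite (n2_distC tr (x := (w a').2 l) (y := a' l) I I) in h3.
apply: le_trans (lerD h1 (le_trans h3 (lerD (main l) h2))) _.
exact: aux.
Qed.

End CoverTheorem.

(** * From the algebra to the microstates *)

Section Transfer.
Context {R : realType} {H : completeNormedModType R[i]}.
Variable ip : {dot H for Num.conj}.
Hypothesis ipH : hilbert_space ip.
Variables (M : set (H -> H)) (tau : (H -> H) -> R[i]).
Hypothesis tauM : faithful_normal_trace ip M tau.
Variables (n : nat) (x : 'I_n -> H -> H).
Hypothesis x_sa : forall i, self_adjoint ip (x i).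
Hypothesis x_gen : generates ip M x.
Local Notation bst := (bst ipH).
Local Notation MB := (MB M).
Local Notation gens := (gens x_gen).
Let tr : tracial bscal bst MB (tauB tau) := MB_tracial ipH tauM x_gen.
Let sa := ta_alg tr.
Local Notation n2 := (norm2 bst (tauB tau)).
Local Notation rtr := (retrace (tauB tau)).
Local Notation ev := (npeval bscal bst gens).

Local Notation evm k := (@npeval R 'M[R[i]]_k (@msc R k) (@mxadjoint R k k) n).

Definition evmic (rho : R) (Q : forall k, ('I_n -> 'M[R[i]]_k) -> Prop) : Prop :=
  exists m (gam : R), 0 < gam /\ forall k (a : 'I_n -> 'M[R[i]]_k), (0 < k)%N ->
    microstates ip tau x rho m gam a -> Q k a.

Lemma evmic_mono rho (Q Q' : forall k, ('I_n -> 'M[R[i]]_k) -> Prop) :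
  evmic rho Q -> (forall k a, (0 < k)%N -> Q k a -> Q' k a) -> evmic rho Q'.
Proof.
move=> [m [g [g0 h]]] hQ; exists m, g; split => // k a k0 /h h'.
by apply: hQ => //; exact: h'.
Qed.

Lemma microstates_le rho m m' (g g' : R) k : (m <= m')%N -> g' <= g ->
  microstates ip tau x rho m' g' `<=` @microstates _ _ ip tau n x rho m k g.
Proof.
move=> mm gg a [h1 h2]; split=> // w wm.
by apply: lt_le_trans gg; apply: h2; exact: leq_trans mm.
Qed.

Lemma evmic_and rho (Q Q' : forall k, ('I_n -> 'M[R[i]]_k) -> Prop) :
  evmic rho Q -> evmic rho Q' -> evmic rho (fun k a => Q k a /\ Q' k a).
Proof.
move=> [m [g [g0 h]]] [m' [g' [g'0 h']]].
exists (maxn m m'), (Num.min g g'); split; first by rewrite lt_min g0.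
move=> k a k0 ha; split; [apply: h|apply: h'] => //.
  by apply: microstates_le ha; rewrite ?leq_maxl// ge_min lexx.
by apply: microstates_le ha; rewrite ?leq_maxr// ge_min lexx orbT.
Qed.

Lemma evmic_all rho (I : finType) (Q : I -> forall k, ('I_n -> 'M[R[i]]_k) -> Prop) :
  (forall i, evmic rho (Q i)) -> evmic rho (fun k a => forall i, Q i k a).
Proof.
move=> hQ.
suff h (s : seq I) : evmic rho (fun k a => forall i, i \in s -> Q i k a).
  by apply: evmic_mono (h (enum I)) _ => k a _ ha i; apply: ha; rewrite mem_enum.
elim: s => [|i s IH]; first by exists 0%N, 1; split.
apply: evmic_mono (evmic_and (hQ i) IH) _ => k a _ [h1 h2] j.
by rewrite inE => /predU1P[->//|]; exact: h2.
Qed.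

Lemma opwordE w : opword ip x w = evw bst gens w.
Proof.
elim: w => [|[l []] w IH] ; first exact: (esym bop1_fun).
  by rewrite -[LHS]/(adjoint ip (gens l) \o opword ip x w) IH adjointE.
by rewrite -[LHS]/(gens l \o opword ip x w) IH.
Qed.

Lemma Re_norm_mul (c z : R[i]) : `|complex.Re (c * z)| <= complex.Re `|c| * complex.Re `|z|.
Proof.
have : `|complex.Re (c * z)|%:C <= `|c * z| by exact: normc_ge_Re.
rewrite normrM; have := normr_ge0 c; have := normr_ge0 z.
case: (`|c|) => a b; case: (`|z|) => a' b' /=; rewrite !lecE/=.
by move=> /andP[/eqP -> _] /andP[/eqP -> _] /andP[_]; rewrite mulr0 subr0.
Qed.

Lemma transfer rho f (e : R) : 0 < e ->
  evmic rho (fun k a => `|rtr (ev f) - retrace (@ntrace R k) (evm k a f)| < e).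
Proof.
move=> e0; pose Z := \sum_(w <- f) complex.Re `|w.1| + 1.
have c0 (z : R[i]) : 0 <= complex.Re `|z|.
  by have := normr_ge0 z; rewrite lecE => /andP[].
have Z0 : 0 < Z by rewrite ltr_wpDl// sumr_ge0.
exists (\max_(w <- f) size w.2), (e / Z); split; first by rewrite divr_gt0.
move=> k a k0 [_ ha]; have trk := mx_tracial (R := R) k0.
rewrite /retrace (tau_ev tr (MB_gens x_gen)) (tau_ev trk (X := a))//.
have -> : forall z z' : R[i], complex.Re z - complex.Re z' = complex.Re (z - z').
  by move=> z z'; rewrite ReD ReN.
rewrite -sumrB; apply: (@le_lt_trans _ _ (\sum_(w <- f) complex.Re `|w.1| * (e / Z))).
  rewrite (raddf_sum (@complex.Re R : Rcomplex R -> R)).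
  apply: le_trans (ler_norm_sum _ _ _) _.
  rewrite big_seq [leRHS]big_seq; apply: ler_sum => w wf.
  rewrite -mulrBr (le_trans (Re_norm_mul _ _))// ler_wpM2l// ltW//.
  rewrite /tauB -opwordE; apply: ha.
  by rewrite (big_rem w wf)/= leq_maxl.
by rewrite -mulr_suml mulrA ltr_pdivrMr// mulrC ltr_pM2l// ltrDl.
Qed.

Definition np_half (f : npoly (R := R)) : npoly (n := n) :=
  np_mul (np_const (2^-1 : R)%:C) (f ++ np_star f).

Lemma ev_half (A : pzRingType) (sc : R[i] -> A) (st : A -> A) (X : 'I_n -> A) f :
  star_alg sc st ->
  npeval sc st X (np_half f) = sc (2^-1 : R)%:C * (npeval sc st X f + st (npeval sc st X f)).
Proof. by move=> s; rewrite (ev_mul s) ev_const ev_cat (ev_star s). Qed.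

Lemma st_half (A : pzRingType) (sc : R[i] -> A) (st : A -> A) (X : 'I_n -> A) f :
  star_alg sc st -> st (npeval sc st X (np_half f)) = npeval sc st X (np_half f).
Proof.
move=> s; rewrite ev_half// (sa_stM s) (sa_stsc s) (sa_stD s) (sa_stK s).
rewrite addrC -(sa_scC s); congr (sc _ * _).
by apply/eqP; rewrite eq_complex/= oppr0 !eqxx.
Qed.

Lemma half_half (A : pzRingType) (sc : R[i] -> A) (st : A -> A) (y : A) :
  star_alg sc st -> sc (2^-1 : R)%:C * (y + y) = y.
Proof.
move=> s; have -> : y + y = sc (2 : R)%:C * y.
  have -> : (2 : R)%:C = 1 + 1.
    by apply/eqP; rewrite eq_complex/= addr0 !eqxx.
  by rewrite (sa_scD s) (sa_sc1 s) mulrDl mul1r.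
by rewrite mulrA -(sa_scM s) -rmorphM mulVf// rmorph1 (sa_sc1 s) mul1r.
Qed.

Lemma family_polynomials r (p : 'I_r -> bop H) (eta : R) : pfam bst MB p -> 0 < eta ->
  exists (g : npoly (n := n)) (h : 'I_r -> npoly (n := n)),
   [/\ forall i, n2 (ev (h i) - p i) <= eta,
       forall i : 'I_r, n2 ((ev (np_half g) - bscal (i%:R : R)%:C) * ev (h i)) <= eta &
       n2 (1 - \sum_i ev (h i)) <= eta].
Proof.
move=> pp e0; have Mp := pf_D pp.
have Np i : nclos ipH tau x_gen (p i).
  apply: nclos_projection => //; split; first exact: (pf_st pp).
  exact: (pf_idem pp).
pose D := pfcomb bscal p.
have MD : MB D := D_pfcomb tr pp.
have sD : bst D = D.
  rewrite /D /pfcomb (st_sum sa); apply: eq_bigr => i _.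
  rewrite (sa_stM sa) (sa_stsc sa) (pf_st pp) (sa_scC sa).
  by congr (_ * bscal _); apply/eqP; rewrite eq_complex/= oppr0 !eqxx.
have ND : nclos ipH tau x_gen D.
  rewrite /D /pfcomb; elim/big_ind: _ => [|a b|i _].
  - by have := N_sc ipH tauM x_gen 0; rewrite (sc0 sa).
  - exact: (N_D tauM).
  - by apply: (N_M tauM) => //; exact: (N_sc ipH tauM).
have e20 : 0 < eta / 2 by rewrite divr_gt0.
have [g0 hg0] := ND.2 _ e20.
have Mg0 := MB_ev ipH tauM x_gen g0; have Mg := MB_ev ipH tauM x_gen (np_half g0).
have Mg0' := ta_st tr Mg0.
have hg : n2 (ev (np_half g0) - D) <= eta / 2.
  rewrite (n2_distC tr Mg MD) ev_half// -{1}(half_half D sa) -mulrBr.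
  rewrite (n2Z tr); last by apply: (D_B tr); apply: (ta_D tr).
  rewrite opprD addrACA ger0_norm ?invr_ge0// -{2}sD -(stB sa).
  have := n2D tr (D_B tr MD Mg0) (ta_st tr (D_B tr MD Mg0)).
  by rewrite (n2_st tr (D_B tr MD Mg0)); lra.
have [K hK] := MB_opbd_ex ipH tauM x_gen Mg.
have K0 := hK.1.
pose del := eta / (2 * (K + r%:R + 1)).
have Kr0 : 0 < K + r%:R + 1 by rewrite ltr_wpDl// addr_ge0.
have del0 : 0 < del by rewrite divr_gt0// mulr_gt0.
have delE : (K + r%:R + 1) * del = eta / 2 by rewrite /del; field; rewrite gt_eqF.
have hh i := (Np i).2 _ del0.
have [h hh'] := choice hh; exists g0, h.
have Mh i := MB_ev ipH tauM x_gen (h i).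
have hhp i : n2 (ev (h i) - p i) <= del.
  by rewrite (n2_distC tr (Mh i) (Mp i)) ltW.
have del_eta : del <= eta.
  have : 0 <= (K + r%:R) * del by rewrite mulr_ge0 ?addr_ge0// ltW.
  by move: delE; lra.
have Msc i : MB (bscal (i%:R : R)%:C) by exact: (ta_sc tr).
split=> [i|i|]; first exact: le_trans (hhp i) del_eta.
  have -> : (ev (np_half g0) - bscal (i%:R : R)%:C) * ev (h i) =
     (ev (np_half g0) * (ev (h i) - p i) - bscal (i%:R : R)%:C * (ev (h i) - p i))
     + (ev (np_half g0) - D) * p i.
    have Dp : D * p i = bscal (i%:R : R)%:C * p i by exact: (pfcomb_mulr bscal i pp).
    by rewrite -mulrBl mulrBr ![(_ - _) * p i]mulrBl Dp subrK.
  have M1 := D_B tr (Mh i) (Mp i).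
  have M2 := D_B tr Mg MD.
  have h1 := hK.2 _ M1; have h2 := n2Z tr (i%:R) M1.
  have h3 : n2 ((ev (np_half g0) - D) * p i) <= eta / 2.
    by apply: le_trans hg; apply: (proj_ler tr (Mp i) (pf_opbd tr i pp) M2).
  have h4 := n2B tr (ta_M tr Mg M1) (ta_M tr (Msc i) M1).
  have h5 := n2D tr (D_B tr (ta_M tr Mg M1) (ta_M tr (Msc i) M1)) (ta_M tr M2 (Mp i)).
  rewrite normr_nat in h2.
  have h6 : K * n2 (ev (h i) - p i) <= K * del by rewrite ler_wpM2l.
  have h7 : i%:R * n2 (ev (h i) - p i) <= r%:R * del.
    by rewrite ler_pM ?n2_ge0// ler_nat ltnW.
  have := del0; move: delE h1 h2 h3 h4 h5 h6 h7; rewrite !mulrDl mul1r; lra.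
rewrite -(pf_sum pp) -sumrB; apply: le_trans (n2_sum tr _ _) _.
  by move=> i; apply: (D_B tr).
apply: (@le_trans _ _ (\sum_(i < r) del)).
  by apply: ler_sum => i _; rewrite (n2_distC tr (Mp i) (Mh i)).
rewrite sumr_const card_ord -[_ *+ r]mulr_natl.
have : 0 <= (K + 1) * del by rewrite mulr_ge0 ?addr_ge0// ltW.
by move: delE; lra.
Qed.

End Transfer.

Section NumericAux.
Context {R : realType}.
Implicit Types (a b c d e t : R).

Lemma half_sum_le a b d e t : a <= b + d -> b <= e / 2 -> d <= t / 4 ->
  e <= t / 4 -> 0 < t -> a <= t / 2.
Proof. by lra. Qed.

Lemma half_le t : 0 < t -> t / 2 <= t.
Proof. by lra. Qed.

Lemma dist_le_add a b d e k' t : `|a - b| <= d -> d <= k' -> `|b - t| <= 2 * e ->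
  a <= t + (k' + 2 * e).
Proof. by rewrite !ler_norml => /andP[_ ?] ? /andP[_ ?]; lra. Qed.

Lemma mul_perturb a b s t k' : 0 <= a -> 0 <= b -> 0 <= s <= 1 -> 0 <= t <= 1 ->
  0 <= k' -> k' <= 1 -> a <= s + k' -> b <= t + k' -> a * b <= s * t + 3 * k'.
Proof.
move=> a0 b0 /andP[s0 s1] /andP[t0 t1] k0 k1 ha hb.
have kk : k' * k' <= k' by rewrite ler_piMl.
have p1 : s * k' <= k' by rewrite ler_piMl.
have p2 : k' * t <= k' by rewrite ler_piMr.
have : a * b <= (s + k') * (t + k') by rewrite ler_pM.
by rewrite mulrDl !mulrDr; lra.
Qed.

End NumericAux.

Section MatrixGood.
Context {R : realType}.
Local Notation C := R[i].
Variables (k r n : nat).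
Hypothesis k0 : (0 < k)%N.
Local Notation Mk := 'M[C]_k.
Local Notation st := (@mxadjoint R k k).
Local Notation ntr := (@ntrace R k).
Let tr := mx_tracial (R := R) k0.
Let sa := mx_star_alg (R := R) k.
Local Notation rtr := (@retrace R Mk ntr).
Local Notation n2 := (@norm2 R Mk st ntr).
Variable alw : 'I_n -> rel 'I_r.

Lemma card_alw_ix (u : Mk) (c : 'I_k -> 'I_r) : unitary u ->
  (#|[pred p | alw_ix alw c p]|%:R : R) = k%:R ^+ 2 *
    \sum_l \sum_i \sum_j (alw l i j)%:R * (rtr (efam u c i) * rtr (efam u c j)).
Proof.
move=> uu; rewrite -sum1_card natr_sum big_mkcond/=.
rewrite -(pair_bigA _ (fun l p => if (l, p) \in [pred p | alw_ix alw c p] then 1%:R else 0))/=.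
rewrite mulr_sumr; apply: eq_bigr => l _.
pose nn (i : 'I_r) : R := \sum_s (c s == i)%:R.
have hn i : k%:R * rtr (efam u c i) = nn i.
  rewrite rtr_efam// mulrC divfK ?gt_eqF ?ltr0n// /nn -sum1_card natr_sum big_mkcond/=.
  by apply: eq_bigr => s _; rewrite inE; case: eqP.
have pick (f : 'I_r -> R) : \sum_i f i * nn i = \sum_s f (c s).
  under eq_bigr do rewrite mulr_sumr.
  rewrite exchange_big/=; apply: eq_bigr => s _.
  rewrite (bigD1 (c s))//= eqxx mulr1 big1 ?addr0// => i ci.
  by rewrite eq_sym (negbTE ci) mulr0.
have -> : k%:R ^+ 2 * \sum_i \sum_j (alw l i j)%:R * (rtr (efam u c i) * rtr (efam u c j)) =
    \sum_i (\sum_j (alw l i j)%:R * nn j) * nn i.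
  rewrite mulr_sumr; apply: eq_bigr => i _; rewrite mulr_sumr mulr_suml.
  apply: eq_bigr => j _; rewrite -(hn i) -(hn j).
  by move: (rtr _) (rtr _) => z1 z2; ring.
rewrite (pick (fun i => \sum_j (alw l i j)%:R * nn j)).
rewrite -(pair_bigA _ (fun s t => if (l, (s, t)) \in [pred p | alw_ix alw c p] then 1%:R else 0))/=.
apply: eq_bigr => s _; rewrite (pick (fun j => (alw l (c s) j)%:R)).
by apply: eq_bigr => t _; rewrite inE /alw_ix/=; case: (alw _ _ _).
Qed.

Lemma matrix_good (a : 'I_n -> Mk) (g : Mk) (h : 'I_r -> Mk) (t : 'I_r -> R)
    (c rho eta theta del : R) (m : nat) : (0 < r)%N ->
  1 <= c -> 0 <= rho -> 0 < eta -> eta <= 1 -> 0 < theta -> 0 < del ->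
  (forall i, 0 <= t i <= 1) ->
  (forall l, opbd st setT ntr rho (a l)) ->
  (forall l, n2 (a l - st (a l)) <= eta) ->
  (forall l, rtr ((msc k (2^-1 : R)%:C * (a l + st (a l))) ^+ (2 * m).+2) <=
     c ^+ (2 * m).+2 + 1) ->
  st g = g ->
  (forall i : 'I_r, n2 ((g - msc k (i%:R : R)%:C) * h i) <= 2 * eta) ->
  n2 (1 - \sum_i h i) <= 2 * eta ->
  (forall i, `|rtr (h i) - t i| <= 2 * eta) ->
  (forall l i j, ~~ alw l i j -> rtr (h i * a l * h j * st (a l)) <= (3 * c ^+ 2 + 1) * eta) ->
  2 * c ^+ 2 / m.+1%:R <= (theta / 4) ^+ 2 ->
  eta <= theta / 4 ->
  (3 * c ^+ 2 + 1 + 4 * r.+2%:R * rho ^+ 2 * (2 + 4 * r.+2%:R)) * eta <= (theta / 2) ^+ 2 ->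
  (4 * r.+2%:R + 2) * eta <= 1 ->
  3 * (n%:R * r%:R * r%:R) * ((4 * r.+2%:R + 2) * eta) <= del ->
  exists w, good alw (2 * c) theta
    (Num.truncn (k%:R ^+ 2 * (\sum_l \sum_i \sum_j (alw l i j)%:R * (t i * t j) + del))) a w.
Proof.
move=> r0 c1 rho0 eta0 eta1 th0 del0 ht ha A1 A2 sg A3 A4 A5 A6 N1 N2 N3 N4 N5.
have c0 : 0 < c by apply: lt_le_trans c1.
have [u [cc [uu hE]]] := spectral_family k0 r0 sg.
have [E [EE pE {}hE]] : exists E, [/\ E = efam u cc, pfam st setT E &
    forall i (y : Mk), n2 ((1 - E i) * y) <= 2 * n2 ((g - msc k (i%:R : R)%:C) * y)].
  by exists (efam u cc); split => //; exact: efam_pfam.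
pose kap : R := 4 * r.+2%:R * eta.
have kap0 : 0 <= kap by rewrite !mulr_ge0// ltW.
have hEh i : n2 (E i - h i) <= kap.
  have e4 : 4 * eta = 2 * (2 * eta) by ring.
  have -> : kap = r.+2%:R * (4 * eta) by rewrite /kap; ring.
  apply: (pf_rounding tr (eta := 4 * eta) i pE (fun=> I)).
    by apply: le_trans A4 _; rewrite e4 ler_peMl ?mulr_ge0 ?(ltW eta0) ?ler1n.
  by move=> j; apply: le_trans (hE j _) _; rewrite e4 ler_wpM2l ?A3.
pose Ah l := msc k (2^-1 : R)%:C * (a l + st (a l)).
have sAh l : st (Ah l) = Ah l.
  rewrite /Ah (sa_stM sa) (sa_stsc sa) (sa_stD sa) (sa_stK sa) addrC -(sa_scC sa).
  by congr (msc k _ * _); apply/eqP; rewrite eq_complex/= oppr0 !eqxx.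
have hAh l : n2 (a l - Ah l) <= eta / 2.
  have -> : a l - Ah l = msc k (2^-1 : R)%:C * (a l - st (a l)).
    rewrite -{1}(half_half (a l) sa) /Ah -mulrBr; congr (_ * _).
    by rewrite opprD addrACA subrr add0r.
  by rewrite (n2Z tr)// ger0_norm// mulrC ler_wpM2r.
have hb l := truncation k0 m (sAh l) (mulr_gt0 (ltr0n R 2) c0 : 0 < 2 * c).
have [b hb'] := choice hb.
have hbd l : n2 (Ah l - b l) <= theta / 4.
  have [_ _ hl] := hb' l.
  have := le_trans hl (A2 l); set y := n2 _ => hy.
  rewrite -(ler_pXn2r (n:=2))// ?nnegrE ?n2_ge0 ?divr_ge0 ?(ltW th0)//.
  apply: le_trans N1.
  have cm0 : 0 < c ^+ (2 * m) by rewrite exprn_gt0.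
  have h1 : y ^+ 2 * 2 ^+ (2 * m) <= 2 * c ^+ 2.
    rewrite -(ler_pM2r cm0) -mulrA -exprMn; apply: le_trans hy _.
    rewrite -mulrA -exprD -[(2 + 2 * m)%N]/((2 * m).+2).
    by rewrite mulr2n mulrDl mul1r lerD2l exprn_ege1.
  rewrite ler_pdivlMr//; apply: le_trans h1.
  rewrite ler_wpM2l ?sqr_ge0// -natrX ler_nat.
  by rewrite (leq_trans (ltn_expl m (isT : (1 < 2)%N)))// leq_exp2l// leq_pmull.
have hab l : n2 (a l - b l) <= theta / 2.
  have := n2_dist tr (x := a l) (y := Ah l) (z := b l) I I I.
  by move=> H; exact: half_sum_le H (hAh l) (hbd l) N2 th0.
have sEi i := pf_st pE i.
have hoffa l i j : ~~ alw l i j -> n2 (E i * a l * E j) <= theta / 2.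
  move=> nal; rewrite -(ler_pXn2r (n:=2))// ?nnegrE ?n2_ge0 ?divr_ge0 ?(ltW th0)//.
  apply: le_trans N3; rewrite (n2_sqr tr)//.
  have -> : rtr (st (E i * a l * E j) * (E i * a l * E j)) = rtr (E i * (a l * E j * st (a l))).
    rewrite !(sa_stM sa) !sEi (rtr_comm tr I I).
    rewrite -!mulrA (mulrA (E j) (E j)) (pf_idem pE) !mulrA (rtr_comm tr I I).
    by rewrite !mulrA (pf_idem pE).
  have -> : E i * (a l * E j * st (a l)) = h i * a l * h j * st (a l) +
     ((E i - h i) * (a l * E j * st (a l)) + h i * (a l * (E j - h j) * st (a l))).
    have -> : h i * (a l * (E j - h j) * st (a l)) =
        h i * (a l * E j * st (a l)) - h i * a l * h j * st (a l).
      by rewrite mulrBr mulrBl mulrBr !mulrA.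
    rewrite [(E i - h i) * _]mulrBl.
    move: (E i * _) (h i * (_ * E j * _)) (h i * _ * _ * _) => z1 z2 z3.
    by rewrite addrC addrA !subrK.
  rewrite !(rtrD tr)//.
  have bs (y : Mk) : n2 (a l * y * st (a l)) <= rho ^+ 2 * n2 y.
    have := opbdr tr (x := st (a l)) (y := a l * y) I I (opbd_st tr I (ha l)).
    move=> hh; apply: le_trans hh _; rewrite expr2 -mulrA ler_wpM2l//.
    exact: (ha l).2.
  have t1 : rtr ((E i - h i) * (a l * E j * st (a l))) <= kap * rho ^+ 2.
    apply: le_trans (ler_norm _) _; apply: le_trans (rtrM_le tr _ _) _ => //.
    apply: ler_pM; rewrite ?n2_ge0//; apply: le_trans (bs _) _.
    by rewrite ler_piMr ?sqr_ge0// (pf_n2_le1 tr).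
  have hh1 : n2 (h i) <= 1 + kap.
    have := n2_dist tr (x := h i) (y := E i) (z := 0) I I I; rewrite !subr0.
    have := hEh i; rewrite (n2_distC tr)// => h1 h2.
    by apply: le_trans h2 _; rewrite addrC lerD// (pf_n2_le1 tr).
  have t2 : rtr (h i * (a l * (E j - h j) * st (a l))) <= (1 + kap) * (rho ^+ 2 * kap).
    apply: le_trans (ler_norm _) _; apply: le_trans (rtrM_le tr _ _) _ => //.
    apply: ler_pM; rewrite ?n2_ge0//; apply: le_trans (bs _) _.
    by rewrite ler_wpM2l ?sqr_ge0.
  have kap4 : kap <= 4 * r.+2%:R by rewrite /kap ler_piMr// mulr_ge0.
  have t0 := A6 _ _ _ nal.
  have t3 : kap * rho ^+ 2 + (1 + kap) * (rho ^+ 2 * kap) <=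
      4 * r.+2%:R * rho ^+ 2 * (2 + 4 * r.+2%:R) * eta.
    have -> : kap * rho ^+ 2 + (1 + kap) * (rho ^+ 2 * kap) = kap * rho ^+ 2 * (2 + kap) by ring.
    have -> : 4 * r.+2%:R * rho ^+ 2 * (2 + 4 * r.+2%:R) * eta = kap * rho ^+ 2 * (2 + 4 * r.+2%:R).
      by rewrite /kap; ring.
    by rewrite ler_wpM2l ?lerD2l// mulr_ge0 ?sqr_ge0.
  by rewrite [leRHS]mulrDl; exact: lerD t0 (le_trans (lerD t1 t2) t3).
exists (u, cc, b); split => //=.
- by move=> l; have [] := hb' l.
- by move=> l; have [] := hb' l.
- by move=> l; exact: le_trans (hab l) (half_le th0).
- move=> l i j nal; rewrite -EE.
  have -> : E i * b l * E j = E i * a l * E j - E i * (a l - b l) * E j.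
    by rewrite mulrBr mulrBl opprB addrC subrK.
  apply: le_trans (n2B tr _ _) _ => //.
  have h1 : n2 (E i * (a l - b l) * E j) <= theta / 2.
    apply: le_trans (proj_ler tr _ (pf_opbd tr j pE) _) _ => //.
    by apply: le_trans (proj_le (pf_opbd tr i pE) _) _.
  by rewrite (splitr theta); exact: lerD (hoffa _ _ _ nal) h1.
have Ige0 : 0 <= \sum_l \sum_i \sum_j (alw l i j)%:R * (t i * t j).
  apply: sumr_ge0 => l _; apply: sumr_ge0 => i _; apply: sumr_ge0 => j _.
  by have /andP[? _] := ht i; have /andP[? _] := ht j; rewrite !mulr_ge0.
rewrite truncn_ge_nat ?mulr_ge0 ?sqr_ge0 ?addr_ge0 ?(ltW del0)//.
rewrite (card_alw_ix cc uu) -EE ler_wpM2l ?sqr_ge0//.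
pose kap' : R := (4 * r.+2%:R + 2) * eta.
have kap'0 : 0 <= kap' by rewrite mulr_ge0 ?addr_ge0 ?mulr_ge0// ltW.
have hrt i : rtr (E i) <= t i + kap'.
  have h1 := rtr_le tr (x := E i - h i) I; rewrite (rtrB tr)// in h1.
  have -> : kap' = kap + 2 * eta by rewrite /kap' /kap; ring.
  exact: dist_le_add h1 (hEh i) (A5 i).
have hrt0 i : 0 <= rtr (E i).
  by have := rtr_ge0 tr (x := E i) I; rewrite sEi (pf_idem pE).
apply: (@le_trans _ _ (\sum_l \sum_i \sum_j ((alw l i j)%:R * (t i * t j) + 3 * kap'))).
  apply: ler_sum => l _; apply: ler_sum => i _; apply: ler_sum => j _.
  have hp := mul_perturb (hrt0 i) (hrt0 j) (ht i) (ht j) kap'0 N4 (hrt i) (hrt j).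
  by case: (alw l i j); rewrite ?mul1r// !mul0r add0r mulr_ge0.
have -> : \sum_l \sum_i \sum_j ((alw l i j)%:R * (t i * t j) + 3 * kap') =
   \sum_l \sum_i \sum_j (alw l i j)%:R * (t i * t j) + 3 * (n%:R * r%:R * r%:R) * kap'.
  rewrite (eq_bigr (fun l => \sum_i \sum_j (alw l i j)%:R * (t i * t j) + r%:R * (r%:R * (3 * kap')))).
    rewrite big_split/=; congr (_ + _).
    by rewrite sumr_const card_ord -[_ *+ n]mulr_natl; ring.
  move=> l _; rewrite (eq_bigr (fun i => \sum_j (alw l i j)%:R * (t i * t j) + r%:R * (3 * kap'))).
    by rewrite big_split/= sumr_const card_ord -[_ *+ r]mulr_natl.
  by move=> i _; rewrite big_split/= sumr_const card_ord -[_ *+ r]mulr_natl.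
by rewrite lerD2l.
Qed.

End MatrixGood.

Lemma small_multiple {R : realType} (Z b : R) : 0 <= Z -> 0 < b ->
  exists2 e, 0 < e & forall y, 0 < y -> y <= e -> Z * y <= b.
Proof.
move=> Z0 b0; have Z1 : 0 < Z + 1 by rewrite ltr_wpDl.
exists (b / (Z + 1)); first exact: divr_gt0.
move=> y y0 yb; apply: (@le_trans _ _ ((Z + 1) * (b / (Z + 1)))); last by rewrite mulrC divfK ?gt_eqF.
by apply: ler_pM => //; [exact: ltW|rewrite lerDl].
Qed.

Lemma fsbig_injection {V : nmodType} (T : choiceType) (J : finType) (q : J -> T) (A : set T)
    (F : T -> V) : injective q -> A `<=` range q ->
  \sum_(x \in A) F x = \sum_(j | `[< A (q j) >]) F (q j).
Proof.
move=> qI Aq; pose s := [seq q j | j <- enum J & `[< A (q j) >]].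
have us : uniq s by rewrite map_inj_uniq// filter_uniq// enum_uniq.
have AE : A = [set` s].
  apply/seteqP; split=> y /=.
    move=> Ay; have [j _ jy] := Aq _ Ay; apply/mapP; exists j => //.
    by rewrite mem_filter mem_enum andbT; apply/asboolP; rewrite jy.
  by move=> /mapP[j]; rewrite mem_filter => /andP[/asboolP Aj _] ->.
by rewrite [in LHS]AE -fsbig_seq// big_map big_filter big_enum_cond.
Qed.

Lemma finite_set_enum (T : choiceType) (A : set T) : finite_set A ->
  exists r (p : 'I_r -> T), injective p /\ A = range p.
Proof.
move=> /finite_seqP[s ->]; exists (size (undup s)), (tnth (in_tuple (undup s))); split.
  by apply/tuple_uniqP; exact: undup_uniq.
apply/seteqP; split=> [y /= ys|_ [i _ <-]].
  have {}ys : y \in in_tuple (undup s) by rewrite /= mem_undup.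
  by have /tnthP[i ->] := ys; exists i.
by have := mem_tnth i (in_tuple (undup s)); rewrite mem_undup.
Qed.

(** * The free entropy dimension *)

Section CoverParameters.
Context {R : realType}.

Lemma cover_parameters (n r : nat) (B : R) : 0 <= B ->
  exists Q, 1 <= Q /\ forall eps, 0 < eps -> eps < 1 ->
    exists theta e1 e2 T1 T2,
      [/\ [/\ 0 < theta, 0 < e1, 0 < e2, (0 < T1)%N & (0 < T2)%N],
          r%:R <= T1%:R * e1, n%:R * B ^+ 2 <= T2%:R ^+ 2 * e2 ^+ 2,
          n%:R * (2 * theta + (2 * e2 + r%:R * (2 * (theta + 2 * B * (4 * r%:R * e1))))) < eps &
          2 * expR 1 * T1.+1%:R <= Q / eps /\ 2 * expR 1 * T2.+1%:R <= Q / eps].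
Proof.
move=> B0; pose N : R := n.+1%:R; pose r1 : R := r.+1%:R.
have N0 : 0 < N by []. have r10 : 0 < r1 by [].
have rr1 : r%:R <= r1 by rewrite ler_nat.
have nN : n%:R <= N by rewrite ler_nat.
have N1 : 1 <= N by rewrite ler1n.
have B1 : 0 < B + 1 by rewrite ltr_wpDl.
pose c1 : R := 64 * N * (B + 1) * r1 ^+ 2; pose c2 : R := 8 * N; pose c3 : R := 8 * N * r1.
have c10 : 0 < c1 by rewrite mulr_gt0 ?exprn_gt0// mulr_gt0// mulr_gt0.
have c20 : 0 < c2 by rewrite mulr_gt0.
have c30 : 0 < c3 by rewrite mulr_gt0.
have trunc1 (z : R) : 0 <= z -> z <= (Num.truncn z).+1%:R /\ (Num.truncn z).+2%:R <= z + 2.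
  by move=> z0; have /andP[h1 h2] := truncn_itv z0; rewrite -addn2 natrD lerD2r; split => //; exact: ltW.
pose A1 := r%:R * c1 + 2; pose A2 := N * B * c2 + 2.
have A10 : 2 <= A1 by rewrite lerDr mulr_ge0// ltW.
have A20 : 2 <= A2 by rewrite lerDr !mulr_ge0// ltW.
have ex1 : 1 <= expR 1 :> R by rewrite -expR0 ler_expR.
have ee : 0 <= 2 * expR 1 :> R by rewrite mulr_ge0// expR_ge0.
exists (2 * expR 1 * (A1 + A2)); split.
  by apply: (@le_trans _ _ (2 * 1 * (1 + 0))); [lra|apply: ler_pM; lra].
move=> eps e0 e1; have ei : 1 <= eps^-1 by rewrite invf_ge1// ltW.
have ei0 : 0 <= eps^-1 by rewrite invr_ge0 ltW.
have [h1 h1'] := @trunc1 (r%:R * c1 / eps) (mulr_ge0 (mulr_ge0 (ler0n _ _) (ltW c10)) ei0).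
have [h2 h2'] := @trunc1 (N * B * c2 / eps)
  (mulr_ge0 (mulr_ge0 (mulr_ge0 (ltW N0) B0) (ltW c20)) ei0).
exists (eps / c3), (eps / c1), (eps / c2), (Num.truncn (r%:R * c1 / eps)).+1,
  (Num.truncn (N * B * c2 / eps)).+1; split.
- by split => //; exact: divr_gt0.
- by rewrite mulrA ler_pdivlMr// -ler_pdivrMr.
- have h3 : N * B <= (Num.truncn (N * B * c2 / eps)).+1%:R * (eps / c2).
    by rewrite mulrA ler_pdivlMr// -ler_pdivrMr.
  rewrite -exprMn; apply: (@le_trans _ _ ((N * B) ^+ 2)).
    rewrite exprMn; apply: ler_wpM2r; first exact: sqr_ge0.
    by apply: le_trans nN _; rewrite expr2 ler_peMl// ltW.
  by rewrite ler_pXn2r ?nnegrE ?mulr_ge0 ?(ltW N0) ?(ltW c20) ?invr_ge0 ?(ltW e0) ?(ltW c20).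
- have q1 : r1 * N * (eps / c3) = eps / 8 by rewrite /c3; field; rewrite !gt_eqF.
  have q2 : N * (eps / c2) = eps / 8 by rewrite /c2; field; rewrite !gt_eqF.
  have q3 : r1 ^+ 2 * N * (B + 1) * (eps / c1) = eps / 64.
    by rewrite /c1; field; rewrite !gt_eqF.
  have p3 : 0 <= eps / c3 by rewrite divr_ge0// ltW.
  have p2 : 0 <= eps / c2 by rewrite divr_ge0// ltW.
  have p1 : 0 <= eps / c1 by rewrite divr_ge0// ltW.
  have n0 : 0 <= n%:R :> R by []. have r0 : 0 <= r%:R :> R by [].
  have m2 : n%:R * (eps / c2) <= eps / 8 by rewrite -q2 ler_wpM2r.
  have m3 : n%:R * (eps / c3) + n%:R * r%:R * (eps / c3) <= eps / 8.
    rewrite -mulrDl -q1 ler_wpM2r// -[X in X + _]mulr1 -mulrDr mulrC.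
    by rewrite /r1 -natr1 addrC ler_wpM2l// addr_ge0.
  have m1 : n%:R * (r%:R ^+ 2 * B * (eps / c1)) <= eps / 64.
    rewrite -q3 mulrA ler_wpM2r// mulrCA.
    have s1 : r%:R ^+ 2 <= r1 ^+ 2 by rewrite ler_pXn2r ?nnegrE// ltW.
    have s2 : n%:R * B <= N * (B + 1) by apply: ler_pM => //; rewrite lerDl.
    by rewrite -mulrA; apply: ler_pM => //; rewrite ?sqr_ge0 ?mulr_ge0.
  have -> : n%:R * (2 * (eps / c3) + (2 * (eps / c2) + r%:R * (2 * (eps / c3 + 2 * B * (4 * r%:R * (eps / c1)))))) =
    2 * (n%:R * (eps / c3) + n%:R * r%:R * (eps / c3)) + 2 * (n%:R * (eps / c2)) +
    16 * (n%:R * (r%:R ^+ 2 * B * (eps / c1))) by ring.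
  by lra.
- have g (z A : R) m : m%:R <= z / eps + 2 -> z + 2 <= A -> m%:R <= A / eps.
    move=> hm hz; apply: le_trans hm _; apply: (@le_trans _ _ ((z + 2) / eps)).
      by rewrite mulrDl lerD2l -[leLHS]mulr1 ler_wpM2l.
    by rewrite ler_wpM2r.
  by split; rewrite -[leRHS]mulrA; apply: ler_wpM2l => //;
    [apply: g h1' _|apply: g h2' _]; rewrite -/A1 -/A2; lra.
Qed.

End CoverParameters.

Section FreeDimension.
Context {R : realType} {H : completeNormedModType R[i]}.
Variable ip : {dot H for Num.conj}.
Hypothesis ipH : hilbert_space ip.
Variables (M : set (H -> H)) (tau : (H -> H) -> R[i]).
Hypothesis tauM : faithful_normal_trace ip M tau.
Variables (n : nat) (x : 'I_n -> H -> H).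
Hypothesis x_sa : forall i, self_adjoint ip (x i).
Hypothesis x_gen : generates ip M x.
Local Notation bst := (bst ipH).
Local Notation MB := (MB M).
Local Notation gens := (gens x_gen).
Let tr : tracial bscal bst MB (tauB tau) := MB_tracial ipH tauM x_gen.
Let sa := ta_alg tr.
Local Notation n2 := (norm2 bst (tauB tau)).
Local Notation rtr := (retrace (tauB tau)).
Local Notation ev := (npeval bscal bst gens).

Local Notation evm k := (@npeval R 'M[R[i]]_k (@msc R k) (@mxadjoint R k k) n).

Lemma micro_good r (p : 'I_r -> bop H) (c theta del rho : R) :
  pfam bst MB p -> (0 < r)%N -> 1 <= c ->
  (forall l, opbd bst MB (tauB tau) c (gens l)) -> 0 < theta -> 0 < del -> 0 < rho ->
  evmic ip tau x rho (fun k a => exists w,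
    good (fun l i j => p i * gens l * p j != 0) (2 * c) theta
      (Num.truncn (k%:R ^+ 2 * (\sum_l \sum_(i < r) \sum_(j < r)
         (p i * gens l * p j != 0)%:R * (rtr (p i) * rtr (p j)) + del))) a w).
Proof.
move=> pp r0 c1 hc th0 del0 rho0.
have c0 : 0 < c by apply: lt_le_trans c1.
pose Z2 : R := 4 * r.+2%:R + 2.
pose Z1 : R := 3 * c ^+ 2 + 1 + 4 * r.+2%:R * rho ^+ 2 * (2 + 4 * r.+2%:R).
pose Z3 : R := 3 * (n%:R * r%:R * r%:R) * Z2.
have Z20 : 0 <= Z2 by rewrite addr_ge0// mulr_ge0.
have Z10 : 0 <= Z1.
  have r2 : 0 <= r.+2%:R :> R by [].
  apply: addr_ge0; first by apply: addr_ge0 => //; exact: (mulr_ge0 _ (sqr_ge0 c)).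
  have r3 : 0 <= 4 * r.+2%:R :> R by rewrite mulr_ge0.
  by apply: mulr_ge0; [apply: mulr_ge0 r3 (sqr_ge0 _)|apply: addr_ge0].
have Z30 : 0 <= Z3.
  by apply: mulr_ge0 Z20; rewrite mulr_ge0// -!natrM ler0n.
have th20 : 0 < (theta / 2) ^+ 2 by rewrite exprn_gt0// divr_gt0.
have [e1 e10 he1] := small_multiple Z10 th20.
have [e2 e20 he2] := small_multiple Z20 (ltr01 : 0 < (1 : R)).
have [e3 e30 he3] := small_multiple Z30 del0.
have th40 : 0 < theta / 4 by rewrite divr_gt0.
pose eta := Num.min 1 (Num.min (theta / 4) (Num.min e1 (Num.min e2 e3))).
have eta0 : 0 < eta by rewrite !lt_min ltr01 th40 e10 e20 e30.
have [eta1 etath eta_1 eta_2 eta_3] :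
    [/\ eta <= 1, eta <= theta / 4, eta <= e1, eta <= e2 & eta <= e3].
  by have := lexx eta; rewrite {2}/eta !le_min => /and5P[].
have [m hm] : exists m, 2 * c ^+ 2 / m.+1%:R <= (theta / 4) ^+ 2.
  have c20 : 0 < 2 * c ^+ 2 by rewrite mulr_gt0// exprn_gt0.
  have [m /(_ m (leqnn m)) hm] := invSn_lt (divr_gt0 (exprn_gt0 2 th40) c20).
  by exists m; rewrite mulrC -ler_pdivlMr// ltW.
have [g [h [hp hg h1]]] := family_polynomials tauM x_sa x_gen pp eta0.
have Mp := pf_D pp; have Mx := MB_gens x_gen; have Mev f := MB_ev ipH tauM x_gen f.
have eta20 : 0 < eta ^+ 2 by rewrite exprn_gt0.
have sx l : bst (gens l) = gens l by exact: gens_sadj.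
pose f1 l : npoly (R := R) (n := n) := np_var l ++ np_opp (np_star (np_var l)).
pose f2 l : npoly (R := R) (n := n) := np_exp (np_half (np_var l)) (2 * m).+2.
pose f3 (i : 'I_r) : npoly (R := R) (n := n) :=
  np_mul (np_half g ++ np_opp (np_const (i%:R : R)%:C)) (h i).
pose f4 : npoly (R := R) (n := n) :=
  np_const 1 ++ np_opp (flatten [seq h i | i <- enum 'I_r]).
pose f6 l (i j : 'I_r) : npoly (R := R) (n := n) :=
  np_mul (np_mul (np_mul (h i) (np_var l)) (h j)) (np_star (np_var l)).
have ev1 (A : pzRingType) sc0 st0 (X : 'I_n -> A) (s : star_alg sc0 st0) l :
    npeval sc0 st0 X (f1 l) = X l - st0 (X l).
  by rewrite ev_cat (ev_opp s) (ev_star s) (ev_var s).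
have ev2 (A : pzRingType) sc0 st0 (X : 'I_n -> A) (s : star_alg sc0 st0) l :
    npeval sc0 st0 X (f2 l) = (sc0 (2^-1 : R)%:C * (X l + st0 (X l))) ^+ (2 * m).+2.
  by rewrite (ev_exp s) ev_half// (ev_var s).
have ev3 (A : pzRingType) sc0 st0 (X : 'I_n -> A) (s : star_alg sc0 st0) i :
    npeval sc0 st0 X (f3 i) =
    (npeval sc0 st0 X (np_half g) - sc0 (i%:R : R)%:C) * npeval sc0 st0 X (h i).
  by rewrite (ev_mul s) ev_cat (ev_opp s) ev_const.
have ev4 (A : pzRingType) sc0 st0 (X : 'I_n -> A) (s : star_alg sc0 st0) :
    npeval sc0 st0 X f4 = 1 - \sum_i npeval sc0 st0 X (h i).
  by rewrite ev_cat (ev_opp s) ev_const (sa_sc1 s) ev_flatten big_enum.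
have ev6 (A : pzRingType) sc0 st0 (X : 'I_n -> A) (s : star_alg sc0 st0) l i j :
    npeval sc0 st0 X (f6 l i j) =
    npeval sc0 st0 X (h i) * X l * npeval sc0 st0 X (h j) * st0 (X l).
  by rewrite !(ev_mul s) (ev_star s) (ev_var s).
have sq f (t : R) : 0 <= t -> n2 (ev f) <= t ->
    evmic ip tau x rho (fun k a => (0 < k)%N -> norm2 (@mxadjoint R k k) (@ntrace R k) (evm k a f) <= t + eta).
  move=> t0 hf; apply: evmic_mono (transfer ipH tauM x_gen rho (np_mul (np_star f) f) eta20) _.
  move=> k a k0; have s := mx_star_alg (R := R) k; have trk := mx_tracial (R := R) k0.
  rewrite !(ev_mul sa) !(ev_star sa) !(ev_mul s) !(ev_star s) => ha _.
  rewrite -(ler_pXn2r (n:=2))// ?nnegrE ?n2_ge0 ?addr_ge0 ?(ltW eta0)//.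
  rewrite (n2_sqr trk)//.
  have h2 : rtr (bst (ev f) * ev f) <= t ^+ 2.
    by rewrite -(n2_sqr tr)// ler_pXn2r ?nnegrE ?n2_ge0.
  have h3 : 0 <= t * eta by rewrite mulr_ge0// ltW.
  rewrite sqrrD mulr2n; move: ha; rewrite ltr_norml => /andP[h4 _].
  by move: h2 h3 h4; move: (retrace _ _) (retrace _ _) (t * eta) => *; lra.
have Q0 : evmic ip tau x rho (fun k a => forall l, mx_opnorm (a l) <= rho).
  by exists 0%N, 1; split => // k a _ [].
have Q1 : evmic ip tau x rho (fun k a => forall l, (0 < k)%N ->
    norm2 (@mxadjoint R k k) (@ntrace R k) (a l - mxadjoint (a l)) <= eta).
  apply: evmic_all => l; have := sq (f1 l) 0 (lexx _).
  rewrite (ev1 _ _ _ _ sa) sx subrr (n20 tr) => /(_ (lexx _)) hq.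
  apply: evmic_mono hq _ => k a k0; rewrite add0r.
  by rewrite (ev1 _ _ _ _ (mx_star_alg k)).
have Q2 : evmic ip tau x rho (fun k a => forall l, (0 < k)%N ->
    retrace (@ntrace R k) ((msc k (2^-1 : R)%:C * (a l + mxadjoint (a l))) ^+ (2 * m).+2) <=
     c ^+ (2 * m).+2 + 1).
  apply: evmic_all => l.
  apply: evmic_mono (transfer ipH tauM x_gen rho (f2 l) (ltr01 : 0 < (1 : R))) _.
  move=> k a k0; rewrite (ev2 _ _ _ _ sa) (ev2 _ _ _ _ (mx_star_alg k)) sx.
  rewrite (half_half _ sa) => ha _.
  have h2 : rtr (gens l ^+ (2 * m).+2) <= c ^+ (2 * m).+2.
    have -> : (2 * m).+2 = (m.+1 * 2)%N by rewrite [RHS]mulSn [(m * 2)%N]mulnC.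
    have Mxm := D_exp tr m.+1 (Mx l).
    have sxm : bst (gens l ^+ m.+1) = gens l ^+ m.+1 by rewrite (stX sa) sx.
    rewrite !exprM; have -> : rtr ((gens l ^+ m.+1) ^+ 2) = n2 (gens l ^+ m.+1) ^+ 2.
      by rewrite (n2_sqr tr Mxm) sxm expr2.
    rewrite ler_pXn2r ?nnegrE ?n2_ge0 ?exprn_ge0 ?(ltW c0)//.
    have := (opbdX tr m.+1 (Mx l) (hc l)).2 1 (D_1 tr).
    by rewrite mulr1 (n21 tr) mulr1.
  move: ha; rewrite ltr_norml => /andP[h4 _].
  by move: h2 h4; move: (retrace _ _) (retrace _ _) => *; lra.
have Q3 : evmic ip tau x rho (fun k a => forall i : 'I_r, (0 < k)%N ->
    norm2 (@mxadjoint R k k) (@ntrace R k)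
      ((evm k a (np_half g) - msc k (i%:R : R)%:C) * evm k a (h i)) <= 2 * eta).
  apply: evmic_all => i; have := sq (f3 i) eta (ltW eta0).
  rewrite (ev3 _ _ _ _ sa) => /(_ (hg i)) hq.
  apply: evmic_mono hq _ => k a k0; rewrite (ev3 _ _ _ _ (mx_star_alg k)).
  by rewrite mulr_natl mulr2n.
have Q4 : evmic ip tau x rho (fun k a => (0 < k)%N ->
    norm2 (@mxadjoint R k k) (@ntrace R k) (1 - \sum_i evm k a (h i)) <= 2 * eta).
  have := sq f4 eta (ltW eta0); rewrite (ev4 _ _ _ _ sa) => /(_ h1) hq.
  apply: evmic_mono hq _ => k a k0; rewrite (ev4 _ _ _ _ (mx_star_alg k)).
  by rewrite mulr_natl mulr2n.
have Q5 : evmic ip tau x rho (fun k a => forall i : 'I_r, (0 < k)%N ->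
    `|retrace (@ntrace R k) (evm k a (h i)) - rtr (p i)| <= 2 * eta).
  apply: evmic_all => i.
  apply: evmic_mono (transfer ipH tauM x_gen rho (h i) eta0) _ => k a k0 ha _.
  have h2 : `|rtr (ev (h i)) - rtr (p i)| <= eta.
    rewrite -(rtrB tr (Mev _) (Mp i)).
    exact: le_trans (rtr_le tr (D_B tr (Mev _) (Mp i))) (hp i).
  apply: le_trans (ler_distD (rtr (ev (h i))) _ _) _.
  by rewrite mulr_natl mulr2n distrC; apply: lerD h2; exact: ltW.
have Q6 : evmic ip tau x rho (fun k a => forall lij : 'I_n * ('I_r * 'I_r), (0 < k)%N ->
    ~~ (p lij.2.1 * gens lij.1 * p lij.2.2 != 0) ->
    retrace (@ntrace R k) (evm k a (h lij.2.1) * a lij.1 * evm k a (h lij.2.2) * mxadjoint (a lij.1))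
     <= (3 * c ^+ 2 + 1) * eta).
  apply: evmic_all => -[l [i j]] /=.
  apply: evmic_mono (transfer ipH tauM x_gen rho (f6 l i j) eta0) _ => k a k0.
  rewrite (ev6 _ _ _ _ sa) (ev6 _ _ _ _ (mx_star_alg k)) sx => ha _ /negPn/eqP p0.
  set X := gens l in p0 ha; have MX : MB X := Mx l.
  have bX (y : bop H) : MB y -> n2 (X * y * X) <= c ^+ 2 * n2 y.
    move=> My; apply: le_trans (opbdr tr MX (ta_M tr MX My) (hc l)) _.
    by rewrite expr2 -mulrA ler_wpM2l ?(ltW c0)//; exact: (hc l).2.
  have MhX := ta_M tr (ta_M tr MX (Mev (h j))) MX.
  have Mdi := D_B tr (Mev (h i)) (Mp i); have Mdj := D_B tr (Mev (h j)) (Mp j).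
  have MdX := ta_M tr (ta_M tr MX Mdj) MX.
  have e : ev (h i) * X * ev (h j) * X =
     (ev (h i) - p i) * (X * ev (h j) * X) + p i * (X * (ev (h j) - p j) * X).
    have -> : p i * (X * (ev (h j) - p j) * X) =
        p i * (X * ev (h j) * X) - p i * X * p j * X.
      by rewrite mulrBr mulrBl mulrBr !mulrA.
    by rewrite p0 mul0r subr0 mulrBl subrK !mulrA.
  have hj2 : n2 (ev (h j)) <= 2.
    have := n2D tr Mdj (Mp j); rewrite subrK => hq; apply: le_trans hq _.
    by rewrite mulr2n; apply: lerD; [exact: le_trans (hp j) eta1|exact: (pf_n2_le1 tr)].
  have t1 : rtr ((ev (h i) - p i) * (X * ev (h j) * X)) <= eta * (c ^+ 2 * 2).
    apply: le_trans (ler_norm _) _; apply: le_trans (rtrM_le tr Mdi MhX) _.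
    apply: ler_pM; rewrite ?n2_ge0//; apply: le_trans (bX _ (Mev _)) _.
    by rewrite ler_wpM2l ?sqr_ge0.
  have t2 : rtr (p i * (X * (ev (h j) - p j) * X)) <= 1 * (c ^+ 2 * eta).
    apply: le_trans (ler_norm _) _; apply: le_trans (rtrM_le tr (Mp i) MdX) _.
    apply: ler_pM; rewrite ?n2_ge0 ?(pf_n2_le1 tr)//; apply: le_trans (bX _ Mdj) _.
    by rewrite ler_wpM2l ?sqr_ge0.
  move: ha; rewrite e (rtrD tr (ta_M tr Mdi MhX) (ta_M tr (Mp i) MdX)).
  rewrite ltr_norml => /andP[h4 _].
  move: t1 t2 h4; move: (retrace _ _) (retrace _ _) (retrace _ _) (c ^+ 2) => z1 z2 z3 c2.
  by lra.
have ht i : 0 <= rtr (p i) <= 1.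
  have -> : rtr (p i) = n2 (p i) ^+ 2.
    by rewrite (n2_sqr tr (Mp i)) (pf_st pp) (pf_idem pp).
  by rewrite sqr_ge0/= expr_le1 ?n2_ge0// (pf_n2_le1 tr).
apply: evmic_mono (evmic_and Q0 (evmic_and Q1 (evmic_and Q2 (evmic_and Q3
  (evmic_and Q4 (evmic_and Q5 Q6)))))) _ => k a k0 [a0 [a1 [a2 [a3 [a4 [a5 a6]]]]]].
apply: (matrix_good k0 (g := evm k a (np_half g)) (h := fun i => evm k a (h i))
  (rho := rho) (eta := eta) (m := m)) => //.
- exact: ltW.
- by move=> l; apply: mx_opnorm_opbd => //; exact: ltW.
- by move=> l; exact: a1.
- by move=> l; exact: a2.
- exact: st_half (mx_star_alg k).
- by move=> i; exact: a3.
- exact: a4.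
- by move=> i; exact: a5.
- by move=> l i j; exact: (a6 (l, (i, j)) k0).
- exact: he1.
- exact: he2.
- by rewrite mulrA; exact: he3.
Qed.

Definition pf_index r (p : 'I_r -> bop H) : R :=
  \sum_l \sum_(i < r) \sum_(j < r)
    (p i * gens l * p j != 0)%:R * (rtr (p i) * rtr (p j)).

Lemma pf_index_ge0 r (p : 'I_r -> bop H) : pfam bst MB p -> 0 <= pf_index p.
Proof.
move=> pp; do 3!(apply: sumr_ge0 => ? _); have t0 i : 0 <= rtr (p i).
  by rewrite -(pf_idem pp) -[X in X * _](pf_st pp) (rtr_ge0 tr (pf_D pp _)).
by rewrite mulr_ge0// mulr_ge0.
Qed.

Lemma K_eps_le r (p : 'I_r -> bop H) (del : R) :
  pfam bst MB p -> (0 < r)%N -> 0 < del ->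
  exists Q, 1 <= Q /\ forall eps, 0 < eps -> eps < 1 ->
    (K_eps ip tau x eps <=
      ((1 + (pf_index p + del)) * ln (Q / eps))%:E)%E.
Proof.
move=> pp r0 del0; set I0 := pf_index p; pose D := I0 + del; rewrite -/D.
have I00 : 0 <= I0 by exact: pf_index_ge0.
have D0 : 0 <= D by rewrite addr_ge0// ltW.
have [c [c1 hc]] : exists c, 1 <= c /\ forall l, opbd bst MB (tauB tau) c (gens l).
  have h l := MB_opbd_ex ipH tauM x_gen (MB_gens x_gen l).
  have [c hc] := choice h; exists (1 + \sum_l `|c l|); split.
    by rewrite lerDl sumr_ge0.
  move=> l; have cl : c l <= 1 + \sum_l `|c l|.
    rewrite (bigD1 l)//= addrCA; apply: le_trans (ler_norm _) _.
    by rewrite lerDl addr_ge0// sumr_ge0.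
  have [cl0 hl] := hc l; split=> [|y My]; first exact: le_trans cl.
  by apply: le_trans (hl _ My) _; rewrite ler_wpM2r// n2_ge0.
have alw_sym l i j : (p i * gens l * p j != 0) = (p j * gens l * p i != 0).
  suff h i' j' : p i' * gens l * p j' = 0 -> p j' * gens l * p i' = 0.
    by congr negb; apply/eqP/eqP; exact: h.
  move=> /(congr1 bst); rewrite !(sa_stM sa) !(pf_st pp) (gens_sadj ipH x_sa x_gen) (st0 sa).
  by rewrite mulrA.
have c0 : 0 <= 2 * c by rewrite mulr_ge0// (le_trans ler01).
have [Q [Q1 hQ]] := cover_parameters n r c0.
exists Q; split=> // eps e0 e1.
have [theta [d1 [d2 [T1 [T2 [[th0 d10 d20 T10 T20] hT1 hT2 heps [q1 q2]]]]]]] := hQ _ e0 e1.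
have Qe1 : 1 <= Q / eps by rewrite ler_pdivlMr// mul1r (le_trans (ltW e1)).
have lnQ0 : 0 <= ln (Q / eps) by rewrite ln_ge0.
apply: ge_ereal_sup => _ [rho rho0 <-].
have [m [gam [gam0 hm]]] := micro_good pp r0 c1 hc th0 del0 rho0.
apply: ge_ereal_inf; exists (K_micro ip tau x eps rho m gam); first by exists (m, gam).
apply: ge_ereal_inf; eexists; first by exists [set k | (0 < k)%N] => //; exists 1%N.
apply: ge_ereal_sup => _ [k k0 <-]; rewrite /= in k0.
set d := Num.truncn (k%:R ^+ 2 * D).
have hcov := good_cover k0 alw_sym (hm k ^~ k0) c0 (ltW th0) d10 d20 T10 T20 hT1 hT2 heps.
have k20 : 0 < k%:R ^+ 2 :> R by rewrite exprn_gt0// ltr0n.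
have hd : d%:R <= k%:R ^+ 2 * D 
  by have /truncn_itv/andP[] : 0 <= k%:R ^+ 2 * D by rewrite mulr_ge0// ltW.
apply: (@le_trans _ _ ((k%:R ^- 2)%:E * lne ((Q / eps) ^+ (k * k + d))%:E)%E).
  rewrite lee_pmul2l ?lte_fin ?invr_gt0//.
  have cv0 : (0 <= covering_number (@tuple_dist R n k) (@microstates _ _ ip tau n x rho m k gam) eps)%E.
    by apply: le_ereal_inf_tmp => _ [N _ <-]; rewrite lee_fin.
  have Q0 : 0 <= (Q / eps) ^+ (k * k + d) by rewrite exprn_ge0// (le_trans ler01).
  rewrite lee_lne ?in_itv/= ?cv0 ?leey ?lee_fin ?Q0//.
  apply: le_trans hcov _; rewrite lee_fin natrM exprD.
  have hp t (q : R) e : (0 < t)%N -> 2 * expR 1 * t.+1%:R <= q -> (#|codes e t|%:R : R) <= q ^+ e.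
    move=> t0 hq; apply: le_trans (card_codes e t0) _.
    have z0 : 0 <= 2 * expR 1 * t.+1%:R :> R by rewrite !mulr_ge0// expR_ge0.
    by apply: lerXn2r (hq); rewrite nnegrE// (le_trans z0).
  by apply: ler_pM => //; exact: hp.
have Qe0 : 0 < Q / eps by apply: lt_le_trans Qe1.
rewrite lne_EFin ?exprn_gt0// lnXn// -EFinM lee_fin.
rewrite -[ln _ *+ _]mulr_natl natrD natrM -expr2 mulrA ler_wpM2r// mulrDr.
by rewrite mulVf ?gt_eqF// lerD2l mulrC ler_pdivrMr// mulrC.
Qed.

Lemma delta0_le r (p : 'I_r -> bop H) :
  pfam bst MB p -> (0 < r)%N ->
  (delta0 ip tau x <= (1 + pf_index p)%:E)%E.
Proof.
move=> pp r0; set I0 := pf_index p; apply/lee_addgt0Pr => del del0.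
have del20 : 0 < del / 2 by rewrite divr_gt0.
have [Q [Q1 hQ]] := K_eps_le pp r0 del20; rewrite -/I0 in hQ.
have Q0 : 0 < Q by apply: lt_le_trans Q1.
have I00 : 0 <= I0 by exact: pf_index_ge0.
pose D := 1 + (I0 + del / 2); rewrite -/D in hQ.
have D0 : 0 < D by rewrite addr_gt0// ltr_wpDl.
have lQ : 0 <= ln Q by rewrite ln_ge0.
pose L := D * ln Q / (del / 2) + 1.
have L0 : 0 < L by rewrite ltr_wpDl// !mulr_ge0 ?(ltW D0)// invr_ge0 ltW.
apply: ge_ereal_inf; eexists.
  exists [set eps : R | 0 < eps /\ eps < expR (- L)] => //.
  near=> e; split; first by near: e; exact: nbhs_right_gt.
  by near: e; apply: nbhs_right_lt; exact: expR_gt0.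
apply: ge_ereal_sup => _ [eps [e0 eL] <-].
have lnL : L < - ln eps.
  by rewrite ltrNr -(expRK (- L)) ltr_ln ?posrE ?expR_gt0.
have ln0 : 0 < - ln eps by apply: lt_trans lnL.
have e1 : eps < 1 by apply: lt_trans eL _; rewrite expR_lt1 oppr_lt0.
rewrite -normrN gtr0_norm//; set y := - ln eps in lnL ln0 *.
apply: (@le_trans _ _ ((D * ln (Q / eps))%:E * (y^-1)%:E)%E).
  by rewrite lee_wpmul2r ?lee_fin ?invr_ge0 ?(ltW ln0)//; exact: hQ.
rewrite -EFinM -EFinD lee_fin ler_pdivrMr// ln_div ?posrE// -/y.
have h : D * ln Q <= del / 2 * y.
  rewrite [leRHS]mulrC -ler_pdivrMr//; apply: ltW; apply: le_lt_trans lnL.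
  by rewrite /L lerDl.
have -> : 1 + I0 + del = D + del / 2 by rewrite /D; field.
by rewrite [leLHS]mulrDr [leRHS]mulrDl [leLHS]addrC; apply: lerD.
Unshelve. all: by end_near. Qed.

Lemma partition_pfam P : proj_partition ip M P ->
  exists r (p : 'I_r -> bop H), [/\ pfam bst MB p, (0 < r)%N & I_part tau x P = pf_index p].
Proof.
move=> [/finite_set_enum[r [q [qI ->]]] hP orth sum1].
have Mq i : M (q i) by have [] := hP (q i) (ex_intro2 _ _ i I erefl).
pose p i := Bop (M_bounded x_gen (Mq i)); exists r, p.
have pp : pfam bst MB p.
  split=> [i|i|i|i j ij|]; first exact: Mq.
  - by apply: bop_inj; rewrite -adjointE; have [_ h _] := hP (q i) (ex_intro2 _ _ i I erefl).
  - by apply: bop_inj; rewrite bmul_fun; have [_ _ h] := hP (q i) (ex_intro2 _ _ i I erefl).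
  - have qij : q i \o q j = cst 0.
      by apply: orth; [exists i|exists j|move=> /qI/eqP; rewrite (negPf ij)].
    by apply: bop_ext => v; rewrite bop0E -[LHS]/((q i \o q j) v) qij.
  - apply: bop_ext => v; rewrite bop_sumE bop1E -[RHS]sum1 (@fsbig_injection _ _ _ q)//.
    by apply: eq_bigl => i; apply/esym/asboolP; exists i.
split=> //.
  rewrite lt0n; apply/eqP => r0; have := n21 tr; rewrite -(pf_sum pp) big1.
    by rewrite (n20 tr) => /eqP; rewrite eq_sym oner_eq0.
  by move=> i _; have := ltn_ord i; rewrite {2}r0.
apply: eq_bigr => l _; rewrite /I_op.
rewrite (@fsbig_injection _ _ _ (fun ij : 'I_r * 'I_r => (q ij.1, q ij.2))); last 2 first.
- by move=> [i j] [i' j'] [/qI/= -> /qI/= ->].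
- by move=> [f g] /= [[i _ <-] [j _ <-] _]; exists (i, j).
rewrite pair_big big_mkcond/=; apply: eq_bigr => -[i j] _ /=.
have -> : `[< [/\ range q (q i), range q (q j) & q i \o x l \o q j <> cst 0] >] =
    (p i * gens l * p j != 0).
  apply/asboolP/negP => [[_ _ h] /eqP/(congr1 (@bop_fun _ _)) p0|h].
    by apply: h; rewrite -[LHS]/(bop_fun (p i * gens l * p j)) p0; apply/funext => v; rewrite bop0E.
  split; [by exists i|by exists j|move=> q0; apply: h; apply/eqP; apply: bop_ext => v].
  by rewrite bop0E -[LHS]/((q i \o x l \o q j) v) q0.
by case: ifP => _; rewrite ?mul1r ?mul0r.
Qed.

Lemma trivial_partition : proj_partition ip M [set id].
Proof.
split=> [|_ ->|_ _ -> -> //|v]; first exact: finite_set1.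
  have M1 : M id by rewrite -(bop1_fun (H := H)); exact: (D_1 tr).
  split=> //.
  by rewrite /self_adjoint -(bop1_fun (H := H)) (adjointE ipH) (st1 sa).
by rewrite fsbig_set1.
Qed.

End FreeDimension.

Theorem corollary8p6 (R : realType) (H : completeNormedModType R[i])
    (ip : {dot H for Num.conj}) (H_hilbert : hilbert_space ip)
    (M : set (H -> H)) (M_II1 : II1_factor ip M)
    (tau : (H -> H) -> R[i]) (tau_trace : faithful_normal_trace ip M tau)
    (n : nat) (x : 'I_n -> H -> H) (x_inj : injective x)
    (x_sa : forall i, self_adjoint ip (x i))
    (x_gen : generates ip M x) :
  (delta0 ip tau x <= (1 + I_set ip M tau x)%:E)%E.
Proof.
have hI P := @partition_pfam _ _ _ H_hilbert _ _ tau_trace _ _ x_gen P.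
have inf0 : has_inf [set I_part tau x P | P in proj_partition ip M].
  split.
    by exists (I_part tau x [set id]), [set id] => //; exact: (trivial_partition H_hilbert tau_trace x_gen).
  by exists 0 => _ [P /hI[r [p [pp _ ->]]] <-]; exact: (pf_index_ge0 tau_trace).
apply/lee_addgt0Pr => del del0.
have [_ [P /hI[r [p [pp r0 IP]]] <-] hdel] := inf_adherent del0 inf0.
apply: le_trans (delta0_le tau_trace x_sa x_gen pp r0) _.
by rewrite -EFinD lee_fin -IP -addrA lerD2l; exact: ltW.
Qed.
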